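(* Let $(\mathbf{X},\|\cdot\|)$ be a separable, reflexive Banach space with dual $\mathbf{X}^*$, equipped with its Borel $\sigma$-field $\mathcal{X}$, and let $\mathbf{B}^*=\{f\in\mathbf{X}^*:\|f\|_*\le1\}$ be the dual unit ball. Let $n\in\mathbb{N}$, $\varepsilon\in[0,1/2)$, $\alpha\in(0,1)$. For an integer $1\le k<\frac n2$, let $\widehat{\mu}_{n,k}:\mathbf{X}^n\to\mathbf{X}$ be a function with $$\widehat{\mu}_{n,k}(x_{1:n})\in\operatorname*{arg\,min}_{\mu\in\mathbf{X}}\left(\sup_{f\in\mathbf{B}^*}\left|\widehat{T}_{n,k}(f,x_{1:n})-f(\mu)\right|\right)\qquad(x_{1:n}\in\mathbf{X}^n).$$ Suppose $$\phi := \frac{1}{n}\left(\lfloor \varepsilon n\rfloor + \left\lceil \ln\frac{2}{\alpha}\right\rceil \vee \left\lceil \frac{\left(\frac12-\varepsilon\right)\wedge\varepsilon}{2}\,n\right\rceil\right) < \frac12 .$$ Then for every probability measure $P$ over $(\mathbf{X},\mathcal{X})$ with $\mathbb{E}_{X\sim P}\|X\|<+\infty$, with mean $\mu_P$, and every $\varepsilon$-contaminated i.i.d. sample $X_{1:n}^{\varepsilon}$ from $P$, $$\mathbb{P}\left\{\left\|\widehat{\mu}_{n,\phi n}(X_{1:n}^{\varepsilon})-\mu_P\right\|\le\Phi_P\right\}\ge1-\alpha,$$ where $$\Phi_P = 2C_\varepsilon\left(8\,\mathbb{E}\left\|\frac1n\sum_{i=1}^nX_i-\mu_P\right\|+\inf_{q\in[1,2]}\nu_q\left(\frac{\ln\frac3\alpha}{n}\right)^{1-\frac1q}+\inf_{p\ge1}\nu_p\,\varepsilon^{1-\frac1p}\right),\qquad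 C_\varepsilon := 384\left(1+\frac{\varepsilon}{\varepsilon\wedge\left(\frac12-\varepsilon\right)}\right),$$ with $X_1,\dots,X_n$ i.i.d. from $P$ in the expectation, and $$\nu_p=\nu_p(\mathbf{B}^*,P):=\sup_{f\in\mathbf{B}^*}\left(\mathbb{E}_{X\sim P}|f(X-\mu_P)|^p\right)^{1/p}\in[0,+\infty].$$
   Context: Notation: $a\vee b=\max(a,b)$, $a\wedge b=\min(a,b)$; $x_{1:n}=(x_1,\dots,x_n)$. Mean: for $P$ with $\mathbb{E}_{X\sim P}\|X\|<\infty$, $\mu_P\in\mathbf{X}$ is the unique element with $f(\mu_P)=\mathbb{E}_{X\sim P}f(X)$ for all $f\in\mathbf{X}^*$. Trimmed mean: for an integer $1\le k<n/2$, a function $f:\mathbf{X}\to\mathbb{R}$ and $x_{1:n}\in\mathbf{X}^n$, $$\widehat{T}_{n,k}(f,x_{1:n}) := \frac{1}{n-2k}\sum_{i=k+1}^{n-k} f(x_{(i)}),$$ where $(\cdot)$ is a permutation of $[n]=\{1,\dots,n\}$ with $f(x_{(1)})\le\cdots\le f(x_{(n)})$. Contamination: a random element $X^{\varepsilon}_{1:n}$ of $\mathbf{X}^n$ is an $\varepsilon$-contaminated i.i.d. sample from $P$ if there exist (on the same probability space) i.i.d. $X_1,\dots,X_n$ with law $P$ such that $\#\{i\in[n]: X_i^{\varepsilon}\ne X_i\}\le \varepsilon n$. The probability in the conclusion is interpreted as an inner probability (the function $\widehat\mu_{n,k}$ need not be measurable). Conventions for $\varepsilon=0$: the ratio $\varepsilon/(\varepsilon\wedge(\frac12-\varepsilon))$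 is read as $1$ and the term $\inf_{p\ge1}\nu_p\varepsilon^{1-1/p}$ is read as $0$. *)

(* Defs.v *)
From HB Require Import structures.
From mathcomp Require Import all_boot all_order all_algebra perm.
From mathcomp Require Import all_classical all_reals all_analysis.

Set Implicit Arguments.
Unset Strict Implicit.
Unset Printing Implicit Defensive.

Import Order.TTheory GRing.Theory Num.Theory.
Import numFieldNormedType.Exports.

Local Open Scope classical_set_scope.
Local Open Scope ring_scope.

(** Banach spaces and duality *)

Section Duality.
Context (R : realType) (X : normedModType R).

Definition separable_space : Prop := exists2 D : set X, countable D & dense D.

(* The topological dual, as a set of functions; the pointwise lmodType
   structure on [X -> R^o] supplies its linear structure. *)
Definition dual : set (X -> R^o) := [set f | linear f /\ continuous f].

Definition dual_norm (f : X -> R^o) : \bar R :=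
  ereal_sup [set `|f x|%:E | x in [set x : X | `|x| <= 1]].

Definition dual_ball : set (X -> R^o) :=
  [set f | dual f /\ (dual_norm f <= 1)%E].

(* Bounded linear functionals on the dual; values outside [dual] are junk. *)
Definition bidual : set ((X -> R^o) -> R) :=
  [set Psi |
    (forall (a : R) f g, dual f -> dual g ->
       Psi (a *: f + g) = a * Psi f + Psi g) /\
    exists M : R, forall f, dual f -> (`|Psi f|%:E <= M%:E * dual_norm f)%E].

Definition reflexive_space : Prop :=
  forall Psi, bidual Psi -> exists x : X, forall f, dual f -> Psi f = f x.

End Duality.

Definition borel (R : realType) (X : normedModType R) :=
  g_sigma_algebraType (@open X).

(** The trimmed mean and the estimator *)

Section TrimmedMean.
Context (R : realType) (X : normedModType R) (n : nat).
Implicit Types (k : nat) (f : X -> R) (x : 'I_n -> X).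

(* The indices of the sample, listed by nondecreasing value of f. *)
Definition sorted_indices f x : seq 'I_n :=
  sort (relpre (f \o x) <=%R) (enum 'I_n).

(* [drop] and [take] keep the ranks k+1, ..., n-k. *)
Definition trimmed_mean k f x : R :=
  (n - 2 * k)%:R^-1 *
  \sum_(i <- take (n - 2 * k) (drop k (sorted_indices f x))) f (x i).

(* The value does not depend on the sorting permutation; ranks start at 0. *)
Lemma trimmed_meanE k f x (s : {perm 'I_n}) :
  {homo (fun i => f (x (s i))) : i j / (i <= j)%N >-> i <= j} ->
  trimmed_mean k f x =
  (n - 2 * k)%:R^-1 * \sum_(i < n | (k <= i < n - k)%N) f (x (s i)).
Proof.
move=> s_mono; rewrite /trimmed_mean; congr (_ * _).
pose v := [seq f (x (s i)) | i <- enum 'I_n].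
have vE : [seq f (x i) | i <- sorted_indices f x] = v.
  apply: (@sorted_eq _ <=%R); [exact: le_trans|exact: le_anti| | |].
  - by rewrite sorted_map; apply: sort_sorted => i j; exact: le_total.
  - rewrite /v sorted_map; apply: (@sub_sorted _ (relpre val leq)).
      by move=> i j; exact: s_mono.
    by rewrite -sorted_map val_enum_ord; exact: iota_sorted.
  - rewrite /v (map_comp (f \o x) s) (_ : map _ _ = [seq (f \o x) i | i <-
      sorted_indices f x])//; apply: perm_map.
    rewrite perm_sort; apply: uniq_perm; rewrite ?enum_uniq//.
      by rewrite map_inj_uniq ?enum_uniq//; exact: perm_inj.
    move=> i; rewrite mem_enum; apply/esym/mapP; exists (s^-1%g i).
      by rewrite mem_enum.
    by rewrite permKV.
have size_v : size v = n by rewrite size_map size_enum_ord.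
rewrite -(big_map (f \o x) xpredT id) map_take map_drop vE.
have -> : \sum_(i < n | (k <= i < n - k)%N) f (x (s i)) =
          \sum_(k <= i < n - k) v`_i.
  rewrite (big_nat_widen _ _ n) ?leq_subr// (big_nat_widenl _ 0)// big_mkord.
  apply: eq_big => [i|i _]; first by rewrite andbC.
  by rewrite (nth_map i) ?size_enum_ord// nth_ord_enum.
rewrite -[in RHS](add0n k) big_addn -subnDA addnn -mul2n (big_nth 0).
rewrite size_takel; last by rewrite size_drop size_v leq_sub2l// leq_pmull.
by apply: eq_big_nat => i /andP[_ i_lt]; rewrite nth_take// nth_drop addnC.
Qed.

Definition trimmed_loss k x (m : X) : \bar R :=
  ereal_sup [set `|trimmed_mean k f x - f m|%:E | f in @dual_ball R X].

Definition is_trimmed_estimator k (muhat : ('I_n -> X) -> X) : Prop :=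
  forall x m, (trimmed_loss k x (muhat x) <= trimmed_loss k x m)%E.

End TrimmedMean.

(** Probability *)

Definition inner_probability (d : measure_display) (Omega : measurableType d)
    (R : realType) (Pr : probability Omega R) (A : set Omega) : \bar R :=
  ereal_sup [set Pr E | E in [set E | measurable E /\ E `<=` A]].

Section Sampling.
Context (d : measure_display) (Omega : measurableType d) (R : realType).
Context (Pr : probability Omega R) (X : normedModType R) (n : nat).
Implicit Types (P : probability (borel X) R) (Z : 'I_n -> {RV Pr >-> borel X}).

Definition mutually_independent Z : Prop :=
  forall (J : {set 'I_n}) (A : 'I_n -> set (borel X)),
    (forall i, measurable (A i)) ->
    Pr (\bigcap_(i in [set` J]) (Z i @^-1` A i)) =
    (\prod_(i in J) Pr (Z i @^-1` A i))%E.

Definition iid P Z : Prop :=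
  mutually_independent Z /\
  forall i (A : set (borel X)), measurable A -> distribution Pr (Z i) A = P A.

(* X is separable where this is used, so that random elements of X^n are the
   families of random elements of X. As usual for random variables, the bound
   on the number of contaminated indices is required almost surely. *)
Definition contaminated_iid (eps : R) P (Y : 'I_n -> {RV Pr >-> borel X}) :
    Prop :=
  exists2 Z, iid P Z &
    {ae Pr, forall w, #|[pred i | (Y i w : X) != Z i w]|%:R <= eps * n%:R}.

(* E || (Z_1 + ... + Z_n) / n - m || *)
Definition expected_deviation (Z : 'I_n -> {RV Pr >-> borel X}) (m : X) :
    \bar R :=
  (\int[Pr]_w `|n%:R^-1 *: (\sum_(i < n) (Z i w : X)) - m|%:E)%E.

End Sampling.

(** The quantities of the error bound *)

Section Bound.
Context (R : realType) (X : normedModType R).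
Implicit Types (P : probability (borel X) R) (eps alpha : R) (n : nat).

(* The Pettis mean; it exists when X is reflexive and E||X|| is finite. *)
Definition mean P : X :=
  get [set m : X | forall f, dual f ->
         (\int[P]_x (f (x : X))%:E = (f m)%:E)%E].

Definition nu P (p : R) : \bar R :=
  ereal_sup [set Lnorm P p%:E (fun x => (f ((x : X) - mean P))%:E)
            | f in @dual_ball R X].

Definition fluctuation_term P n alpha : \bar R :=
  ereal_inf [set (nu P q * ((ln (3 / alpha) / n%:R) `^ (1 - q^-1))%:E)%E
            | q in [set q : R | 1 <= q <= 2]].

Definition contamination_term P eps : \bar R :=
  if eps == 0 then 0%E else
  ereal_inf [set (nu P p * (eps `^ (1 - p^-1))%:E)%E
            | p in [set p : R | 1 <= p]].

End Bound.

Section Constants.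
Context (R : realType).
Implicit Types (eps alpha : R) (n : nat).

(* The integer phi * n. The arguments of floor and ceil are nonnegative when
   0 <= eps < 1/2 and 0 < alpha < 1, so that taking absolute values is only a
   conversion from int to nat. *)
Definition trim_level n eps alpha : nat :=
  let shift := Num.floor (eps * n%:R) in
  let tail := Num.ceil (ln (2 / alpha)) in
  let frac := Num.ceil (Num.min (2^-1 - eps) eps / 2 * n%:R) in
  (`|shift| + maxn `|tail| `|frac|)%N.

Definition phi n eps alpha : R := n%:R^-1 * (trim_level n eps alpha)%:R.

Definition C_const eps : R :=
  384 * (1 + (if eps == 0 then 1 else eps / Num.min eps (2^-1 - eps))).

End Constants.

(* [dev] stands for E || (X_1 + ... + X_n) / n - mean P ||. *)
Definition error_bound (R : realType) (X : normedModType R)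
    (P : probability (borel X) R) (n : nat) (eps alpha : R) (dev : \bar R) :
    \bar R :=
  ((2 * C_const eps)%:E *
   (8%:E * dev + fluctuation_term P n alpha + contamination_term P eps))%E.

(* Main.v *)
Require Import Defs.
From HB Require Import structures.
From mathcomp Require Import all_boot all_order all_algebra.
From mathcomp Require Import all_classical all_reals all_analysis.
From mathcomp Require Import measurable_realfun ring lra zify.

(** A minimiser of the trimmed loss cannot have a larger loss than the mean
    itself, so its distance to the mean is at most twice the largest value of
    |T(f) - f (mean P)| over the dual ball, T(f) being the trimmed mean
    ([trimmed_estimator_error], with norms recovered by [norming_functional]).
    It remains to bound these errors uniformly in f. The trimming level is
    k = e + t, where e bounds the number of contaminated observations.

    Suppose that, for each f, at most t of the clean values f (X_i - mean P)
    exceed a level M in absolute value. Then at most k of the observed values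
    do, the values that survive trimming lie in [-M, M], and
    (n - 2 k) (T(f) - f (mean P)) is the sum of the truncated clean values up to
    4 k M ([trimmed_mean_stable]). If k
    is at least n / 4 then M itself is an affordable error; otherwise eps < 1/4
    and more than half of the sample survives ([error_budget]). Two facts are
    needed, uniformly in f: few values exceed M, and the truncated sums are
    small.

    The level M is of order A n / t + nu_r (n / t)^(1/r), where A is the
    expected deviation of the sample mean in norm, and r = q or r = p according
    to whether the logarithm or eps makes up t. At this level the expected
    number of values beyond M is a small multiple of t, by Markov's inequality
    for one functional and by symmetrization and contraction for the fluctuation
    over all of them. Deviations with probability exp (- t) are therefore
    Poissonian, and crude moment generating functions suffice. Those come from
    the entropy method: entropy is subadditive over independent coordinates
    ([ent_tensorization]), and [herbst] integrates the resulting differential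
    inequalities. Counts are self-bounding ([self_bounding_mgf], [count_tail]).
    For truncated sums the entropy is controlled by their quadratic variation,
    which is again self-bounding and is split off by duality ([maxf_sum_mgf],
    [clip_sum_tail]).

    These estimates are made on finite product spaces. Finitely many functionals
    are discretized by functions with finitely many values that shrink absolute
    values, so moments do not increase and A changes by little; by independence
    the coded sample has exactly a product law ([coded_law]). For each N this
    gives a measurable event, of probability at least 1 - alpha, for the first N
    functionals of a countable family that is pointwise dense in the dual ball
    ([dual_ball_separable]), at precision 1 / N and with exponents p, q that
    attain the infima up to 1 / N ([precision_event]). Infinitely many of these
    events occur together with probability at least 1 - alpha, and when they do,
    passing to the limit gives the bound for every f in the dual ball. *)

Set Implicit Arguments.
Unset Strict Implicit.
Unset Printing Implicit Defensive.

Import Order.TTheory GRing.Theory Num.Theory.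
Import numFieldNormedType.Exports.

Local Open Scope classical_set_scope.
Local Open Scope ring_scope.

(** * Expectations over finite product spaces *)

Section FiniteExpectation.
Context (R : realType).

Definition pmf (A : finType) (w : A -> R) : Prop :=
  (forall a, 0 <= w a) /\ \sum_a w a = 1.

Definition expect (A : finType) (w : A -> R) (G : A -> R) : R :=
  \sum_a w a * G a.

Section Basic.
Context (A : finType) (w : A -> R).
Implicit Types G H : A -> R.

Lemma eq_expect G H : G =1 H -> expect w G = expect w H.
Proof. by move=> GH; apply: eq_bigr => a _; rewrite GH. Qed.

Lemma expectD G H : expect w (fun a => G a + H a) = expect w G + expect w H.
Proof. by rewrite -big_split; apply: eq_bigr => a _; rewrite mulrDr. Qed.

Lemma expectZ (c : R) G : expect w (fun a => c * G a) = c * expect w G.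
Proof. by rewrite mulr_sumr; apply: eq_bigr => a _; rewrite mulrCA. Qed.

Lemma expectN G : expect w (fun a => - G a) = - expect w G.
Proof. by rewrite -sumrN; apply: eq_bigr => a _; rewrite mulrN. Qed.

Lemma expectB G H : expect w (fun a => G a - H a) = expect w G - expect w H.
Proof. by rewrite -expectN -expectD. Qed.

Lemma expect_sum (I : finType) (G : I -> A -> R) :
  expect w (fun a => \sum_i G i a) = \sum_i expect w (G i).
Proof.
by rewrite exchange_big; apply: eq_bigr => a _; rewrite mulr_sumr.
Qed.

Lemma exchange_expect (B : finType) (v : B -> R) (G : A -> B -> R) :
  expect w (fun a => expect v (G a)) =
  expect v (fun b => expect w (fun a => G a b)).
Proof.
rewrite /expect; under eq_bigr do rewrite mulr_sumr.
rewrite exchange_big; apply: eq_bigr => b _; rewrite mulr_sumr.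
by apply: eq_bigr => a _; rewrite mulrCA.
Qed.

Hypothesis wP : pmf w.

Lemma expect_cst (c : R) : expect w (fun=> c) = c.
Proof. by rewrite /expect -mulr_suml wP.2 mul1r. Qed.

Lemma le_expect G H : (forall a, G a <= H a) -> expect w G <= expect w H.
Proof. by move=> GH; apply: ler_sum => a _; rewrite ler_wpM2l ?wP.1. Qed.

Lemma expect_ge0 G : (forall a, 0 <= G a) -> 0 <= expect w G.
Proof. by move=> G0; apply: sumr_ge0 => a _; rewrite mulr_ge0 ?wP.1. Qed.

Lemma expect_gt0 G : (forall a, 0 < G a) -> 0 < expect w G.
Proof.
move=> G0; rewrite lt_neqAle expect_ge0 ?andbT//; last by move=> a; exact: ltW.
apply/eqP => /esym E0.
have wG0 a : w a * G a = 0.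
  by apply: (psumr_eq0P _ E0) => // b _; rewrite mulr_ge0 ?wP.1// ltW.
have w0 a : w a = 0.
  by have /eqP := wG0 a; rewrite mulf_eq0 (gt_eqF (G0 a)) orbF => /eqP.
by have := wP.2; rewrite big1// => /eqP; rewrite eq_sym oner_eq0.
Qed.

Lemma expect_chernoff (Z : A -> R) (l x : R) (E : pred A) :
  0 <= l -> (forall a, E a -> x <= Z a) ->
  expect w (fun a => (E a)%:R) <= expR (- (l * x)) * expect w (fun a => expR (l * Z a)).
Proof.
move=> l0 EZ; rewrite -expectZ; apply: le_expect => a.
rewrite -expRD; have [Ea|_] := boolP (E a); last exact: expR_ge0.
by rewrite -expR0 ler_expR addrC subr_ge0 ler_wpM2l ?EZ.
Qed.

End Basic.

Section ProductSpace.
Context (T : finType) (n : nat).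
Implicit Types (p : T -> R) (x : {ffun 'I_n -> T}) (G : {ffun 'I_n -> T} -> R).

Definition prodw p x : R := \prod_i p (x i).

Definition upd x (i : 'I_n) (y : T) : {ffun 'I_n -> T} :=
  [ffun j => if j == i then y else x j].

Lemma upd_eq x i y : upd x i y i = y.
Proof. by rewrite ffunE eqxx. Qed.

Lemma upd_neq x i y j : j != i -> upd x i y j = x j.
Proof. by move=> /negPf ji; rewrite ffunE ji. Qed.

Lemma upd_upd x i y z : upd (upd x i y) i z = upd x i z.
Proof. by apply/ffunP => j; rewrite !ffunE; case: eqP. Qed.

Lemma upd_id x i : upd x i (x i) = x.
Proof. by apply/ffunP => j; rewrite !ffunE; case: eqP => [->|]. Qed.

Lemma prodw_pmf p : pmf p -> pmf (prodw p).
Proof.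
move=> pP; split; first by move=> x; apply: prodr_ge0 => i _; exact: pP.1.
rewrite -(bigA_distr_bigA (fun _ => p)) big1// => i _; exact: pP.2.
Qed.

Lemma prodw_upd p x i y : prodw p (upd x i y) * p (x i) = prodw p x * p y.
Proof.
rewrite /prodw (bigD1 i)//= [in RHS](bigD1 i)//= upd_eq.
rewrite (eq_bigr (fun j => p (x j))) => [|j ji]; last by rewrite upd_neq.
by ring.
Qed.

(** Exchanging the i-th coordinate with a fresh draw is an involution of the
    enlarged product space that preserves its weight. *)
Lemma expect_resample p i G : pmf p ->
  expect (prodw p) (fun x => expect p (fun y => G (upd x i y))) =
  expect (prodw p) G.
Proof.
move=> pP; pose F (q : {ffun 'I_n -> T} * T) := prodw p q.1 * (p q.2 * G q.1).
pose s (q : {ffun 'I_n -> T} * T) := (upd q.1 i q.2, q.1 i).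
have sK : involutive s by move=> [x y]; rewrite /s/= upd_eq upd_upd upd_id.
transitivity (\sum_q F q); last first.
  rewrite -(pair_big xpredT xpredT (fun x y => prodw p x * (p y * G x)))/=.
  apply: eq_bigr => x _; rewrite -mulr_sumr -mulr_suml pP.2 mul1r//.
rewrite (reindex_inj (inv_inj sK)) /expect/=.
under eq_bigr do rewrite mulr_sumr.
rewrite pair_big/=; apply: eq_bigr => -[x y] _; rewrite /F/s/=.
by rewrite !mulrA prodw_upd.
Qed.

Lemma expect_marginal p i (g : T -> R) : pmf p ->
  expect (prodw p) (fun x => g (x i)) = expect p g.
Proof.
move=> pP; rewrite -(expect_resample i)//.
under eq_expect => x do under eq_expect => y do rewrite upd_eq.
by rewrite expect_cst//; exact: prodw_pmf.
Qed.

End ProductSpace.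

(** * Entropy *)

Definition ent (A : finType) (w : A -> R) (F : A -> R) : R :=
  expect w (fun a => F a * ln (F a)) - expect w F * ln (expect w F).

Lemma ln_ge_1Vx (x : R) : 0 < x -> 1 - x^-1 <= ln x.
Proof.
by move=> x0; have := expR_ge1Dx (- ln x); rewrite expRN lnK//; lra.
Qed.

(** The tangent line of x ln x at c. Its mean bounds the entropy by an
    expression with a free constant c, which is how entropies of exponentials
    are estimated below. *)
Lemma mul_ln_ge (x c : R) : 0 < x -> 0 < c -> x * ln c + x - c <= x * ln x.
Proof.
move=> x0 c0; have := ln_ge_1Vx (divr_gt0 x0 c0).
rewrite ln_div// invf_div -(ler_pM2l x0) !mulrBr mulr1 mulrCA divff ?gt_eqF//.
by rewrite mulr1; lra.
Qed.

Section Entropy.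
Context (A : finType) (w : A -> R) (wP : pmf w).

Lemma ent_le (F : A -> R) (c : R) : (forall a, 0 < F a) -> 0 < c ->
  ent w F <= expect w (fun a => F a * ln (F a) - F a * ln c - F a + c).
Proof.
move=> F0 c0; rewrite expectD !expectB expect_cst//.
have -> : expect w (fun a => F a * ln c) = expect w F * ln c.
  by rewrite mulrC -expectZ; apply: eq_expect => a; rewrite mulrC.
have := mul_ln_ge (expect_gt0 wP F0) c0; rewrite /ent; lra.
Qed.

(** One half of the Gibbs variational principle. It is the mean of the tangent
    line inequality at the point E F * exp g. *)
Lemma ent_variational (F g : A -> R) : (forall a, 0 < F a) ->
  expect w (fun a => expR (g a)) <= 1 ->
  expect w (fun a => F a * g a) <= ent w F.
Proof.
move=> F0 g1; set c := expect w F.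
have c0 : 0 < c by exact: expect_gt0.
have Fg a : F a * g a <= F a * ln (F a) - ln c * F a - F a + c * expR (g a).
  have := mul_ln_ge (F0 a) (mulr_gt0 c0 (expR_gt0 (g a))).
  by rewrite lnM ?posrE ?expR_gt0// expRK mulrDr; lra.
apply: le_trans (le_expect wP Fg) _.
rewrite expectD !expectB !expectZ -/c /ent -/c.
have : c * expect w (fun a => expR (g a)) <= c by rewrite ler_piMr// ltW.
lra.
Qed.

(** Exchanging an exponential weight for an independent copy costs only the
    entropy of the weight. *)
Lemma ent_decoupling (F Q : A -> R) : (forall a, 0 < F a) ->
  expect w (fun a => F a * Q a) <=
  ent w F + expect w F * ln (expect w (fun a => expR (Q a))).
Proof.
move=> F0; set m := expect w (fun a => expR (Q a)).
have m0 : 0 < m by apply: expect_gt0 => // a; exact: expR_gt0.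
have := @ent_variational F (fun a => Q a - ln m) F0.
have -> : expect w (fun a => expR (Q a - ln m)) = 1.
  transitivity (m^-1 * m); last by rewrite mulVf ?gt_eqF.
  by rewrite -expectZ; apply: eq_expect => a; rewrite expRB lnK// mulrC.
move=> /(_ (lexx _)); rewrite (_ : expect w _ = expect w (fun a => F a * Q a) -
  expect w F * ln m); first lra.
rewrite [in RHS]mulrC -expectZ -expectB.
by apply: eq_expect => a; rewrite mulrBr [ln m * _]mulrC.
Qed.

(** By Jensen's inequality the entropy is at most the covariance of exp (l Z)
    and l Z, which is a mean over independent pairs (a, b), symmetric in a and
    b. Charging each pair to its larger exponential leaves only the pairs with
    Z b < Z a. *)
Lemma ent_exp_le (Z : A -> R) (l : R) : 0 <= l ->
  ent w (fun a => expR (l * Z a)) <= l ^+ 2 *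
    expect w (fun a => expR (l * Z a) *
      expect w (fun b => Num.max 0 (Z a - Z b) ^+ 2)).
Proof.
move=> l0; set F := fun a => expR (l * Z a).
have F0 a : 0 < F a by exact: expR_gt0.
pose cov := expect w (fun a => expect w (fun b => F a * (l * Z a - l * Z b))).
have entcov : ent w F <= cov.
  have -> : cov = expect w (fun a => F a * ln (F a)) -
                  expect w F * expect w (fun a => l * Z a).
    rewrite /cov [in RHS]mulrC -expectZ -expectB; apply: eq_expect => a.
    by rewrite expectZ expectB expect_cst// expRK mulrBr [_ * F a]mulrC.
  rewrite lerD2l lerN2 ler_wpM2l ?expect_ge0//; first by move=> a; exact: ltW.
  have ent1 : ent w (fun=> 1) = 0 by rewrite /ent !expect_cst// ln1 mulr0 subr0.
  have := @ent_variational (fun=> 1) (fun a => l * Z a - ln (expect w F)).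
  have -> : expect w (fun a => expR (l * Z a - ln (expect w F))) = 1.
    transitivity ((expect w F)^-1 * expect w F).
      rewrite -expectZ; apply: eq_expect => a.
      by rewrite expRB lnK ?posrE ?expect_gt0// mulrC.
    by rewrite mulVf ?gt_eqF ?expect_gt0.
  move=> /(_ (fun=> ltr01) (lexx _)); rewrite ent1 expectZ mul1r.
  by rewrite expectB expect_cst// subr_le0.
apply: le_trans entcov _.
pose D a b := l * Z a - l * Z b.
have Dl a b : D a b = l * (Z a - Z b) by rewrite /D mulrBr.
have cov2 : cov *+ 2 =
    expect w (fun a => expect w (fun b => (F a - F b) * D a b)).
  rewrite mulr2n {2}/cov exchange_expect -expectD; apply: eq_expect => a.
  by rewrite -expectD; apply: eq_expect => b; rewrite /D; ring.
have key a b : (F a - F b) * D a b <=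
    l ^+ 2 * (F a * Num.max 0 (Z a - Z b) ^+ 2) +
    l ^+ 2 * (F b * Num.max 0 (Z b - Z a) ^+ 2).
  wlog ba : a b / Z b <= Z a.
    move=> H; have /orP[|ab] := le_total (Z b) (Z a); first exact: H.
    rewrite [leRHS]addrC (_ : _ * D a b = (F b - F a) * D b a); first exact: H.
    by rewrite /D; ring.
  rewrite (max_r (_ : 0 <= Z a - Z b)) ?subr_ge0//.
  rewrite (max_l (_ : Z b - Z a <= 0)) ?subr_le0// expr0n/= !mulr0 addr0.
  have DF : F a - F b <= F a * D a b.
    have := expR_ge1Dx (- D a b); rewrite -(ler_pM2l (F0 a)) mulrDr mulr1.
    rewrite -expRD (_ : l * Z a + - D a b = l * Z b); last by rewrite /D; ring.
    by rewrite -/(F b); lra.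
  have D0 : 0 <= D a b by rewrite Dl mulr_ge0// subr_ge0.
  apply: le_trans (ler_wpM2r D0 DF) _.
  by rewrite le_eqVlt; apply/orP; left; apply/eqP; rewrite Dl; ring.
have : cov *+ 2 <= (l ^+ 2 * expect w (fun a => F a *
    expect w (fun b => Num.max 0 (Z a - Z b) ^+ 2))) *+ 2.
  rewrite cov2.
  apply: (@le_trans _ _ (expect w (fun a => expect w (fun b =>
      l ^+ 2 * (F a * Num.max 0 (Z a - Z b) ^+ 2) +
      l ^+ 2 * (F b * Num.max 0 (Z b - Z a) ^+ 2))))).
    by apply: le_expect => // a; apply: le_expect => // b; exact: key.
  rewrite le_eqVlt; apply/orP; left; apply/eqP.
  rewrite mulr2n -{1}expectZ -{1}expectZ exchange_expect.
  under eq_expect => a do rewrite expectD.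
  rewrite expectD; congr (_ + _).
    rewrite exchange_expect; apply: eq_expect => a.
    by rewrite !expectZ.
  apply: eq_expect => a.
  by rewrite !expectZ.
by rewrite ler_pMn2r.
Qed.

End Entropy.
End FiniteExpectation.

(** * Tensorization of entropy and Herbst's argument *)

Section Tensorization.
Context (R : realType) (T : finType) (n : nat) (p : T -> R) (pP : pmf p).
Implicit Types (F : {ffun 'I_n -> T} -> R) (x : {ffun 'I_n -> T}).

Definition average (i : 'I_n) F x : R := expect p (fun y => F (upd x i y)).

Definition averages (s : seq 'I_n) F : {ffun 'I_n -> T} -> R :=
  foldr average F s.

Lemma averages_gt0 s F x : (forall x, 0 < F x) -> 0 < averages s F x.
Proof. by move=> F0; elim: s x => //= i s IH x; exact: expect_gt0. Qed.

Lemma expect_averages s F :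
  expect (prodw p) (averages s F) = expect (prodw p) F.
Proof. by elim: s => //= i s <-; exact: expect_resample. Qed.

Lemma averages_agree s F x x' : (forall i, i \notin s -> x i = x' i) ->
  averages s F x = averages s F x'.
Proof.
elim: s x x' => [|i s IH] x x' xx'; first by congr F; apply/ffunP => i; exact: xx'.
apply: eq_expect => y; apply: IH => j js; rewrite !ffunE; case: eqP => // /eqP ji.
by rewrite xx'// inE negb_or ji.
Qed.

Lemma average_upd i F x y : average i F (upd x i y) = average i F x.
Proof. by apply: eq_expect => z; rewrite upd_upd. Qed.

(** Subadditivity of entropy. The logarithm of F over its mean telescopes
    along successive averages over the coordinates; the increment for the
    coordinate i has conditional exponential mean one, so its F-weighted mean
    is at most the conditional entropy, by [ent_variational]. *)
Lemma ent_tensorization F : (forall x, 0 < F x) ->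
  ent (prodw p) F <=
  \sum_(i < n) expect (prodw p) (fun x => ent p (fun y => F (upd x i y))).
Proof.
move=> F0.
have partial s : expect (prodw p) (fun x => F x * (ln (F x) - ln (averages s F x)))
    <= \sum_(i <- s) expect (prodw p) (fun x => ent p (fun y => F (upd x i y))).
  elim: s => [|i s IH].
    rewrite big_nil; under eq_expect do rewrite subrr mulr0.
    by rewrite expect_cst//; exact: prodw_pmf.
  rewrite big_cons /=.
  set A := averages s F; set B := average i A.
  rewrite (@eq_expect _ _ _ _ (fun x => F x * (ln (A x) - ln (B x)) +
    F x * (ln (F x) - ln (A x)))); last by move=> x; ring.
  rewrite expectD lerD// -(expect_resample i _ pP).
  apply: le_expect => [|x]; first exact: prodw_pmf.
  have B0 : 0 < B x by apply: expect_gt0 => // y; exact: averages_gt0.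
  have E1 : expect p (fun y => expR (ln (A (upd x i y)) - ln (B x))) <= 1.
    rewrite (@eq_expect _ _ _ _ (fun y => (B x)^-1 * A (upd x i y))).
      by rewrite expectZ -/(average i A x) -/B mulVf ?gt_eqF.
    move=> y; rewrite expRB !lnK ?posrE//; last exact: averages_gt0.
    by rewrite mulrC.
  apply: le_trans (ent_variational pP (fun y => F0 _) E1).
  by apply: le_expect => // y; rewrite /B average_upd.
have := partial (index_enum 'I_n); apply: le_trans.
have cstE x : averages (index_enum 'I_n) F x = expect (prodw p) F.
  rewrite -(expect_averages (index_enum 'I_n)).
  rewrite -[LHS](expect_cst (prodw_pmf n pP)); apply: eq_expect => x'.
  by apply: averages_agree => i; rewrite mem_index_enum.
rewrite [leRHS](@eq_expect _ _ _ _ (fun x => F x * ln (F x) -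
    ln (expect (prodw p) F) * F x)).
  by rewrite expectB expectZ [_ * expect _ _]mulrC.
by move=> x; rewrite cstE mulrBr [ln _ * _]mulrC.
Qed.

End Tensorization.

Section Herbst.
Context (R : realType) (A : finType) (w : A -> R) (wP : pmf w) (Z : A -> R).

Definition mgf (l : R) : R := expect w (fun a => expR (l * Z a)).
Definition dmgf (l : R) : R := expect w (fun a => Z a * expR (l * Z a)).

Lemma mgf_gt0 l : 0 < mgf l.
Proof. by apply: expect_gt0 => // a; exact: expR_gt0. Qed.

Lemma is_derive_sum_seq (I : Type) (s : seq I) (f df : I -> R -> R) (l : R) :
  (forall i, is_derive l 1 (f i) (df i l)) ->
  is_derive l 1 (fun l => \sum_(i <- s) f i l) (\sum_(i <- s) df i l).
Proof.
move=> fP; elim: s => [|i s IH].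
  rewrite big_nil (_ : (fun _ => _) = cst 0); first exact: is_derive_cst.
  by apply/funext => x; rewrite big_nil.
rewrite big_cons (_ : (fun _ => _) = f i + (fun l => \sum_(i <- s) f i l)).
  exact: is_deriveD.
by apply/funext => x; rewrite big_cons.
Qed.

Lemma is_derive_expsum (c : A -> R) (l : R) :
  is_derive l 1 (fun l => \sum_a c a * expR (l * Z a))
    (\sum_a c a * (Z a * expR (l * Z a))).
Proof.
apply: (@is_derive_sum_seq _ _ _ (fun a l => c a * (Z a * expR (l * Z a)))) => a.
have ZP : is_derive l 1 (fun l => l * Z a) (Z a).
  have := is_deriveZ (Z a) (is_derive_id l (1 : R)).
  rewrite (_ : Z a \*: id = fun l => l * Z a); last first.
    by apply/funext => x; exact: mulrC.
  by move=> P; apply: is_derive_eq P _; exact: mulr1.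
have eP := @is_derive1_comp _ expR _ l _ _ (is_derive_expR (l * Z a)) ZP.
have := is_deriveZ (c a) eP.
rewrite (_ : c a \*: _ = fun l => c a * expR (l * Z a)) => [P|]; last first.
  by apply/funext.
by apply: is_derive_eq P _; rewrite [expR _ * _]mulrC.
Qed.

Lemma is_derive_mgf (l : R) : is_derive l 1 mgf (dmgf l).
Proof. exact: is_derive_expsum. Qed.

Lemma dmgf0 : dmgf 0 = expect w Z.
Proof. by apply: eq_expect => a; rewrite mul0r expR0 mulr1. Qed.

Lemma continuous_dmgf : continuous dmgf.
Proof.
move=> l; apply/differentiable_continuous/derivable1_diffP.
rewrite (_ : dmgf = fun l => \sum_a (w a * Z a) * expR (l * Z a)).
  by have [] := is_derive_expsum (fun a => w a * Z a) l.
by apply/funext => x; apply: eq_bigr => a _; rewrite mulrA.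
Qed.

Lemma ln_mgf_le l : ln (mgf l) <= l * dmgf l.
Proof.
apply: (@le_trans _ _ (mgf l - 1)).
  have := ln_ge_1Vx (_ : 0 < (mgf l)^-1).
  by rewrite invr_gt0 mgf_gt0 lnV ?posrE ?mgf_gt0// invrK => /(_ isT); lra.
rewrite -(expect_cst wP 1) -expectB -expectZ; apply: le_expect => // a.
have := expR_ge1Dx (- (l * Z a)).
rewrite -(ler_pM2r (expR_gt0 (l * Z a))) -expRD addNr expR0; lra.
Qed.

(** Herbst's argument with a general comparison function u: a differential
    inequality makes (ln mgf - k l^2) / u nonincreasing, and its limit at 0+ is
    at most the mean. *)
Lemma herbst (u du : R -> R) (k b m : R) : 0 < b -> 0 <= k -> 0 <= m ->
  expect w Z <= m ->
  (forall l : R, 0 < l <= b -> is_derive l 1 u (du l)) ->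
  (forall l : R, 0 < l <= b -> l <= u l) ->
  (forall l : R, 0 < l <= b -> (dmgf l / mgf l - 2 * k * l) * u l <=
                            (ln (mgf l) - k * l ^+ 2) * du l) ->
  ln (mgf b) - k * b ^+ 2 <= u b * m.
Proof.
move=> b0 k0 m0 EZ u' lu H.
pose psi (l : R) := ln (mgf l) - k * l ^+ 2.
have u0 (l : R) : 0 < l <= b -> 0 < u l.
  by move=> lb; apply: lt_le_trans (lu _ lb); case/andP: lb.
have psi' (l : R) : is_derive l 1 psi (dmgf l / mgf l - 2 * k * l).
  have lnP := @is_derive1_comp _ (@ln R) _ l _ _ (is_derive1_ln (mgf_gt0 l)) (is_derive_mgf l).
  have sqP := is_deriveZ k (is_deriveX 2 (is_derive_id l (1 : R))).
  have := is_deriveB lnP sqP.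
  rewrite (_ : _ - _ = psi) => [P|]; last by apply/funext => x; rewrite /psi/=.
  apply: is_derive_eq P _; rewrite /GRing.scale/=; field.
  by rewrite gt_eqF ?mgf_gt0.
pose D (l : R) := psi l * (u l)^-1.
have D' (l : R) : 0 < l <= b ->
    is_derive l 1 D (((dmgf l / mgf l - 2 * k * l) * u l - psi l * du l) / u l ^+ 2).
  move=> lb; have u_neq0 : u l != 0 by rewrite gt_eqF// u0.
  have := is_deriveM (psi' l) (is_deriveV u_neq0 (u' l lb)).
  rewrite (_ : psi * _ = D) => [P|]; last by apply/funext.
  apply: is_derive_eq P _; rewrite /GRing.scale/=; field.
  by rewrite u_neq0 gt_eqF ?mgf_gt0.
have Dle (s : R) : 0 < s < b -> D b <= D s.
  move=> /andP[s0 sb]; rewrite -subr_le0.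
  have sub x : x \in `[s, b]%R -> 0 < x <= b.
    by rewrite in_itv/= => /andP[sx ->]; rewrite (lt_le_trans s0).
  have [||c cI ->] := @MVT_segment _ D (fun l =>
    ((dmgf l / mgf l - 2 * k * l) * u l - psi l * du l) / u l ^+ 2) s b (ltW sb).
  - by move=> x xI; apply: D'; apply: sub; exact: subset_itv_oo_cc.
  - apply: derivable_within_continuous => x xI.
    by have [] := D' x (sub _ xI).
  rewrite mulr_le0_ge0 ?subr_ge0 ?(ltW sb)// mulr_le0_ge0//.
    by rewrite subr_le0 H// sub.
  by rewrite invr_ge0 exprn_ge0// ltW// u0// sub.
suff Db : D b <= m.
  by rewrite -/(psi b) mulrC -ler_pdivrMr// u0// b0 lexx.
apply/ler_addgt0Pr => e e0.
have [r /= r0 rP] : exists2 r, 0 < r & forall s : R, 0 < s < r -> dmgf s <= m + e.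
  have : \forall s \near (0 : R), dmgf s < m + e.
    have /cvgr_lt : dmgf x @[x --> (0 : R)] --> dmgf 0 by exact: continuous_dmgf.
    by apply; rewrite dmgf0 (le_lt_trans EZ)// ltrDl.
  move=> /nbhs_ballP[r /= r0 rP]; exists r => // s /andP[s0 sr]; apply/ltW/rP.
  by rewrite /ball/= sub0r normrN gtr0_norm.
pose s := Num.min (b / 2) (r / 2).
have s0 : 0 < s by rewrite lt_min !divr_gt0.
have sb : s < b by rewrite gt_min ltr_pdivrMr// mulr_natr mulr2n ltrDl b0.
have sr : s < r.
  by rewrite gt_min [X in _ || X]ltr_pdivrMr// mulr_natr mulr2n ltrDl r0 orbT.
have sb' : 0 < s <= b by rewrite s0 ltW.
apply: le_trans (Dle s _) _; first by rewrite s0.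
rewrite ler_pdivrMr ?u0//.
have me0 : 0 <= m + e by rewrite addr_ge0// ltW.
apply: le_trans (_ : s * (m + e) <= _); last by rewrite mulrC ler_wpM2l// lu.
apply: (@le_trans _ _ (ln (mgf s))).
  by rewrite gerBl mulr_ge0// sqr_ge0.
apply: le_trans (ln_mgf_le s) _; rewrite ler_wpM2l ?(ltW s0)// rP// s0 sr.
by [].
Qed.

End Herbst.

(** * Self-bounding functionals and suprema of bounded sums *)

Section FiniteMax.
Context (R : realType) (J : finType) (j0 : J).
Implicit Types F G : J -> R.

Definition maxf F : R := F [arg max_(j > j0) F j]%O.

Lemma le_maxf F j : F j <= maxf F.
Proof. by rewrite /maxf; case: arg_maxP => // i _; exact. Qed.

Lemma maxf_attained F : exists j, maxf F = F j.
Proof. by eexists. Qed.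

Lemma maxf_le F c : (forall j, F j <= c) -> maxf F <= c.
Proof. exact. Qed.

Lemma le_maxf2 F G : (forall j, F j <= G j) -> maxf F <= maxf G.
Proof. by move=> FG; apply: maxf_le => j; exact: le_trans (FG j) (le_maxf _ _). Qed.

Lemma eq_maxf F G : F =1 G -> maxf F = maxf G.
Proof. by move=> /funext ->. Qed.

Lemma maxfD F G : maxf (fun j => F j + G j) <= maxf F + maxf G.
Proof. by apply: maxf_le => j; apply: lerD; exact: le_maxf. Qed.

Lemma maxfZ c F : 0 <= c -> maxf (fun j => c * F j) = c * maxf F.
Proof.
move=> c0; apply/eqP; rewrite eq_le; apply/andP; split.
  by apply: maxf_le => j; rewrite ler_wpM2l ?le_maxf.
by have [j ->] := maxf_attained F; exact: (le_maxf (fun j => c * F j)).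
Qed.

Lemma maxf_expect (A : finType) (w : A -> R) (F : A -> J -> R) : pmf w ->
  maxf (fun j => expect w (fun a => F a j)) <= expect w (fun a => maxf (F a)).
Proof.
by move=> wP; apply: maxf_le => j; apply: le_expect => // a; exact: le_maxf.
Qed.

End FiniteMax.

Lemma expR1_le3 (R : realType) : expR 1 <= 3 :> R.
Proof.
(* exp (- 1/6) >= 5/6, and (6/5)^6 < 3 *)
have h : expR (6^-1) <= 6 / 5 :> R.
  have := expR_ge1Dx (- 6^-1 : R); rewrite expRN => h.
  by rewrite -[leLHS]invrK -[leRHS]invrK lef_pV2 ?posrE ?invr_gt0 ?expR_gt0//; lra.
have -> : expR 1 = expR (6^-1) ^+ 6 :> R by rewrite -expRM_natl divff.
apply: (@le_trans _ _ ((6 / 5) ^+ 6)); last by lra.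
by rewrite lerXn2r ?nnegrE ?expR_ge0.
Qed.

Section SelfBounding.
Context (R : realType) (T : finType) (n : nat) (p : T -> R) (pP : pmf p).
Local Notation mu := (prodw p).
Implicit Types (Z : {ffun 'I_n -> T} -> R) (x : {ffun 'I_n -> T}).

Let muP : pmf (mu : {ffun 'I_n -> T} -> R). Proof. exact: prodw_pmf. Qed.

Lemma ent_mgf Z l : ent mu (fun x => expR (l * Z x)) =
  l * dmgf mu Z l - mgf mu Z l * ln (mgf mu Z l).
Proof.
rewrite /ent -/(mgf _ _ _) -expectZ; congr (_ - _); apply: eq_expect => x.
by rewrite expRK; ring.
Qed.

(** Functionals whose coordinate-wise decrements lie in [0, 1] and sum to at
    most the functional itself have Poissonian moment generating functions.
    The entropy of one coordinate is bounded by the choice of constant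
    exp (l * Zi i) in [ent_le]. *)
Lemma self_bounding_mgf Z (Zi : 'I_n -> {ffun 'I_n -> T} -> R) (b : R) :
  (forall i x y, Zi i (upd x i y) = Zi i x) ->
  (forall i x, 0 <= Z x - Zi i x <= 1) ->
  (forall x, \sum_(i < n) (Z x - Zi i x) <= Z x) ->
  0 < b -> ln (mgf mu Z b) <= (expR b - 1) * expect mu Z.
Proof.
move=> Ziupd D01 sumD b0.
have Z0 x : 0 <= Z x.
  by apply: le_trans (sumD x); apply: sumr_ge0 => i _; case/andP: (D01 i x).
have := @herbst _ _ mu muP Z (fun l => expR l - 1) expR 0 b (expect mu Z) b0.
rewrite mul0r subr0; apply => //.
- exact: expect_ge0.
- move=> l _; have := is_deriveB (is_derive_expR l) (is_derive_cst (1 : R) l 1).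
  rewrite subr0 (_ : expR - cst 1 = fun l => expR l - 1)//; exact/funext.
- by move=> l _; have := expR_ge1Dx l; lra.
move=> l /andP[l0 _]; rewrite mulr0 !mul0r !subr0.
pose F x := expR (l * Z x).
have F0 x : 0 < F x by exact: expR_gt0.
have entF : ent mu F <= (l - 1 + expR (- l)) * dmgf mu Z l.
  apply: le_trans (ent_tensorization pP F0) _.
  have step i : expect mu (fun x => ent p (fun y => F (upd x i y))) <=
      expect mu (fun x => (l - 1 + expR (- l)) * (F x * (Z x - Zi i x))).
    rewrite -[leRHS](expect_resample i)//; apply: le_expect => // x.
    apply: le_trans (ent_le pP (fun y => F0 _) (expR_gt0 (l * Zi i x))) _.
    apply: le_expect => // y; rewrite /F !expRK -(Ziupd i x y).
    set x' := upd x i y; set d := Z x' - Zi i x'; set z := Z x'.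
    have /andP[d0 d1] : 0 <= d <= 1 := D01 i x'.
    have -> : Zi i x' = z - d by rewrite /d /z; ring.
    have e0 := expR_gt0 (l * z).
    have cvx : expR (- (l * d)) <= 1 - d + d * expR (- l).
      have h1 := expR_ge1Dx (l * d); have h2 := expR_ge1Dx (l * d - l).
      have c0 := expR_gt0 (- (l * d)).
      have h1' : expR (- (l * d)) * (1 + l * d) <= 1.
        by rewrite -[leRHS](expR0 R) -(addNr (l * d)) expRD ler_wpM2l// ltW.
      have h2' : expR (- (l * d)) * (1 + (l * d - l)) <= expR (- l).
        rewrite [leRHS](_ : _ = expR (- (l * d)) * expR (l * d - l)).
          by rewrite ler_wpM2l// ltW.
        by rewrite -expRD; congr expR; ring.
      have := lerD (ler_wpM2l (_ : 0 <= 1 - d) h1') (ler_wpM2l d0 h2').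
      by rewrite subr_ge0 d1 => /(_ isT); lra.
    rewrite (_ : expR (l * (z - d)) = expR (l * z) * expR (- (l * d))); last first.
      by rewrite -expRD; congr expR; ring.
    have := ler_wpM2l (ltW e0) cvx; lra.
  apply: le_trans (ler_sum _ (fun i _ => step i)) _.
  rewrite -expect_sum -expectZ; apply: le_expect => // x.
  rewrite -mulr_sumr ler_wpM2l//; first by have := expR_ge1Dx (- l); lra.
  by rewrite -mulr_sumr mulrC ler_wpM2r// ltW.
rewrite ent_mgf in entF.
have m0 : 0 < mgf mu Z l by exact: mgf_gt0.
rewrite -(ler_pM2l m0) -(ler_pM2l (expR_gt0 (- l))).
have -> : expR (- l) * (mgf mu Z l * (dmgf mu Z l / mgf mu Z l * (expR l - 1))) =
   dmgf mu Z l * (1 - expR (- l)).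
  have ee : expR (- l) * expR l = 1 by rewrite -expRD addNr expR0.
  transitivity (dmgf mu Z l * (expR (- l) * expR l - expR (- l))).
    by field; rewrite gt_eqF.
  by rewrite ee.
have -> : expR (- l) * (mgf mu Z l * (ln (mgf mu Z l) * expR l)) =
   mgf mu Z l * ln (mgf mu Z l).
  have ee : expR (- l) * expR l = 1 by rewrite -expRD addNr expR0.
  by rewrite -[RHS]mul1r -ee; ring.
by lra.
Qed.

Context (J : finType) (j0 : J).

(** Dropping the coordinate i lowers the maximum by at most the i-th summand of
    a maximising member, and these summands add up to the maximum. *)
Lemma maxf_sum_self_bounding (h : J -> T -> R) (b : R)
    (Z := fun x => maxf j0 (fun f => \sum_(i < n) h f (x i))) :
  (forall f c, 0 <= h f c <= 1) -> 0 < b ->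
  ln (mgf mu Z b) <= (expR b - 1) * expect mu Z.
Proof.
move=> h01 b0.
pose Zi (i : 'I_n) x := maxf j0 (fun f => \sum_(j < n | j != i) h f (x j)).
have DZ i x f : Z x = \sum_(i < n) h f (x i) -> Z x - Zi i x <= h f (x i).
  move=> ->; rewrite (bigD1 i)//=.
  have := le_maxf j0 (fun f => \sum_(j < n | j != i) h f (x j)) f.
  by rewrite -/(Zi i x); lra.
apply: (@self_bounding_mgf _ Zi) => //.
- move=> i x y; apply: eq_maxf => f; apply: eq_bigr => j ji.
  by rewrite upd_neq.
- move=> i x; apply/andP; split.
    rewrite subr_ge0; apply: le_maxf2 => f; rewrite [leRHS](bigD1 i)//=.
    by rewrite lerDr; case/andP: (h01 f (x i)).
  have [f fP] := maxf_attained j0 (fun f => \sum_(i < n) h f (x i)).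
  by apply: le_trans (DZ i x f fP) _; case/andP: (h01 f (x i)).
- move=> x; have [f fP] := maxf_attained j0 (fun f => \sum_(i < n) h f (x i)).
  by rewrite [leRHS]fP; apply: ler_sum => i _; exact: DZ.
Qed.

(** A Bernstein-type moment bound for suprema of sums of functions bounded by
    one. Changing a coordinate changes the supremum by at most the change of
    the maximising sum, so the entropy is controlled by Q, the largest
    quadratic variation; Q is self-bounding, and [ent_decoupling] separates it
    from the exponential weight. *)
Lemma maxf_sum_mgf (g : J -> T -> R) (c : J -> R) (v q m : R)
    (Z := fun x => maxf j0 (fun f => \sum_(i < n) g f (x i) - c f)) :
  (forall f t, `|g f t| <= 1) ->
  (forall f, n%:R * expect p (fun t => g f t ^+ 2) <= v) -> 0 <= v ->
  expect mu (fun x => maxf j0 (fun f => \sum_(i < n) g f (x i) ^+ 2)) <= q ->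
  0 <= m -> expect mu Z <= m ->
  ln (mgf mu Z 2^-1) <= 2^-1 * m + (2 * q + v).
Proof.
move=> g1 gv v0 EQ m0 EZ.
pose Q x := maxf j0 (fun f => \sum_(i < n) g f (x i) ^+ 2).
have sq01 f t : 0 <= g f t ^+ 2 <= 1.
  rewrite sqr_ge0 -(real_normK (num_real (g f t))) /=.
  by rewrite -(expr1n R 2) lerXn2r ?nnegrE.
have q0 : 0 <= q.
  apply: le_trans EQ; apply: expect_ge0 => // x.
  by apply: le_trans (le_maxf _ _ j0); apply: sumr_ge0 => i _; exact: sqr_ge0.
have lnQ : ln (expect mu (fun x => expR (Q x))) <= 2 * q.
  have := maxf_sum_self_bounding sq01 ltr01; rewrite /mgf /= -/Q.
  rewrite (@eq_expect _ _ _ _ (fun x => expR (Q x))); last by move=> x; rewrite mul1r.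
  have := expR1_le3 R; have : 1 <= expR 1 :> R by rewrite -{1}(expR0 R) ler_expR.
  move=> h1 h3 h; apply: le_trans h _.
  apply: (@le_trans _ _ ((expR 1 - 1) * q)); first by rewrite ler_wpM2l ?subr_ge0.
  by rewrite ler_wpM2r//; lra.
pose k := 4 * (2 * q + v).
have := @herbst _ _ mu muP Z id (fun=> 1) k 2^-1 m.
rewrite (_ : k * 2^-1 ^+ 2 = 2 * q + v); last by rewrite /k; field.
move=> H; rewrite -lerBlDr; apply: H => //.
  by rewrite /k mulr_ge0// addr_ge0// mulr_ge0.
move=> l /andP[l0 l2].
pose F x := expR (l * Z x).
have F0 x : 0 < F x by exact: expR_gt0.
have mg0 : 0 < mgf mu Z l by exact: mgf_gt0.
have entF : ent mu F <= l ^+ 2 * expect mu (fun x => F x * (2 * Q x + 2 * v)).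
  apply: le_trans (ent_tensorization pP F0) _.
  pose D i x := expect p (fun y => Num.max 0 (Z x - Z (upd x i y)) ^+ 2).
  have step i : expect mu (fun x => ent p (fun y => F (upd x i y))) <=
      expect mu (fun x => l ^+ 2 * (F x * D i x)).
    rewrite -[leRHS](expect_resample i)//; apply: le_expect => // x.
    apply: le_trans (ent_exp_le pP (fun y => Z (upd x i y)) (ltW l0)) _.
    rewrite -expectZ; apply: le_expect => // y; rewrite /D.
    rewrite le_eqVlt; apply/orP; left; apply/eqP; congr (_ * (_ * _)).
    by apply: eq_expect => z; rewrite upd_upd.
  apply: le_trans (ler_sum _ (fun i _ => step i)) _.
  rewrite -expect_sum -expectZ; apply: le_expect => // x.
  rewrite -mulr_sumr ler_wpM2l ?sqr_ge0// -mulr_sumr ler_wpM2l ?(ltW (F0 x))//.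
  have [f fP] := maxf_attained j0 (fun f => \sum_(i < n) g f (x i) - c f).
  have DP i : D i x <= 2 * g f (x i) ^+ 2 + 2 * expect p (fun y => g f y ^+ 2).
    rewrite -[X in X + _](expect_cst pP) -expectZ -expectD.
    apply: le_expect => // y.
    have dZ : Z x - Z (upd x i y) <= g f (x i) - g f y.
      have := le_maxf j0 (fun f => \sum_(j < n) g f (upd x i y j) - c f) f.
      rewrite -/(Z (upd x i y)) (fP : Z x = _) /= (bigD1 i)//= [X in _ -> X - _ - _ <= _](bigD1 i)//=.
      rewrite upd_eq (eq_bigr (fun j => g f (x j))); first lra.
      by move=> j ji; rewrite upd_neq.
    apply: (@le_trans _ _ ((g f (x i) - g f y) ^+ 2)).
      case: (leP 0 (Z x - Z (upd x i y))) => [d0|d0]; last by rewrite expr0n/= sqr_ge0.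
      by rewrite lerXn2r ?nnegrE// (le_trans d0).
    have := sqr_ge0 (g f (x i) + g f y); rewrite !expr2; lra.
  apply: le_trans (ler_sum _ (fun i _ => DP i)) _.
  rewrite big_split/= -mulr_sumr lerD//.
    by rewrite ler_wpM2l//; exact: (le_maxf j0 (fun f => \sum_(i < n) g f (x i) ^+ 2)).
  rewrite sumr_const card_ord -[leLHS]mulr_natl mulrCA ler_wpM2l//; exact: gv.
have dec := ent_decoupling muP Q F0.
have EF : expect mu F = mgf mu Z l by [].
rewrite EF in dec.
have dec' : expect mu (fun x => F x * Q x) <= ent mu F + mgf mu Z l * (2 * q).
  by apply: le_trans dec _; rewrite lerD2l ler_wpM2l// ltW.
have E2 : expect mu (fun x => F x * (2 * Q x + 2 * v)) =
    2 * expect mu (fun x => F x * Q x) + 2 * v * mgf mu Z l.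
  by rewrite -EF -!expectZ -expectD; apply: eq_expect => x; ring.
have l2' : l ^+ 2 <= 4^-1.
  rewrite (_ : 4^-1 = 2^-1 ^+ 2 :> R); last by field.
  by rewrite lerXn2r ?nnegrE// ltW.
have ent0 : 0 <= ent mu F.
  have := ent_variational muP (g := fun=> 0) F0.
  rewrite expR0 expect_cst// (@eq_expect _ _ _ _ (fun=> 0)).
    by rewrite expect_cst//; apply.
  by move=> x; rewrite mulr0.
have entF' : ent mu F <= k * l ^+ 2 * mgf mu Z l.
  rewrite E2 in entF.
  have h1 := ler_wpM2l (sqr_ge0 l) dec'.
  have h2 := ler_wpM2r ent0 l2'.
  by rewrite /k; lra.
rewrite ent_mgf in entF'; rewrite mulr1 -(ler_pM2l mg0).
rewrite (_ : mgf mu Z l * _ = l * dmgf mu Z l - 2 * k * l ^+ 2 * mgf mu Z l).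
  by lra.
by field; rewrite gt_eqF.
Qed.

End SelfBounding.

(** * Symmetrization and contraction *)

Section Rademacher.
Context (R : realType).

Definition coin (b : bool) : R := 2^-1.
Definition sgb (b : bool) : R := (-1) ^+ b.

Lemma coin_pmf : pmf coin.
Proof. split=> [b|]; first by rewrite invr_ge0.
by rewrite big_bool /coin/=; field.
Qed.

Lemma expect_coin (G : bool -> R) : expect coin G = 2^-1 * (G true + G false).
Proof. by rewrite /expect big_bool mulrDr. Qed.

Lemma normr_sgb b : `|sgb b| = 1.
Proof. exact: normr_sign. Qed.

Context (J : finType) (j0 : J) (n : nat).
Local Notation signs := (prodw coin : {ffun 'I_n -> bool} -> R).

Let signsP : pmf signs. Proof. exact: prodw_pmf coin_pmf. Qed.

(** If f and g are maximisers on the left, then on the right the same pair, or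
    the pair exchanged, does at least as well, according to the sign of
    a f - a g. *)
Lemma contraction1 (r a b : J -> R) :
  (forall f g, `|b f - b g| <= `|a f - a g|) ->
  maxf j0 (fun f => r f + b f) + maxf j0 (fun f => r f - b f) <=
  maxf j0 (fun f => r f + a f) + maxf j0 (fun f => r f - a f).
Proof.
move=> ba; have [f ->] := maxf_attained j0 (fun f => r f + b f).
have [g ->] := maxf_attained j0 (fun f => r f - b f).
have := ba f g; have := ler_norm (b f - b g).
have [fg|gf] := leP (a g) (a f).
  rewrite (ger0_norm (_ : 0 <= a f - a g)) ?subr_ge0//.
  have := le_maxf j0 (fun f => r f + a f) f.
  by have := le_maxf j0 (fun f => r f - a f) g; lra.
rewrite (ltr0_norm (_ : a f - a g < 0)) ?subr_lt0//.
have := le_maxf j0 (fun f => r f + a f) g.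
by have := le_maxf j0 (fun f => r f - a f) f; lra.
Qed.

(** The contraction principle for one-sided maxima. One coordinate is replaced
    at a time, averaging over its sign, by [contraction1]. *)
Lemma contraction (L : R) (phi : R -> R) (a : 'I_n -> J -> R) : 0 < L ->
  (forall x y, `|phi x - phi y| <= L * `|x - y|) ->
  expect signs (fun e => maxf j0 (fun f => \sum_(i < n) sgb (e i) * phi (a i f))) <=
  L * expect signs (fun e => maxf j0 (fun f => \sum_(i < n) sgb (e i) * a i f)).
Proof.
move=> L0 phiL; rewrite -expectZ.
pose b (k : nat) (i : 'I_n) f := if (i < k)%N then L * a i f else phi (a i f).
pose H k := expect signs (fun e => maxf j0 (fun f => \sum_(i < n) sgb (e i) * b k i f)).
have stepH k : (k < n)%N -> H k <= H k.+1.
  move=> kn; pose i0 := Ordinal kn.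
  rewrite /H -[leLHS](expect_resample i0 _ coin_pmf) -[leRHS](expect_resample i0 _ coin_pmf).
  apply: le_expect => // e; rewrite !expect_coin ler_wpM2l ?invr_ge0//.
  pose r f := \sum_(i < n | i != i0) sgb (e i) * b k i f.
  have sumE k' y f : (k' = k \/ k' = k.+1) ->
      \sum_(i < n) sgb (upd e i0 y i) * b k' i f = r f + sgb y * b k' i0 f.
    move=> k'P; rewrite (bigD1 i0)//= upd_eq addrC; congr (_ + _).
    apply: eq_bigr => i ii0; rewrite upd_neq//; congr (_ * _).
    rewrite /b; case: k'P => ->//; rewrite ltnS leq_eqVlt.
    by rewrite (_ : (i == k :> nat) = false)//; exact/negbTE.
  have maxE k' y : (k' = k \/ k' = k.+1) ->
      maxf j0 (fun f => \sum_(i < n) sgb (upd e i0 y i) * b k' i f) =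
      maxf j0 (fun f => r f + sgb y * b k' i0 f).
    by move=> k'P; apply: eq_maxf => f; exact: sumE.
  rewrite !maxE; try by [left|right].
  have bk f : b k i0 f = phi (a i0 f) by rewrite /b ltnn.
  have bk1 f : b k.+1 i0 f = L * a i0 f by rewrite /b ltnSn.
  have sF k' : maxf j0 (fun f => r f + sgb false * b k' i0 f) =
               maxf j0 (fun f => r f + b k' i0 f).
    by apply: eq_maxf => f; rewrite /sgb expr0 mul1r.
  have sT k' : maxf j0 (fun f => r f + sgb true * b k' i0 f) =
               maxf j0 (fun f => r f - b k' i0 f).
    by apply: eq_maxf => f; rewrite /sgb expr1 mulN1r.
  rewrite !sF !sT addrC [leRHS]addrC; apply: contraction1 => f g.
  by rewrite !bk !bk1 -mulrBr normrM (gtr0_norm L0).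
have Hn k : (k <= n)%N -> H 0%N <= H k.
  by elim: k => // k IH kn; apply: le_trans (IH (ltnW kn)) (stepH k kn).
have := Hn n (leqnn n).
rewrite /H; congr (_ <= _); apply: eq_expect => e.
rewrite -maxfZ; last exact: ltW.
apply: eq_maxf => f; rewrite mulr_sumr; apply: eq_bigr => i _.
by rewrite /b ltn_ord mulrCA.
Qed.

Lemma expect_flip (G : {ffun 'I_n -> bool} -> R) :
  expect signs (fun e => G [ffun i => ~~ e i]) = expect signs G.
Proof.
have flipK : involutive (fun e : {ffun 'I_n -> bool} => [ffun i => ~~ e i]).
  by move=> e; apply/ffunP => i; rewrite !ffunE negbK.
rewrite /expect [RHS](reindex_inj (inv_inj flipK)); apply: eq_bigr => e _.
by congr (_ * _); apply: eq_bigr.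
Qed.

Section Symmetrization.
Context (T : finType) (p : T -> R) (pP : pmf p).
Local Notation mu := (prodw p : {ffun 'I_n -> T} -> R).
Implicit Types (x : {ffun 'I_n -> T}) (e : {ffun 'I_n -> bool}).

Let muP : pmf mu. Proof. exact: prodw_pmf. Qed.

Definition mix e x x' : {ffun 'I_n -> T} := [ffun i => if e i then x' i else x i].

Lemma expect_mix e (G : {ffun 'I_n -> T} -> {ffun 'I_n -> T} -> R) :
  expect mu (fun x => expect mu (fun x' => G (mix e x x') (mix e x' x))) =
  expect mu (fun x => expect mu (G x)).
Proof.
pose s (q : {ffun 'I_n -> T} * {ffun 'I_n -> T}) := (mix e q.1 q.2, mix e q.2 q.1).
have sK : involutive s.
  by move=> [x x']; congr (_, _); apply/ffunP => i; rewrite !ffunE; case: (e i).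
pose F (q : {ffun 'I_n -> T} * {ffun 'I_n -> T}) := mu q.1 * (mu q.2 * G q.1 q.2).
transitivity (\sum_q F q); last first.
  rewrite -(pair_big xpredT xpredT (fun x y => mu x * (mu y * G x y)))/=.
  by apply: eq_bigr => x _; rewrite -mulr_sumr.
rewrite (reindex_inj (inv_inj sK)) /expect/=.
under eq_bigr do rewrite mulr_sumr.
rewrite pair_big/=; apply: eq_bigr => -[x x'] _; rewrite /F/s/= !mulrA.
congr (_ * _); rewrite /prodw -!big_split; apply: eq_bigr => i _ /=.
by rewrite !ffunE; case: (e i) => //; rewrite mulrC.
Qed.

(** Jensen's inequality: the centring is itself a mean over an independent
    sample x'. *)
Lemma ghost_sample (c : 'I_n -> R) (h : J -> T -> R) :
  expect mu (fun x => maxf j0 (fun f => \sum_(i < n) c i * (h f (x i) - expect p (h f)))) <=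
  expect mu (fun x => expect mu (fun x' =>
    maxf j0 (fun f => \sum_(i < n) c i * (h f (x i) - h f (x' i))))).
Proof.
apply: le_expect => // x.
rewrite (@eq_maxf _ _ j0 _ (fun f => expect mu (fun x' =>
  \sum_(i < n) c i * (h f (x i) - h f (x' i))))).
  exact: maxf_expect.
move=> f; rewrite expect_sum; apply: eq_bigr => i _.
rewrite expectZ expectB expect_cst//; congr (_ * (_ - _)).
by rewrite expect_marginal.
Qed.

(** Exchanging the i-th coordinates of the two samples, wherever the sign is
    negative, preserves their joint law. *)
Lemma sign_exchange e (h : J -> T -> R) :
  expect mu (fun x => expect mu (fun x' =>
    maxf j0 (fun f => \sum_(i < n) sgb (e i) * (h f (x i) - h f (x' i))))) =
  expect mu (fun x => expect mu (fun x' =>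
    maxf j0 (fun f => \sum_(i < n) (h f (x i) - h f (x' i))))).
Proof.
rewrite -(expect_mix e (fun x x' =>
  maxf j0 (fun f => \sum_(i < n) (h f (x i) - h f (x' i))))).
apply: eq_expect => x; apply: eq_expect => x'; apply: eq_maxf => f.
apply: eq_bigr => i _; rewrite !ffunE /sgb; case: (e i).
  by rewrite expr1; ring.
by rewrite expr0; ring.
Qed.

Lemma symmetrization (h : J -> T -> R) :
  expect mu (fun x => maxf j0 (fun f => \sum_(i < n) h f (x i) - n%:R * expect p (h f))) <=
  2 * expect mu (fun x => expect signs (fun e =>
    maxf j0 (fun f => \sum_(i < n) sgb (e i) * h f (x i)))).
Proof.
set rad := expect mu (fun x => expect signs _).
rewrite (@eq_expect _ _ _ _ (fun x =>
  maxf j0 (fun f => \sum_(i < n) 1 * (h f (x i) - expect p (h f))))); last first.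
  move=> x; apply: eq_maxf => f; under [RHS]eq_bigr do rewrite mul1r.
  by rewrite big_split/= sumr_const card_ord mulNrn mulr_natl.
apply: le_trans (ghost_sample (fun=> 1) h) _.
set S := expect mu _.
have -> : S = expect signs (fun e => expect mu (fun x => expect mu (fun x' =>
    maxf j0 (fun f => \sum_(i < n) sgb (e i) * (h f (x i) - h f (x' i)))))).
  under eq_expect do rewrite sign_exchange.
  rewrite expect_cst//; apply: eq_expect => x; apply: eq_expect => x'.
  by apply: eq_maxf => f; apply: eq_bigr => i _; rewrite mul1r.
pose M e x := maxf j0 (fun f => \sum_(i < n) sgb (e i) * h f (x i)).
have radE : rad = expect signs (fun e => expect mu (M e)) by exact: exchange_expect.
have bound e x x' : maxf j0 (fun f => \sum_(i < n) sgb (e i) * (h f (x i) - h f (x' i)))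
    <= M e x + M [ffun i => ~~ e i] x'.
  apply: le_trans (maxfD _ _ _); apply: le_maxf2 => f; rewrite -big_split/=.
  apply: ler_sum => i _; rewrite ffunE /sgb; case: (e i); rewrite /= ?expr1 ?expr0; lra.
apply: (@le_trans _ _ (expect signs (fun e =>
    expect mu (M e) + expect mu (M [ffun i => ~~ e i])))).
  apply: le_expect => // e.
  rewrite -{1}(expect_cst muP (expect mu (M [ffun i => ~~ e i]))) -expectD.
  apply: le_expect => // x; rewrite -{1}(expect_cst muP (M e x)) -expectD.
  by apply: le_expect.
by rewrite expectD (expect_flip (fun e => expect mu (M e))) -radE; lra.
Qed.

(** For a family stable under negation, randomly signed sums are no larger on
    average than twice the unsigned ones, up to the bias of the family. *)
Lemma desymmetrization (V : J -> T -> R) (neg : J -> J) (eta : R) :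
  (forall f t, V (neg f) t = - V f t) ->
  (forall f, `|expect p (V f)| <= eta) ->
  expect mu (fun x => expect signs (fun e =>
    maxf j0 (fun f => \sum_(i < n) sgb (e i) * V f (x i)))) <=
  2 * expect mu (fun x => maxf j0 (fun f => \sum_(i < n) V f (x i))) + n%:R * eta.
Proof.
move=> Vneg Veta; rewrite exchange_expect -[leRHS](expect_cst signsP).
apply: le_expect => // e.
pose C x := maxf j0 (fun f => \sum_(i < n) sgb (e i) * (V f (x i) - expect p (V f))).
apply: (@le_trans _ _ (expect mu (fun x => C x + n%:R * eta))).
  apply: le_expect => // x; apply: maxf_le => f.
  apply: le_trans (lerD (le_maxf _ _ f) (lexx _)).
  rewrite -lerBlDl -sumrB.
  apply: (@le_trans _ _ (\sum_(i < n) eta)); last by rewrite sumr_const card_ord mulr_natl.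
  apply: ler_sum => i _.
  rewrite -mulrBr opprB addrCA subrr addr0.
  by apply: le_trans (ler_norm _) _; rewrite normrM normr_sgb mul1r.
rewrite expectD expect_cst// lerD2r.
apply: le_trans (ghost_sample _ _) _; rewrite sign_exchange.
pose M x := maxf j0 (fun f => \sum_(i < n) V f (x i)).
apply: (@le_trans _ _ (expect mu (fun x => M x + expect mu M))).
  apply: le_expect => // x; rewrite -{1}(expect_cst muP (M x)) -expectD.
  apply: le_expect => // x'; apply: maxf_le => f; rewrite sumrB lerD ?le_maxf//.
  rewrite -sumrN; apply: le_trans (le_maxf _ _ (neg f)).
  by apply: ler_sum => i _; rewrite Vneg.
by rewrite expectD expect_cst// mulr2n mulrDl !mul1r.
Qed.

End Symmetrization.
End Rademacher.

(** * Truncation and uniform tail bounds *)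

Section Truncation.
Context (R : realType).
Implicit Types (M x y r q : R).

Definition clip M x : R := Num.max (- M) (Num.min x M).

(** A Lipschitz interpolation between the indicators of |x| > M / 2 and of
    |x| >= M. *)
Definition ramp M x : R := Num.min 1 (Num.max 0 (2 * `|x| / M - 1)).

Lemma clip_id M x : `|x| <= M -> clip M x = x.
Proof. by rewrite ler_norml => /andP[Mx xM]; rewrite /clip min_l// max_r. Qed.

Lemma clip_cases M x : 0 <= M ->
  [\/ x < - M /\ clip M x = - M, - M <= x <= M /\ clip M x = x
    | M < x /\ clip M x = M].
Proof.
move=> M0; rewrite /clip; case: (leP x M) => xM.
  case: (leP (- M) x) => Mx; first by constructor 2.
  by constructor 1.
by constructor 3; rewrite max_r//; lra.
Qed.

Lemma clip_lip M x y : 0 <= M -> `|clip M x - clip M y| <= `|x - y|.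
Proof.
move=> M0; have xy := ler_norm (x - y).
have yx := ler_norm (y - x); rewrite distrC in yx; rewrite ler_norml.
by have [[h ->]|[/andP[h h'] ->]|[h ->]] := clip_cases x M0;
  have [[k ->]|[/andP[k k'] ->]|[k ->]] := clip_cases y M0; apply/andP; split; lra.
Qed.

Lemma clip_bound M x : 0 <= M -> `|clip M x| <= M.
Proof.
move=> M0; rewrite ler_norml.
by have [[h ->]|[/andP[h h'] ->]|[h ->]] := clip_cases x M0; apply/andP; split; lra.
Qed.

Lemma clip0 M : 0 <= M -> clip M 0 = 0.
Proof. by move=> M0; rewrite clip_id ?normr0. Qed.

Lemma clip_le_norm M x : 0 <= M -> `|clip M x| <= `|x|.
Proof. by move=> M0; have := clip_lip x 0 M0; rewrite clip0// !subr0. Qed.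

Lemma clip_lip_level M M' x : 0 <= M -> M <= M' ->
  `|clip M' x - clip M x| <= M' - M.
Proof.
move=> M0 MM'; rewrite ler_norml.
by have [[h ->]|[/andP[h h'] ->]|[h ->]] := clip_cases x M0;
  have [[k ->]|[/andP[k k'] ->]|[k ->]] := clip_cases x (le_trans M0 MM');
  apply/andP; split; lra.
Qed.

Lemma ramp01 M x : 0 <= ramp M x <= 1.
Proof. by rewrite /ramp le_min ler01 le_max lexx/= ge_min lexx. Qed.

Lemma ramp1 M x : 0 < M -> M <= `|x| -> ramp M x = 1.
Proof.
move=> M0 Mx; have h : 1 <= `|x| / M by rewrite ler_pdivlMr// mul1r.
by rewrite /ramp min_l// le_max; apply/orP; right; rewrite -mulrA; lra.
Qed.

Lemma ramp_lip M x y : 0 < M -> `|ramp M x - ramp M y| <= 2 / M * `|x - y|.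
Proof.
move=> M0; pose u (z : R) : R := 2 * `|z| / M - 1.
have : `|u x - u y| <= 2 / M * `|x - y|.
  rewrite /u (_ : _ - _ = 2 / M * (`|x| - `|y|)); last by ring.
  rewrite normrM ger0_norm; last by rewrite divr_ge0// ltW.
  by rewrite ler_wpM2l ?divr_ge0 ?(ltW M0)// ler_dist_dist.
apply: le_trans; rewrite /ramp -/(u x) -/(u y).
have xy := ler_norm (u x - u y).
have yx := ler_norm (u y - u x); rewrite distrC in yx; rewrite ler_norml.
have casesP (z : R) : [\/ z <= 0 /\ Num.min 1 (Num.max 0 z) = 0,
    0 <= z <= 1 /\ Num.min 1 (Num.max 0 z) = z
    | 1 <= z /\ Num.min 1 (Num.max 0 z) = 1].
  case: (leP 0 z) => z0; last first.
    by constructor 1; rewrite min_r// ltW.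
  case: (leP 1 z) => z1; first by constructor 3.
  by constructor 2; rewrite ltW.
by have [[h ->]|[/andP[h h'] ->]|[h ->]] := casesP (u x);
  have [[k ->]|[/andP[k k'] ->]|[k ->]] := casesP (u y); apply/andP; split; lra.
Qed.

Lemma le_powR1 (z r : R) : 1 <= r -> 1 <= z -> z <= z `^ r.
Proof. by move=> r1 z1; rewrite -{1}(powRr1 (le_trans ler01 z1)) ler_powR. Qed.

(** Tail probabilities, the bias of truncation and truncated second moments
    enter only through this bound and the two that follow, in the manner of
    Markov's inequality. *)
Lemma ramp_le_powR M x r : 0 < M -> 1 <= r -> ramp M x <= (2 * `|x| / M) `^ r.
Proof.
move=> M0 r1; have [h|h] := leP 1 (2 * `|x| / M).
  by apply: le_trans (le_trans h (le_powR1 r1 h)); case/andP: (ramp01 M x).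
rewrite /ramp max_l; last by lra.
by rewrite min_r ?powR_ge0.
Qed.

Lemma clip_error_le_powR M x r : 0 < M -> 1 <= r ->
  `|clip M x - x| <= M * (`|x| / M) `^ r.
Proof.
move=> M0 r1; have [h|h] := leP `|x| M.
  by rewrite clip_id// subrr normr0 mulr_ge0 ?powR_ge0// ltW.
have xM : 1 <= `|x| / M by rewrite ler_pdivlMr// mul1r ltW.
apply: le_trans (_ : M * (`|x| / M) <= _); last first.
  by rewrite ler_wpM2l ?(ltW M0)// le_powR1.
rewrite mulrCA divff ?gt_eqF// mulr1.
have := ler_norm x; have := ler_norm (- x); rewrite normrN => x1 x2.
rewrite ler_norml.
by have [[k ->]|[/andP[k k'] ->]|[k ->]] := clip_cases x (ltW M0);
  apply/andP; split; lra.
Qed.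

Lemma clip_sqr_le_powR M x q : 0 < M -> 1 <= q <= 2 ->
  clip M x ^+ 2 <= M `^ (2 - q) * `|x| `^ q.
Proof.
move=> M0 /andP[q1 q2]; set c := clip M x.
have q0 : 0 < q by lra.
have [->|c0] := eqVneq c 0.
  by rewrite expr0n/= mulr_ge0 ?powR_ge0.
have cn0 : 0 < `|c| by rewrite normr_gt0.
have -> : c ^+ 2 = `|c| `^ (2 - q) * `|c| `^ q.
  rewrite -powRD; last by rewrite (gt_eqF cn0) implybT.
  by rewrite subrK powR_mulrn// real_normK ?num_real.
have M0' := ltW M0.
apply: ler_pM; rewrite ?powR_ge0//; apply: ge0_ler_powR; rewrite ?nnegrE ?subr_ge0//.
- exact: clip_bound.
- exact: ltW.
- exact: clip_le_norm.
Qed.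

End Truncation.

Section TailBounds.
Context (R : realType) (T : finType) (n : nat) (p : T -> R) (pP : pmf p).
Context (J : finType) (j0 : J) (V : J -> T -> R) (rho : R).
Local Notation mu := (prodw p : {ffun 'I_n -> T} -> R).
Local Notation signs := (prodw (coin R) : {ffun 'I_n -> bool} -> R).

Hypothesis rhoP : expect mu (fun x => expect signs (fun e =>
  maxf j0 (fun f => \sum_(i < n) sgb R (e i) * V f (x i)))) <= rho.

Let muP : pmf mu. Proof. exact: prodw_pmf. Qed.

Lemma rademacher_bound_ge0 : 0 <= rho.
Proof.
apply: le_trans rhoP; apply: expect_ge0 => // x.
apply: le_trans (maxf_expect _ _ (prodw_pmf n (coin_pmf R))).
apply: le_trans (le_maxf _ _ j0).
rewrite expect_sum big1// => i _.
rewrite (@eq_expect _ _ _ _ (fun e : {ffun 'I_n -> bool} => V j0 (x i) * sgb R (e i))).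
  rewrite expectZ (expect_marginal _ _ (coin_pmf R)) expect_coin /sgb expr1 expr0.
  by rewrite addNr !mulr0.
by move=> e; rewrite mulrC.
Qed.

(** Symmetrization, then contraction: every Lipschitz image of the family
    fluctuates no more than rho, the randomly signed sums of the family
    itself. *)
Lemma lipschitz_fluctuation (L : R) (phi : R -> R) : 0 < L ->
  (forall x y, `|phi x - phi y| <= L * `|x - y|) ->
  expect mu (fun x => maxf j0 (fun f => \sum_(i < n) phi (V f (x i)) -
    n%:R * expect p (fun t => phi (V f t)))) <= 2 * L * rho.
Proof.
move=> L0 phiL; apply: le_trans (symmetrization j0 _ pP (fun f t => phi (V f t))) _.
rewrite -mulrA ler_wpM2l//; apply: le_trans (ler_wpM2l (ltW L0) rhoP).
rewrite -expectZ; apply: le_expect => // x.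
exact: (contraction j0 (fun i f => V f (x i)) L0 phiL).
Qed.

Lemma lipschitz_maxf_sum (L c : R) (phi : R -> R) : 0 < L ->
  (forall x y, `|phi x - phi y| <= L * `|x - y|) ->
  (forall f, n%:R * expect p (fun t => phi (V f t)) <= c) ->
  expect mu (fun x => maxf j0 (fun f => \sum_(i < n) phi (V f (x i)))) <=
  c + 2 * L * rho.
Proof.
move=> L0 phiL phic; apply: le_trans (lerD (lexx c) (lipschitz_fluctuation L0 phiL)).
rewrite -{1}(expect_cst muP c) -expectD; apply: le_expect => // x.
apply: maxf_le => f; apply: le_trans (lerD (phic f) (le_maxf _ _ f)).
by rewrite addrC subrK.
Qed.

(** The count of values beyond M is below the sum of the ramps, which is
    self-bounding and has mean at most t / 8. Chernoff's bound at the exponent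
    2 gives exp (- t), as exp 2 - 1 <= 8. *)
Lemma count_tail (M c : R) (t : nat) : 0 < M ->
  (forall f, n%:R * expect p (fun y => ramp M (V f y)) <= c) ->
  c + 4 / M * rho <= t%:R / 8 ->
  expect mu (fun x =>
    [exists f, (t < #|[pred i | (M < `|V f (x i)|)%R]|)%N]%:R) <= expR (- t%:R).
Proof.
move=> M0 hc ct.
pose Z x := maxf j0 (fun f => \sum_(i < n) ramp M (V f (x i))).
have EZ : expect mu Z <= t%:R / 8.
  apply: le_trans ct; rewrite (_ : 4 / M = 2 * (2 / M)); last by ring.
  by apply: lipschitz_maxf_sum => // [|x y]; [rewrite divr_gt0|exact: ramp_lip].
have mgfZ : ln (mgf mu Z 2) <= (expR 2 - 1) * expect mu Z.
  exact: (@maxf_sum_self_bounding _ _ n _ pP _ j0 (fun f y => ramp M (V f y)) 2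
    (fun f y => ramp01 M (V f y)) (ltr0Sn R 1)).
have e2 : expR 2 <= 9 :> R.
  have -> : expR 2 = expR 1 * expR 1 :> R by rewrite -expRD.
  have e3 := expR1_le3 R; have e0 := expR_ge0 (1 : R).
  by apply: (@le_trans _ _ (3 * 3)); [rewrite ler_pM|lra].
have EZ0 : 0 <= expect mu Z.
  apply: expect_ge0 => // x; apply: le_trans (le_maxf _ _ j0).
  by apply: sumr_ge0 => i _; case/andP: (ramp01 M (V j0 (x i))).
apply: le_trans (@expect_chernoff _ _ mu muP Z 2 t.+1%:R _ (ler0n _ 2) _) _.
  move=> x /existsP[f]; rewrite -(ler_nat R) => /le_trans; apply.
  apply: le_trans (le_maxf _ _ f); rewrite -sum1_card natr_sum big_mkcond/=.
  apply: ler_sum => i _; rewrite inE; case: ifPn => [Mi|_].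
    by rewrite ramp1// ltW.
  by case/andP: (ramp01 M (V f (x i))).
rewrite -/(mgf mu Z 2) -[mgf mu Z 2]lnK ?posrE ?mgf_gt0// -expRD ler_expR.
have := ler_wpM2r EZ0 (_ : expR 2 - 1 <= 8); rewrite lerBlDr => /(_ ltac:(lra)).
by rewrite -natr1; lra.
Qed.

(** After division by S the truncated values are bounded by one, so that
    [maxf_sum_mgf] applies; squaring is 2-Lipschitz there, which bounds the
    quadratic variation. The exponent 1/2 in Chernoff's bound is fixed, as S
    will be of the order at which deviations are Poissonian rather than
    Gaussian. *)
Lemma clip_sum_tail (M S v L : R) : 0 < M -> M <= S -> 0 <= v ->
  (forall f, n%:R * expect p (fun y => clip M (V f y) ^+ 2) <= v) ->
  expect mu (fun x => [exists f, n%:R * expect p (fun y => clip M (V f y)) +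
      18 * rho + 6 * (v / S) + 2 * S * L < \sum_(i < n) clip M (V f (x i))]%:R)
  <= expR (- L).
Proof.
move=> M0 MS v0 hv; have S0 : 0 < S by exact: lt_le_trans MS.
have M0' := ltW M0; have S0' := ltW S0.
have Si0 : 0 < S^-1 by rewrite invr_gt0.
have rho0 := rademacher_bound_ge0.
pose phi x := S^-1 * clip M x.
have phi_lip x y : `|phi x - phi y| <= S^-1 * `|x - y|.
  by rewrite /phi -mulrBr normrM gtr0_norm// ler_wpM2l ?(ltW Si0)// clip_lip.
have phi1 x : `|phi x| <= 1.
  rewrite /phi normrM gtr0_norm// mulrC ler_pdivrMr// mul1r.
  by apply: le_trans MS; exact: clip_bound.
have sq_lip x y : `|phi x ^+ 2 - phi y ^+ 2| <= 2 / S * `|x - y|.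
  rewrite subr_sqr normrM mulrC -mulrA.
  have h1 : `|phi x + phi y| <= 2.
    by apply: le_trans (ler_normD _ _) _; have := phi1 x; have := phi1 y; lra.
  exact: ler_pM (normr_ge0 _) (normr_ge0 _) h1 (phi_lip x y).
pose c f := n%:R * expect p (fun y => phi (V f y)).
pose Z x := maxf j0 (fun f => \sum_(i < n) phi (V f (x i)) - c f).
have EZ : expect mu Z <= 2 * S^-1 * rho by exact: lipschitz_fluctuation.
have v'P f : n%:R * expect p (fun y => phi (V f y) ^+ 2) <= v / S ^+ 2.
  rewrite (@eq_expect _ _ _ _ (fun y => (S ^+ 2)^-1 * clip M (V f y) ^+ 2)).
    by rewrite expectZ mulrCA mulrC ler_wpM2r ?invr_ge0 ?exprn_ge0.
  by move=> y; rewrite /phi exprMn exprVn.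
have EQ := lipschitz_maxf_sum (divr_gt0 (ltr0Sn R 1) S0) sq_lip v'P.
have m0 : 0 <= 2 * S^-1 * rho by rewrite !mulr_ge0// ltW.
have v'0 : 0 <= v / S ^+ 2 by rewrite divr_ge0// exprn_ge0.
have mgfZ := maxf_sum_mgf pP (fun f y => phi1 (V f y)) v'P v'0 EQ m0 EZ.
pose lev := 18 * rho / S + 6 * (v / S ^+ 2) + 2 * L.
apply: le_trans (@expect_chernoff _ _ mu muP Z 2^-1 lev _ _ _) _.
- by rewrite invr_ge0.
- move=> x /existsP[f] Hf; apply: le_trans (le_maxf _ _ f).
  rewrite /c (@eq_expect _ _ _ _ (fun y => S^-1 * clip M (V f y)))// expectZ.
  rewrite -mulr_sumr mulrCA -mulrBr mulrC ler_pdivlMr//.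
  rewrite (_ : lev * S = 18 * rho + 6 * (v / S) + 2 * S * L); last first.
    by rewrite /lev; field; rewrite gt_eqF.
  by lra.
rewrite -/(mgf mu Z 2^-1) -[mgf mu Z 2^-1]lnK ?posrE ?mgf_gt0// -expRD ler_expR.
have := mgfZ; rewrite /lev -/(mgf mu Z 2^-1); lra.
Qed.

End TailBounds.

(** * Stability of the trimmed mean *)

Section TrimmedMeanStability.
Context (R : realType) (X : normedModType R) (n : nat).
Implicit Types (f : X -> R) (x : 'I_n -> X).

Lemma normr_sum_seq_le (I : eqType) (s : seq I) (F : I -> R) (c : R) :
  (forall i, i \in s -> `|F i| <= c) -> `|\sum_(i <- s) F i| <= (size s)%:R * c.
Proof.
move=> Fc; apply: le_trans (ler_norm_sum _ _ _) _.
apply: (@le_trans _ _ (\sum_(i <- s) c)); last by rewrite big_const_seq count_predT iter_addr_0 mulr_natl.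
by rewrite big_seq [leRHS]big_seq; apply: ler_sum => i; exact: Fc.
Qed.

(** An index that survives the trimming has at least k indices on either side
    of it, so a value beyond the level M there would force more than k values
    beyond M. *)
Lemma trimmed_values_bounded k f x (c M : R) : (2 * k < n)%N ->
  (#|[pred i | (M < `|f (x i) - c|)%R]| <= k)%N ->
  forall i, i \in take (n - 2 * k) (drop k (sorted_indices f x)) -> `|f (x i) - c| <= M.
Proof.
move=> kn cntP i; set s := sorted_indices f x.
pose s1 := take k s; pose s2 := take (n - 2 * k) (drop k s).
pose s3 := drop (n - 2 * k) (drop k s).
have sE : s = s1 ++ s2 ++ s3 by rewrite /s1 /s2 /s3 cat_take_drop cat_take_drop.
have size_s : size s = n by rewrite size_sort size_enum_ord.
have kn' : (k <= n)%N by lia.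
have size1 : size s1 = k by rewrite size_takel// size_s.
have size3 : size s3 = k by rewrite !size_drop size_s; lia.
have uniq_s : uniq s by rewrite sort_uniq enum_uniq.
have : pairwise (relpre (f \o x) <=%R) s.
  rewrite -sorted_pairwise; first by apply: sort_sorted => u v; exact: le_total.
  by move=> u v w; exact: le_trans.
rewrite {1}sE pairwise_cat allrel_catr => /and3P[/andP[/allrelP s12 _] _].
rewrite pairwise_cat => /and3P[/allrelP s23 _ _] is2.
move: uniq_s; rewrite sE cat_uniq has_cat negb_or => /and3P[u1 /andP[d12 _]].
rewrite cat_uniq => /and3P[_ d23 u3].
rewrite leNgt; apply/negP => Mi; move: cntP; rewrite leqNgt => /negP; apply.
have card_sub (r : seq 'I_n) : size r = k -> uniq r -> i \notin r ->
    (forall j, j \in r -> M < `|f (x j) - c|) ->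
    (k < #|[pred i | (M < `|f (x i) - c|)%R]|)%N.
  move=> rk ru ir rM; rewrite -rk -[X in (X < _)%N](card_uniqP ru).
  have -> : (#|r|.+1 = #|[predU1 i & mem r]|)%N by rewrite cardU1 ir.
  by apply: subset_leq_card; apply/fintype.subsetP => j; rewrite !inE => /predU1P[->//|/rM].
case: (leP 0 (f (x i) - c)) => [fi|fi].
  rewrite ger0_norm// in Mi; apply: (card_sub s3) => //.
    by apply/negP => i3; move/hasPn: d23 => /(_ i i3)/=; rewrite is2.
  move=> j j3; apply: lt_le_trans Mi (le_trans _ (ler_norm _)).
  by rewrite lerD2r; exact: s23.
rewrite ltr0_norm// in Mi; apply: (card_sub s1) => //.
  by move/hasPn: d12 => /(_ i is2).
move=> j j1; apply: lt_le_trans Mi _.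
rewrite -normrN; apply: le_trans (ler_norm _).
by rewrite lerN2 lerD2r; exact: s12.
Qed.

Lemma sum_take_drop k f x (F : 'I_n -> R) (M : R) : (2 * k < n)%N ->
  (forall i, `|F i| <= M) ->
  `|\sum_(i <- take (n - 2 * k) (drop k (sorted_indices f x))) F i - \sum_(i < n) F i|
     <= 2 * k%:R * M.
Proof.
move=> kn FM; set s := sorted_indices f x.
have size_s : size s = n by rewrite size_sort size_enum_ord.
have -> : \sum_(i < n) F i = \sum_(i <- s) F i.
  by apply: perm_big; rewrite perm_sym perm_sort; apply/permPr;
    rewrite enumT.
have -> : \sum_(i <- s) F i = \sum_(i <- take k s) F i +
    (\sum_(i <- take (n - 2 * k) (drop k s)) F i +
     \sum_(i <- drop (n - 2 * k) (drop k s)) F i).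
  by rewrite -!big_cat/= !cat_take_drop.
have size3 : size (drop (n - 2 * k) (drop k s)) = k by rewrite !size_drop size_s; lia.
have size1 : size (take k s) = k by rewrite size_takel// size_s; lia.
have := @normr_sum_seq_le _ (take k s) F M (fun i _ => FM i).
have := @normr_sum_seq_le _ (drop (n - 2 * k) (drop k s)) F M (fun i _ => FM i).
rewrite size1 size3 => h3 h1; rewrite distrC.
set A := \sum_(i <- take k s) _ in h1 *; set C := \sum_(i <- drop _ _) _ in h3 *.
rewrite (_ : _ - _ = A + C); last by ring.
by apply: le_trans (ler_normD _ _) _; lra.
Qed.

(** The deterministic core of robustness. The observed values f (x i) - c differ
    from the clean values a for at most e indices, and a' approximates a. At
    most k = e + t observed values exceed M + kap, so those that survive are
    left unchanged by truncation. The truncated sums over the survivors, over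
    all observed values, over a and over a' then differ by at most
    2 k (M + kap), 2 e (M + kap) and 2 n kap in turn. *)
Lemma trimmed_mean_stable (k e t : nat) f x (c M kap : R) (a a' : 'I_n -> R) :
  k = (e + t)%N -> (2 * k < n)%N -> 0 <= M -> 0 <= kap ->
  (forall i, `|a i - a' i| <= kap) ->
  (#|[pred i | (f (x i) - c != a i)%R]| <= e)%N ->
  (#|[pred i | (M < `|a' i|)%R]| <= t)%N ->
  `|trimmed_mean k f x - c| <= M + kap /\
  (n - 2 * k)%:R * `|trimmed_mean k f x - c| <=
    `|\sum_(i < n) clip M (a' i)| + 2 * n%:R * kap + 2 * (k + e)%:R * (M + kap).
Proof.
move=> kE kn M0 kap0 aa' ba a'M.
set M' := M + kap; have M'0 : 0 <= M' by exact: addr_ge0.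
pose b i := f (x i) - c.
have cntb : (#|[pred i | (M' < `|f (x i) - c|)%R]| <= k)%N.
  rewrite kE; apply: leq_trans (leq_add ba a'M).
  rewrite -cardUI; apply: leq_trans (leq_addr _ _); apply: subset_leq_card; apply/fintype.subsetP => i.
  rewrite !inE => Mb; case: eqP => //= bE; move: Mb; rewrite bE => Mb.
  have := aa' i; have := ler_normD (a i - a' i) (a' i); rewrite subrK /M' in Mb *.
  by lra.
have kept := trimmed_values_bounded kn cntb.
set s := take _ _ in kept.
have size_s : size s = (n - 2 * k)%N.
  by rewrite size_takel// size_drop size_sort size_enum_ord; lia.
have d0 : 0 < (n - 2 * k)%:R :> R by rewrite ltr0n subn_gt0.
have TE : (n - 2 * k)%:R * (trimmed_mean k f x - c) = \sum_(i <- s) b i.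
  rewrite /trimmed_mean -/s sumrB big_const_seq count_predT iter_addr_0 size_s.
  by rewrite mulrBr mulrA divff ?gt_eqF// mul1r mulr_natl.
have normTE : (n - 2 * k)%:R * `|trimmed_mean k f x - c| = `|\sum_(i <- s) b i|.
  by rewrite -TE normrM ger0_norm// ltW.
split.
  rewrite -(ler_pM2l d0) normTE -size_s; apply: normr_sum_seq_le => i; exact: kept.
rewrite normTE.
have clipb : \sum_(i <- s) b i = \sum_(i <- s) clip M' (b i).
  by rewrite big_seq [RHS]big_seq; apply: eq_bigr => i si; rewrite clip_id//; exact: kept.
have h1 := sum_take_drop f x kn (fun i => clip_bound (b i) M'0).
rewrite -/s -clipb in h1.
have h2 : `|\sum_(i < n) clip M' (b i) - \sum_(i < n) clip M' (a i)| <= 2 * e%:R * M'.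
  rewrite -sumrB; apply: le_trans (ler_norm_sum _ _ _) _.
  rewrite (bigID (fun i => b i != a i))/= [X in _ + X]big1 ?addr0; last first.
    by move=> i /negbNE/eqP ->; rewrite subrr normr0.
  apply: (@le_trans _ _ (\sum_(i | b i != a i) 2 * M')).
    apply: ler_sum => i _; apply: le_trans (ler_normB _ _) _.
    by have := clip_bound (b i) M'0; have := clip_bound (a i) M'0; lra.
  rewrite sumr_const -[leLHS]mulr_natl mulrCA mulrA ler_wpM2r//.
  by rewrite ler_wpM2l// ler_nat.
have h3 : `|\sum_(i < n) clip M' (a i) - \sum_(i < n) clip M (a' i)| <= 2 * n%:R * kap.
  rewrite -sumrB; apply: le_trans (ler_norm_sum _ _ _) _.
  apply: (@le_trans _ _ (\sum_(i < n) 2 * kap)); last first.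
    by rewrite sumr_const card_ord -[leLHS]mulr_natl mulrCA mulrA.
  apply: ler_sum => i _.
  have := clip_lip (a i) (a' i) M'0; have := aa' i.
  have := clip_lip_level (a' i) M0 (_ : M <= M'); rewrite lerDl => /(_ kap0).
  rewrite (_ : M' - M = kap) => [u1 u2 u3|]; last by rewrite /M'; ring.
  have := ler_normD (clip M' (a i) - clip M' (a' i)) (clip M' (a' i) - clip M (a' i)).
  by rewrite addrA subrK; lra.
set B := \sum_(i < n) clip M' (b i) in h1 h2; set A := \sum_(i < n) clip M' (a i) in h2 h3.
set A' := \sum_(i < n) clip M (a' i) in h3 *; set S := \sum_(i <- s) b i in h1 *.
have tri : `|S| <= `|S - B| + (`|B - A| + (`|A - A'| + `|A'|)).
  rewrite -{1}(subrK B S); apply: le_trans (ler_normD _ _) _; rewrite lerD2l.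
  rewrite -{1}(subrK A B); apply: le_trans (ler_normD _ _) _; rewrite lerD2l.
  by rewrite -{1}(subrK A' A); exact: ler_normD.
by rewrite natrD; lra.
Qed.

End TrimmedMeanStability.

(** * Levels, rates and constants *)

Section Constants.
Context (R : realType).

Definition ratio (eps : R) : R :=
  if eps == 0 then 1 else eps / Num.min eps (2^-1 - eps).

Lemma C_constE eps : C_const eps = 384 * (1 + ratio eps).
Proof. by []. Qed.

Lemma ln3_ge1 : 1 <= ln 3 :> R.
Proof.
rewrite -[leLHS](@expRK R) ler_ln ?posrE ?expR_gt0//; first exact: expR1_le3.
Qed.

(** The integers behind the trimming level: e bounds the number of
    contaminated observations, t the number of clean outliers. The last clause
    tells which of the two terms makes up t. If 4 (e + t) < n then eps < 1/4,
    since eps n < e + 1 <= e + t. *)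
Lemma trim_level_spec (n : nat) (eps alpha : R) : (0 < n)%N ->
  0 <= eps < 2^-1 -> 0 < alpha < 1 -> phi n eps alpha < 2^-1 ->
  exists e t : nat, [/\ trim_level n eps alpha = (e + t)%N,
    (2 * (e + t) < n)%N, (0 < t)%N & [/\
    forall c : nat, c%:R <= eps * n%:R -> (c <= e)%N,
    ln (2 / alpha) <= t%:R,
    e%:R <= 2 * ratio eps * t%:R,
    (4 * (e + t) < n)%N -> ratio eps = 1 &
    t%:R <= 2 * ln (3 / alpha) \/ 0 < eps /\ t%:R <= eps * n%:R]].
Proof.
move=> n0 /andP[e0 e2] /andP[a0 a1] phi_lt.
have n0R : 0 < n%:R :> R by rewrite ltr0n.
have en0 : 0 <= eps * n%:R by rewrite mulr_ge0// ltW.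
have l0 : 0 < ln (2 / alpha) by rewrite ln_gt0// ltr_pdivlMr// mul1r; lra.
set del := Num.min (2^-1 - eps) eps.
have del0 : 0 <= del by rewrite le_min e0 subr_ge0 ltW.
have dele : del <= eps by rewrite ge_min lexx orbT.
pose e := `|Num.floor (eps * n%:R)|%N.
pose tail := `|Num.ceil (ln (2 / alpha))|%N.
pose frac := `|Num.ceil (del / 2 * n%:R)|%N.
have natfloor (x : R) : 0 <= x -> (`|Num.floor x|%N)%:R = (Num.floor x)%:~R :> R.
  by move=> x0; rewrite -[in RHS](@gez0_abs (Num.floor x)) ?floor_ge0.
have natceil (x : R) : 0 <= x -> (`|Num.ceil x|%N)%:R = (Num.ceil x)%:~R :> R.
  move=> x0; rewrite -[in RHS](@gez0_abs (Num.ceil x))//.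
  by rewrite ceil_ge0; lra.
have eE : e%:R <= eps * n%:R < e%:R + 1.
  by rewrite natfloor//; have := floor_itv (eps * n%:R); rewrite intrD1.
have ceilP (x : R) : 0 <= x -> x <= (`|Num.ceil x|%N)%:R < x + 1.
  move=> x0; rewrite natceil//; have := ceil_itv x; rewrite intrB.
  by move=> /andP[u ->]; rewrite -ltrBlDr u.
have tailP := ceilP _ (ltW l0); rewrite -/tail in tailP.
have fracP : del / 2 * n%:R <= frac%:R < del / 2 * n%:R + 1.
  by apply: ceilP; rewrite mulr_ge0 ?divr_ge0// ltW.
pose t := maxn tail frac.
have kE : trim_level n eps alpha = (e + t)%N by [].
have tailt : tail%:R <= t%:R :> R by rewrite ler_nat leq_maxl.
have fract : frac%:R <= t%:R :> R by rewrite ler_nat leq_maxr.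
have tail0 : (0 < tail)%N.
  by rewrite -(ltr_nat R); case/andP: tailP; lra.
have t0 : (0 < t)%N by rewrite leq_max tail0.
have k2 : (2 * (e + t) < n)%N.
  move: phi_lt; rewrite /phi kE -(ltr_nat R) natrM mulrC ltr_pdivrMr//.
  by lra.
have ratioP : eps != 0 -> 0 < del /\ ratio eps = eps / del.
  move=> eps0; rewrite /ratio (negPf eps0) /del minC; split=> //.
  by rewrite lt_min subr_gt0 e2 andbT lt_neqAle eq_sym eps0.
exists e, t; split=> //; split.
- move=> c cP; rewrite -ltnS -(ltr_nat R) -natr1; case/andP: eE => _.
  exact: le_lt_trans.
- by case/andP: tailP => u _; exact: le_trans tailt.
- have [eps0|eps0] := eqVneq eps 0.
    have -> : e = 0%N by rewrite /e eps0 mul0r floor0.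
    by rewrite /ratio eps0 eqxx !mulr_ge0.
  have [del1 ->] := ratioP eps0.
  case/andP: eE => ee _; apply: le_trans ee _.
  rewrite (_ : 2 * (eps / del) * t%:R = eps * (2 * t%:R / del)); last by ring.
  rewrite ler_wpM2l// ler_pdivlMr// mulrC.
  by case/andP: fracP; lra.
- move=> k4; have [eps0|eps0] := eqVneq eps 0; first by rewrite /ratio eps0 eqxx.
  have [del1 ->] := ratioP eps0.
  suff -> : del = eps by rewrite divff.
  apply: min_r; suff : eps < 4^-1 by lra.
  rewrite -(ltr_pM2r n0R); case/andP: eE => _ /lt_le_trans; apply.
  have : (4 * (e + t))%:R <= n%:R :> R by rewrite ler_nat ltnW.
  have : 1 <= t%:R :> R by rewrite ler1n.
  by rewrite natrM natrD; lra.
have [ft|tf] := leqP frac tail; [left|right].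
  rewrite /t (maxn_idPl ft); case/andP: tailP => _ /ltW/le_trans; apply.
  have lnE (c : R) : 0 < c -> ln (c / alpha) = ln c - ln alpha.
    by move=> c0; rewrite ln_div ?posrE.
  have : ln 2 <= ln 3 :> R by rewrite ler_ln ?posrE; lra.
  have := ln3_ge1; have : ln alpha <= 0 by rewrite ln_le0// ltW.
  by rewrite !lnE//; lra.
have f2 : 2%:R <= frac%:R :> R by rewrite ler_nat; exact: leq_ltn_trans tail0 tf.
have dn : 1 < del / 2 * n%:R by case/andP: fracP; lra.
have eps0 : 0 < eps.
  rewrite lt_neqAle e0 andbT; apply/eqP => eps0.
  by move: dn; rewrite (_ : del = 0) ?mul0r ?ltr10//; apply/eqP; rewrite eq_le del0 andbT eps0.
split=> //; rewrite /t (maxn_idPr (ltnW tf)).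
have : del * n%:R <= eps * n%:R by rewrite ler_wpM2r// ltW.
by case/andP: fracP; lra.
Qed.

Lemma ln_alpha_spec (alpha : R) : 0 < alpha < 1 ->
  [/\ 0 < ln (2 / alpha), ln (2 / alpha) <= ln (3 / alpha) & 0 < ln (3 / alpha)].
Proof.
move=> /andP[a0 a1]; have ai0 : 0 < alpha^-1 by rewrite invr_gt0.
have le : ln (2 / alpha) <= ln (3 / alpha).
  by rewrite ler_ln ?posrE ?mulr_gt0// ler_pM2r//; lra.
have l0 : 0 < ln (2 / alpha) by rewrite ln_gt0// ltr_pdivlMr// mul1r; lra.
by split=> //; exact: lt_le_trans le.
Qed.

Lemma ratio_ge1 (eps : R) : 0 <= eps < 2^-1 -> 1 <= ratio eps.
Proof.
move=> /andP[e0 e2]; rewrite /ratio; case: eqVneq => // eps0.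
have eps1 : 0 < eps by rewrite lt_neqAle eq_sym eps0.
rewrite ler_pdivlMr ?mul1r ?ge_min ?lexx//.
by rewrite lt_min eps1 subr_gt0.
Qed.

(** The truncation level carries the factor (13 n / t)^(1/r), and t is at most
    2 s n for the rate s of the error term it is charged to. The factors
    13^(1/r) and 2^(1 - 1/r) have product at most 13. *)
Lemma level_rate (n t : nat) (nu s r : R) : (0 < n)%N -> (0 < t)%N ->
  0 <= nu -> 1 <= r -> t%:R <= 2 * (s * n%:R) ->
  2 * (13 * n%:R / t%:R) `^ r^-1 * nu * (t%:R / n%:R) <= 26 * (nu * s `^ (1 - r^-1)).
Proof.
move=> n0 t0 nu0 r1 ts.
have n0R : 0 < n%:R :> R by rewrite ltr0n.
have t0R : 0 < t%:R :> R by rewrite ltr0n.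
have s0 : 0 < s by rewrite -(pmulr_lgt0 _ n0R); lra.
have r0 : 0 < r by lra.
have ri1 : r^-1 <= 1 by rewrite invf_le1.
set c := r^-1 in ri1 *; set y := t%:R / n%:R.
have y0 : 0 < y by rewrite divr_gt0.
have -> : 13 * n%:R / t%:R = 13 / y.
  by rewrite /y; field; rewrite !gt_eqF.
have ys : y <= 2 * s by rewrite /y ler_pdivrMr//; lra.
have c0 : 0 <= c by rewrite invr_ge0 ltW.
have split_exp (u : R) : 0 < u -> u `^ c * u `^ (1 - c) = u.
  move=> u0; rewrite -powRD; last by rewrite (gt_eqF u0) implybT.
  by rewrite subrKC powRr1// ltW.
have E1 : (13 / y) `^ c * y = 13 `^ c * y `^ (1 - c).
  rewrite -{2}(split_exp y y0) mulrA -powRM ?divr_ge0 ?(ltW y0)//.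
  by rewrite divfK ?gt_eqF.
have E2 : 13 `^ c * y `^ (1 - c) <= 13 * s `^ (1 - c).
  rewrite -[X in _ <= X * _](split_exp 13 (ltr0Sn R 12)) -mulrA.
  rewrite ler_wpM2l ?powR_ge0//.
  rewrite -powRM ?(ltW s0)//; apply: ge0_ler_powR; rewrite ?nnegrE ?subr_ge0 ?(ltW y0)//.
    by rewrite mulr_ge0 ?(ltW s0).
  by lra.
rewrite (_ : _ * y = 2 * nu * ((13 / y) `^ c * y)); last by ring.
rewrite E1 (_ : 26 * _ = 2 * nu * (13 * s `^ (1 - c))); last by ring.
by rewrite ler_wpM2l ?mulr_ge0.
Qed.

(** The bookkeeping of constants. When the trimming level is at least n / 4
    the truncation level itself is affordable; otherwise eps < 1/4, more than
    half of the sample survives, and the truncated sums are used. *)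
Lemma error_budget (n e t : nat) (rat dev D G H W zeta eta l : R) :
  (0 < n)%N -> (0 < t)%N -> (2 * (e + t) < n)%N ->
  0 <= dev -> 0 <= D -> 0 <= G -> H <= D + G -> 0 <= W ->
  W * (t%:R / n%:R) <= 26 * H -> 1 <= rat -> e%:R <= 2 * rat * t%:R ->
  ((4 * (e + t) < n)%N -> rat = 1) -> 0 <= l -> l <= t%:R -> 0 <= eta <= zeta ->
  forall (M := 224 * dev * (n%:R / t%:R) + W + zeta)
    (B := 384 * (1 + rat) * (8 * dev + D + G) + 130 * zeta),
  ((n <= 4 * (e + t))%N -> M <= B) /\
  ((4 * (e + t) < n)%N ->
    M * t%:R / 26 + 36 * n%:R * (dev + eta) + 19 * n%:R * eta + 8 * n%:R * D +
    2 * M * l + 2 * (e + t + e)%:R * M <= (n - 2 * (e + t))%:R * B).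
Proof.
move=> n0 t0 k2 dev0 D0 G0 HDG W0 WH rat1 et rat4 l0 lt_ /andP[eta0 etaz] M B.
have n0R : 0 < n%:R :> R by rewrite ltr0n.
have t0R : 0 < t%:R :> R by rewrite ltr0n.
have zeta0 : 0 <= zeta by exact: le_trans etaz.
have M0 : 0 <= M by rewrite /M !addr_ge0 ?mulr_ge0 ?divr_ge0 ?ler0n ?W0 ?zeta0 ?dev0.
have Wt : W * t%:R <= 26 * H * n%:R.
  by move: WH; rewrite mulrA ler_pdivrMr.
have ME : M * t%:R = 224 * dev * n%:R + W * t%:R + zeta * t%:R.
  by rewrite /M; field; rewrite gt_eqF.
have Mt : M * t%:R <= (224 * dev + 26 * (D + G)) * n%:R + zeta * t%:R.
  have : 26 * H * n%:R <= 26 * (D + G) * n%:R.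
    by rewrite ler_wpM2r ?(ltW n0R)//; lra.
  by rewrite ME; lra.
pose Q := 224 * dev + 26 * (D + G).
have Q0 : 0 <= Q by rewrite /Q addr_ge0// mulr_ge0// addr_ge0.
split=> [k4|k4].
  have nk : n%:R <= 8 * (1 + rat) * t%:R.
    have : n%:R <= (4 * (e + t))%:R :> R by rewrite ler_nat.
    by rewrite natrM natrD; lra.
  have : Q * n%:R <= Q * (8 * (1 + rat) * t%:R) by rewrite ler_wpM2l.
  move=> Qn; rewrite -(ler_pM2r t0R); apply: le_trans Mt _.
  apply: (@le_trans _ _ ((Q * (8 * (1 + rat)) + zeta) * t%:R)).
    by rewrite mulrDl; rewrite /Q in Qn *; lra.
  rewrite ler_wpM2r ?(ltW t0R)// lerD//; last by lra.
  rewrite mulrC (_ : 384 * _ * _ = 8 * (1 + rat) * (48 * (8 * dev + D + G))); last by ring.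
  rewrite ler_wpM2l//; last by rewrite /Q; lra.
  by rewrite mulr_ge0//; lra.
have ratE := rat4 k4.
have n2 : n%:R <= 2 * (n - 2 * (e + t))%:R :> R.
  by rewrite -natrM ler_nat; move: k2 k4; clear; lia.
have tn : t%:R <= n%:R / 4 :> R.
  by rewrite ler_pdivlMr// -natrM ler_nat; move: k2 k4; clear; lia.
have rat0 : 0 <= rat by exact: le_trans rat1.
have B0 : 0 <= B.
  by rewrite /B !addr_ge0 ?mulr_ge0 ?ler0n ?addr_ge0 ?ler01 ?rat0 ?mulr_ge0 ?ler0n.
have Ml : M * l <= M * t%:R by rewrite ler_wpM2l.
have Me : M * e%:R <= 2 * (M * t%:R).
  by rewrite mulrCA ler_wpM2l//; move: et; rewrite ratE; lra.
have zt : zeta * t%:R <= zeta * (n%:R / 4) by rewrite ler_wpM2l.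
have en : eta * n%:R <= zeta * n%:R by rewrite ler_wpM2r// ltW.
have Hn : n%:R * B <= 2 * ((n - 2 * (e + t))%:R * B).
  by rewrite mulrA ler_wpM2r.
have BE : n%:R * B = 6144 * (dev * n%:R) + 768 * (D * n%:R) + 768 * (G * n%:R) + 130 * (zeta * n%:R).
  by rewrite /B ratE; ring.
have dn : 0 <= dev * n%:R by rewrite mulr_ge0// ltW.
have Dn : 0 <= D * n%:R by rewrite mulr_ge0// ltW.
have Gn : 0 <= G * n%:R by rewrite mulr_ge0// ltW.
have zn : 0 <= zeta * n%:R by rewrite mulr_ge0// ltW.
rewrite !natrD; lra.
Qed.

End Constants.

(** * The good event in a finite model *)

Section FiniteModel.
Context (R : realType).

Lemma clipN (M x : R) : 0 <= M -> clip M (- x) = - clip M x.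
Proof.
move=> M0.
have [[h ->]|[/andP[h h'] ->]|[h ->]] := clip_cases x M0;
  have [[k E]|[/andP[k k'] E]|[k E]] := clip_cases (- x) M0;
  rewrite E; lra.
Qed.

Lemma level_moment (n t : nat) (M nu r : R) : (0 < n)%N -> (0 < t)%N ->
  0 < M -> 0 <= nu -> 1 <= r -> 2 * (13 * n%:R / t%:R) `^ r^-1 * nu <= M ->
  n%:R * (2 * nu / M) `^ r <= t%:R / 13.
Proof.
move=> n0 t0 M0 nu0 r1 levM.
have n0R : 0 < n%:R :> R by rewrite ltr0n.
have t0R : 0 < t%:R :> R by rewrite ltr0n.
set y := 13 * n%:R / t%:R in levM.
have y0 : 0 < y by rewrite divr_gt0// mulr_gt0.
have r0 : 0 < r by lra.
have le1 : 2 * nu / M * y `^ r^-1 <= 1.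
  by rewrite mulrAC ler_pdivrMr// mul1r; apply: le_trans levM; rewrite mulrAC.
have a0 : 0 <= 2 * nu / M by rewrite divr_ge0 ?mulr_ge0// ltW.
set a := 2 * nu / M in le1 a0 *.
have : (a * y `^ r^-1) `^ r <= 1 `^ r.
  have ay : 0 <= a * y `^ r^-1 by rewrite mulr_ge0 ?powR_ge0.
  apply: ge0_ler_powR; rewrite ?nnegrE//.
  exact: ltW.
rewrite powR1 powRM ?powR_ge0// -powRrM mulVf ?gt_eqF// powRr1 ?(ltW y0)//.
rewrite -ler_pdivlMr// mul1r => h.
apply: (@le_trans _ _ (n%:R * y^-1)); first by rewrite ler_wpM2l// ltW.
by rewrite le_eqVlt; apply/orP; left; apply/eqP; rewrite /y; field; rewrite !gt_eqF.
Qed.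

(** The denominator S exceeds both M and nu (n / L)^(1/q); the numerator is
    compared with S = S^(2 - q) S^(q - 1) factor by factor. *)
Lemma variance_rate (n : nat) (M nu q L : R) : (0 < n)%N -> 0 < M -> 0 <= nu ->
  1 <= q <= 2 -> 0 < L ->
  n%:R * (M `^ (2 - q) * nu `^ q) / (M + nu * (n%:R / L) `^ q^-1) <=
  n%:R * (nu * (L / n%:R) `^ (1 - q^-1)).
Proof.
move=> n0 M0 nu0 /andP[q1 q2] L0.
have n0R : 0 < n%:R :> R by rewrite ltr0n.
have q0 : 0 < q by lra.
set z := (n%:R / L) `^ q^-1; set w := (L / n%:R) `^ q^-1.
have zw : z * w = 1.
  rewrite /z /w -powRM ?divr_ge0 ?(ltW n0R) ?(ltW L0)//.
  by rewrite mulrA divfK ?gt_eqF// divff ?gt_eqF// powR1.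
have z0 : 0 <= z by exact: powR_ge0.
set S := M + nu * z; have S0 : 0 < S by rewrite ltr_pwDl// mulr_ge0.
have wE : (L / n%:R) `^ (1 - q^-1) = w `^ (q - 1).
  by rewrite /w -powRrM; congr (_ `^ _); field; rewrite gt_eqF.
rewrite -mulrA ler_wpM2l ?(ltW n0R)// ler_pdivrMr// wE.
have [->|nu_neq0] := eqVneq nu 0; first by rewrite powR0 ?gt_eqF// mulr0 !mul0r.
have nu1 : 0 < nu by rewrite lt_neqAle eq_sym nu_neq0.
have nuE : nu `^ q = nu * (nu * z) `^ (q - 1) * w `^ (q - 1).
  rewrite -mulrA -powRM ?mulr_ge0 ?powR_ge0// -mulrA zw mulr1.
  rewrite -{2}(powRr1 nu0) -powRD ?(gt_eqF nu1) ?implybT//.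
  by congr (_ `^ _); ring.
have SE : S = S `^ (2 - q) * S `^ (q - 1).
  rewrite -powRD ?(gt_eqF S0) ?implybT// (_ : _ + _ = 1) ?powRr1 ?ltW//; ring.
rewrite nuE [X in _ <= _ * X]SE.
rewrite (_ : M `^ (2 - q) * _ = (nu * w `^ (q - 1)) * (M `^ (2 - q) * (nu * z) `^ (q - 1))); last by ring.
rewrite ler_wpM2l ?mulr_ge0 ?powR_ge0//.
apply: ler_pM; rewrite ?powR_ge0//; apply: ge0_ler_powR; rewrite ?nnegrE ?subr_ge0 ?(ltW S0) ?(ltW M0) ?mulr_ge0//.
  by rewrite lerDl mulr_ge0.
by rewrite lerDr ltW.
Qed.

Context (T : finType) (n : nat) (p : T -> R) (pP : pmf p).
Context (J : finType) (j0 : J) (V : J -> T -> R) (neg : J -> J).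
Local Notation mu := (prodw p : {ffun 'I_n -> T} -> R).

Lemma expect_powR_scale (f : J) (a nu r : R) : 0 <= a -> 0 <= nu ->
  expect p (fun y => `|V f y| `^ r) <= nu `^ r ->
  expect p (fun y => (a * `|V f y|) `^ r) <= (a * nu) `^ r.
Proof.
move=> a0 nu0 h; rewrite powRM// (@eq_expect _ _ _ _ (fun y => a `^ r * `|V f y| `^ r)).
  by rewrite expectZ ler_wpM2l ?powR_ge0.
by move=> y; rewrite powRM.
Qed.

(** The bound for truncated sums: the bias of truncation, the randomly signed
    sums, the bias eta of the family, the moment rate D and the Chernoff term
    at confidence exp (- l). *)
Definition sum_level (t : nat) (A eta M D l : R) : R :=
  M * t%:R / 26 + 36 * n%:R * A + 19 * n%:R * eta + 8 * n%:R * D + 2 * M * l.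

(** The level M is chosen so that the ramp sums have mean at most
    t / 13 + t / 24 <= t / 8 and truncation costs a bias of at most
    M t / (26 n). The scale M + nu' (n / L)^(1/q) in [clip_sum_tail] turns both
    the variance term and its own share of the Chernoff term into the rate
    nu' (L / n)^(1 - 1/q). *)
Lemma finite_sample_good (t : nat) (M A eta nu r nu' q L l : R) :
  (0 < n)%N -> (0 < t)%N -> 0 < M ->
  (forall f y, V (neg f) y = - V f y) ->
  (forall f, `|expect p (V f)| <= eta) ->
  expect mu (fun x => maxf j0 (fun f => \sum_(i < n) V f (x i))) <= n%:R * A ->
  0 <= nu -> 1 <= r -> (forall f, expect p (fun y => `|V f y| `^ r) <= nu `^ r) ->
  0 <= nu' -> 1 <= q <= 2 ->
  (forall f, expect p (fun y => `|V f y| `^ q) <= nu' `^ q) ->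
  0 < l -> l <= L ->
  2 * (13 * n%:R / t%:R) `^ r^-1 * nu <= M ->
  4 / M * (2 * (n%:R * A) + n%:R * eta) <= t%:R / 24 ->
  1 - expR (- t%:R) - expR (- l) <= expect mu (fun x =>
    [forall f, (#|[pred i | (M < `|V f (x i)|)%R]| <= t)%N &&
      (`|\sum_(i < n) clip M (V f (x i))| <=
         sum_level t A eta M (nu' * (L / n%:R) `^ (1 - q^-1)) l)]%:R).
Proof.
move=> n0 t0 M0 Vneg Veta EA nu0 r1 nuP nu'0 q12 nu'P l0 lL levM levA.
have L0 : 0 < L by exact: lt_le_trans lL.
have n0R : 0 < n%:R :> R by rewrite ltr0n.
have muP : pmf mu by exact: prodw_pmf.
pose rho := 2 * (n%:R * A) + n%:R * eta.
have rhoP : expect mu (fun x => expect (prodw (coin R) : {ffun 'I_n -> bool} -> R) (fun e =>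
    maxf j0 (fun f => \sum_(i < n) sgb R (e i) * V f (x i)))) <= rho.
  apply: le_trans (desymmetrization j0 _ pP Vneg Veta) _.
  by rewrite lerD2r ler_wpM2l.
have momM f : n%:R * expect p (fun y => (2 * `|V f y| / M) `^ r) <= t%:R / 13.
  apply: le_trans (level_moment n0 t0 M0 nu0 r1 levM).
  rewrite ler_wpM2l ?(ltW n0R)// mulrAC.
  rewrite (@eq_expect _ _ _ _ (fun y => (2 / M * `|V f y|) `^ r)).
    by apply: expect_powR_scale => //; rewrite divr_ge0// ltW.
  by move=> y; rewrite mulrAC.
have rampP f : n%:R * expect p (fun y => ramp M (V f y)) <= t%:R / 13.
  apply: le_trans (momM f); rewrite ler_wpM2l ?(ltW n0R)//.
  by apply: le_expect => // y; exact: ramp_le_powR.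
have clipP f : n%:R * expect p (fun y => clip M (V f y)) <= M * t%:R / 26 + n%:R * eta.
  have bias : n%:R * expect p (fun y => (`|V f y| / M) `^ r) <= t%:R / 26.
    rewrite (_ : t%:R / 26 = 2^-1 * (t%:R / 13)); last by field.
    apply: (@le_trans _ _ (2^-1 * (n%:R * expect p (fun y => (2 * `|V f y| / M) `^ r)))).
      rewrite mulrCA ler_wpM2l ?(ltW n0R)// -expectZ; apply: le_expect => // y.
      have VM0 : 0 <= `|V f y| / M by rewrite divr_ge0// ltW.
      have -> : 2 * `|V f y| / M = 2 * (`|V f y| / M) by rewrite mulrA.
      rewrite (powRM _ _ VM0)// mulrA ler_peMl ?powR_ge0//.
      by have := @le_powR1 R 2 r r1 ltac:(lra); lra.
    by rewrite ler_wpM2l ?invr_ge0.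
  have : expect p (fun y => clip M (V f y)) <=
      M * expect p (fun y => (`|V f y| / M) `^ r) + eta.
    apply: le_trans (lerD (lexx _) (le_trans (ler_norm _) (Veta f))).
    rewrite -expectZ -expectD; apply: le_expect => // y.
    rewrite -lerBlDr; apply: le_trans (ler_norm _) _.
    exact: clip_error_le_powR.
  move=> h; apply: le_trans (ler_wpM2l (ltW n0R) h) _.
  by rewrite mulrDr lerD2r mulrCA -mulrA ler_wpM2l// ltW.
have S_ge : M <= M + nu' * (n%:R / L) `^ q^-1 by rewrite lerDl mulr_ge0 ?powR_ge0.
set S := M + _ in S_ge.
pose v := n%:R * (M `^ (2 - q) * nu' `^ q).
have v0 : 0 <= v by rewrite !mulr_ge0 ?powR_ge0// ltW.
have vP f : n%:R * expect p (fun y => clip M (V f y) ^+ 2) <= v.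
  rewrite ler_wpM2l ?(ltW n0R)//.
  apply: (@le_trans _ _ (expect p (fun y => M `^ (2 - q) * `|V f y| `^ q))).
    by apply: le_expect => // y; exact: clip_sqr_le_powR.
  by rewrite expectZ ler_wpM2l ?powR_ge0.
pose D := nu' * (L / n%:R) `^ (1 - q^-1).
have vS : v / S <= n%:R * D by exact: variance_rate.
have SL : S * l <= M * l + n%:R * D.
  rewrite /S mulrDl lerD2l /D.
  apply: (@le_trans _ _ (nu' * (n%:R / L) `^ q^-1 * L)).
    by rewrite ler_wpM2l// mulr_ge0 ?powR_ge0.
  rewrite le_eqVlt; apply/orP; left; apply/eqP.
  have y0 : 0 < n%:R / L by rewrite divr_gt0.
  have -> : (L / n%:R) `^ (1 - q^-1) = (n%:R / L) `^ q^-1 * (L / n%:R).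
    rewrite (_ : L / n%:R = (n%:R / L)^-1); last by rewrite invf_div.
    rewrite -[in RHS](powR_inv1 (ltW y0)) -[in LHS](powR_inv1 (ltW y0)) -powRrM.
    rewrite -powRD ?(gt_eqF y0) ?implybT//; congr (_ `^ _); ring.
  by field; rewrite gt_eqF.
have cnt := @count_tail _ _ n p pP J j0 V rho rhoP M (t%:R / 13) t M0 rampP.
have t_ge0 := ler0n R t; have {cnt} := cnt _; rewrite -/rho in levA *; move=> /(_ ltac:(lra)) cnt.
have sm := @clip_sum_tail _ _ n p pP J j0 V rho rhoP M S v l M0 S_ge v0 vP.
pose off (x : {ffun 'I_n -> T}) :=
  [exists f, n%:R * expect p (fun y => clip M (V f y)) +
      18 * rho + 6 * (v / S) + 2 * S * l < \sum_(i < n) clip M (V f (x i))].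
rewrite lerBlDr lerBlDr; apply: (@le_trans _ _ (expect mu (fun x =>
   [forall f, (#|[pred i | (M < `|V f (x i)|)%R]| <= t)%N &&
      (`|\sum_(i < n) clip M (V f (x i))| <= sum_level t A eta M D l)]%:R) +
   expect mu (fun x => (off x)%:R) +
   expect mu (fun x =>
    [exists f, (t < #|[pred i | (M < `|V f (x i)|)%R]|)%N]%:R))); last first.
  by rewrite !lerD.
rewrite -!expectD -[leLHS](expect_cst muP 1); apply: le_expect => //= x.
have [ex1|nex1] := boolP [exists f, (t < #|[pred i | (M < `|V f (x i)|)%R]|)%N].
  by rewrite /= mulr1n lerDr addr_ge0.
rewrite /= mulr0n addr0; have [ex2|nex2] := boolP (off x).
  by rewrite /= mulr1n lerDr.
rewrite /= mulr0n addr0 (_ : [forall f, _] = true)//; apply/forallP => f; apply/andP; split.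
  by move/existsPn: nex1 => /(_ f); rewrite -leqNgt.
have one g : \sum_(i < n) clip M (V g (x i)) <= sum_level t A eta M D l.
  move/existsPn: nex2 => /(_ g); rewrite -leNgt => /le_trans; apply.
  have := clipP g; rewrite /sum_level /rho; lra.
rewrite ler_norml one andbT.
have := one (neg f); rewrite (eq_bigr (fun i => - clip M (V f (x i)))).
  by rewrite sumrN lerNl.
by move=> i _; rewrite Vneg clipN// ltW.
Qed.

End FiniteModel.

(** * Functionals on a normed space *)

Section DualBall.
Context (R : realType) (X : normedModType R).
Implicit Types (f : X -> R^o) (x y : X).

Lemma linear_fun0 f : linear f -> f 0 = 0.
Proof. by move=> lf; have := lf (-1) 0 0; rewrite scaler0 addr0 scaleN1r addNr. Qed.

Lemma linear_funZ f a x : linear f -> f (a *: x) = a * f x.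
Proof. by move=> lf; rewrite -[a *: x]addr0 lf linear_fun0// addr0. Qed.

Lemma linear_funD f x y : linear f -> f (x + y) = f x + f y.
Proof. by move=> lf; rewrite -[x in LHS]scale1r lf scale1r. Qed.

Lemma linear_funB f x y : linear f -> f (x - y) = f x - f y.
Proof. by move=> lf; rewrite linear_funD// -scaleN1r linear_funZ// mulN1r. Qed.

Lemma linear_fun_sum f (I : Type) (s : seq I) (F : I -> X) : linear f ->
  f (\sum_(i <- s) F i) = \sum_(i <- s) f (F i).
Proof.
move=> lf; elim: s => [|i s IH]; first by rewrite !big_nil linear_fun0.
by rewrite !big_cons linear_funD// IH.
Qed.

Lemma dual_norm_le f (C : R) x : linear f -> (dual_norm f <= C%:E)%E ->
  `|f x| <= C * `|x|.
Proof.
move=> lf fC; have [->|x0] := eqVneq x 0; first by rewrite linear_fun0// !normr0 mulr0.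
have nx : 0 < `|x| by rewrite normr_gt0.
have : (`|f (`|x|^-1 *: x)|%:E <= C%:E)%E.
  apply: le_trans fC; apply: ereal_sup_ubound; exists (`|x|^-1 *: x) => //=.
  by rewrite normrZ ger0_norm ?invr_ge0// mulVf// gt_eqF.
rewrite lee_fin linear_funZ// normrM ger0_norm ?invr_ge0//.
by rewrite mulrC ler_pdivrMr.
Qed.

Lemma dual_ball_le f x : dual_ball f -> `|f x| <= `|x|.
Proof. by move=> [[lf _]] /dual_norm_le => /(_ x lf); rewrite mul1r. Qed.

Lemma continuous_le_norm f (C : R) : linear f -> 0 <= C ->
  (forall x, `|f x| <= C * `|x|) -> continuous f.
Proof.
move=> lf C0 fC x; apply/cvgrPdist_le => e e0.
have C1 : 0 < C + 1 by rewrite ltr_wpDl.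
near=> y; rewrite -linear_funB//; apply: le_trans (fC _) _.
apply: (@le_trans _ _ ((C + 1) * `|x - y|)).
  by rewrite ler_wpM2r// lerDl.
rewrite mulrC -ler_pdivlMr//.
by near: y; apply: cvgr_dist_le => //; exact: divr_gt0.
Unshelve. all: by end_near. Qed.

Lemma dual_ballP f : linear f -> (forall x, `|f x| <= `|x|) -> dual_ball f.
Proof.
move=> lf fx; split; first split=> //.
  by apply: (@continuous_le_norm _ 1) => // x; rewrite mul1r.
by apply: ge_ereal_sup => _ [x /= x1 <-]; rewrite lee_fin (le_trans (fx x)).
Qed.

Lemma dual_ball0 : dual_ball (fun _ : X => 0 : R^o).
Proof.
apply: dual_ballP => [a u v|x]; first by rewrite scaler0 addr0.
by rewrite normr0.
Qed.

Lemma dual_bounded f : dual f -> exists2 C : R, 0 < C & forall x, `|f x| <= C * `|x|.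
Proof.
move=> [lf cf].
have /nbhs_ballP[r /= r0 rP] : \forall x \near (0 : X), `|f x| < 1.
  have : f x @[x --> (0 : X)] --> f 0 by exact: cf.
  rewrite (linear_fun0 lf) => /cvgrPdist_lt/(_ 1 ltr01).
  by apply: filterS => x; rewrite sub0r normrN.
exists (2 / r); first by rewrite divr_gt0.
move=> x; have [->|x0] := eqVneq x 0; first by rewrite linear_fun0// !normr0 mulr0.
have nx : 0 < `|x| by rewrite normr_gt0.
pose a := r / (2 * `|x|).
have a0 : 0 < a by rewrite divr_gt0// mulr_gt0.
have : `|f (a *: x)| < 1.
  apply: rP; rewrite -ball_normE /= sub0r normrN normrZ gtr0_norm// /a.
  rewrite invfM mulrA divfK ?gt_eqF// ltr_pdivrMr// mulr_natr mulr2n.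
  by rewrite ltrDl.
rewrite linear_funZ// normrM gtr0_norm// => /ltW fa.
rewrite -(ler_pM2l a0); apply: le_trans fa _.
suff -> : a * (2 / r * `|x|) = 1 by [].
have rE : r != 0 by rewrite gt_eqF.
have nE : `|x| != 0 by rewrite gt_eqF.
by rewrite /a; move: (`|x|) (r : R) rE nE => N r'; clear => rE nE; field; rewrite nE rE.
Qed.

(** The Hahn-Banach theorem in the form that is needed: a norming functional.
    Partial functionals dominated by the norm are handled as their graphs,
    which are linear subspaces of the product; domination by the norm already
    makes such a subspace a graph. *)
Lemma norming_functional (x0 : X) : exists2 f, dual_ball f & f x0 = `|x0|.
Proof.
pose comb (G : set (X * R)) := forall (a : R) u v, G u -> G v ->
  G (a *: u.1 + v.1, a * u.2 + v.2).
pose dom (G : set (X * R)) := forall u, G u -> u.2 <= `|u.1|.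
pose base : X * R := (x0, `|x0|).
pose P (G : set (X * R)) := [/\ comb G, dom G & forall u, G u -> G base].
have [F FP Ftot|A [[Acomb Adom Abase] Amax]] := @Zorn_bigcup _ P.
  split.
  - move=> a u v [G FG Gu] [H FH Hv].
    have [GH|HG] := Ftot _ _ FG FH.
      by exists H => //; have [+ _ _] := FP _ FH; apply => //; exact: GH.
    by exists G => //; have [+ _ _] := FP _ FG; apply => //; exact: HG.
  - by move=> u [G FG Gu]; have [_ + _] := FP _ FG; exact.
  - by move=> u [G FG Gu]; exists G => //; have [_ _ Gb] := FP _ FG; exact: Gb Gu.
have A0 : A base.
  apply: contrapT => nA.
  have Aempty u : ~ A u by move=> Au; apply: nA; exact: Abase Au.
  apply: (Amax [set u | exists a : R, u = (a *: x0, a * `|x0|)]).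
    split; first by move=> u /Aempty.
    move=> BA; apply: (Aempty base); apply: BA.
    by exists 1; rewrite scale1r mul1r.
  split.
  - move=> a _ _ [b ->] [c ->] /=; exists (a * b + c).
    by rewrite scalerDl scalerA mulrDl mulrA.
  - by move=> _ [a ->] /=; rewrite normrZ ler_wpM2r// ler_norm.
  - by move=> u _; exists 1; rewrite scale1r mul1r.
have A00 : A (0, 0).
  have := Acomb (-1) base base A0 A0.
  by rewrite /= scaleN1r addNr mulN1r addNr.
have Afun x r s : A (x, r) -> A (x, s) -> r = s.
  have le r' s' : A (x, r') -> A (x, s') -> s' <= r'.
    move=> Ar As; have := Adom _ (Acomb (-1) _ _ Ar As).
    by rewrite /= scaleN1r addNr normr0 mulN1r addrC subr_le0.
  by move=> Ar As; apply/eqP; rewrite eq_le !le.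
have Atotal z : exists r, A (z, r).
  apply: contrapT => nz.
  pose L := [set u.2 - `|u.1 - z| | u in A].
  have Lub u : A u -> ubound L (`|u.1 + z| - u.2).
    move=> Au _ [v Av <-]; rewrite lerBrDr addrAC lerBlDr addrC.
    have := Adom _ (Acomb 1 _ _ Au Av); rewrite /= scale1r mul1r => /le_trans; apply.
    rewrite (_ : u.1 + v.1 = (u.1 + z) + (v.1 - z)); first exact: ler_normD.
    by rewrite addrACA subrr addr0.
  have supL : has_sup L.
    split; first by exists (0 - `|0 - z|), (0, 0).
    by eexists; exact: (Lub _ A00).
  pose c := sup L.
  have c_ge u : A u -> u.2 - `|u.1 - z| <= c.
    by move=> Au; apply: ub_le_sup; [exact: supL.2|exists u].
  have c_le u : A u -> c <= `|u.1 + z| - u.2.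
    by move=> Au; apply: ge_sup; [exact: supL.1|exact: Lub].
  apply: (Amax [set w | exists u (a : R), A u /\ w = (u.1 + a *: z, u.2 + a * c)]).
    split.
      by move=> [x r] Axr; exists (x, r), 0; split=> //=; rewrite scale0r mul0r !addr0.
    move=> BA; apply: nz; exists c; apply: BA.
    by exists (0, 0), 1; split=> //=; rewrite scale1r mul1r !add0r.
  split.
  - move=> a _ _ [u [b [Au ->]]] [v [d [Av ->]]] /=.
    exists (a *: u.1 + v.1, a * u.2 + v.2), (a * b + d); split; first exact: Acomb.
    congr (_, _) => /=; last by ring.
    by rewrite scalerDr scalerA addrACA -scalerDl.
  - move=> _ [u [a [Au ->]]] /=.
    have scaled b : A (b *: u.1, b * u.2).
      by have := Acomb b _ _ Au A00; rewrite /= !addr0.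
    have [->|a0] := eqVneq a 0; first by rewrite scale0r mul0r !addr0; exact: Adom.
    have na : 0 < `|a| by rewrite normr_gt0.
    have [a1|a1] := ltP 0 a.
      have := c_le _ (scaled a^-1); rewrite /= lerBrDr -(ler_pM2l a1) mulrDr mulVKf//.
      rewrite -[X in _ <= X * _ -> _](gtr0_norm a1) -normrZ scalerDr scalerA.
      by rewrite divff// scale1r addrC.
    have {}a1 : a < 0 by rewrite lt_neqAle a0.
    have am : 0 < - a by rewrite oppr_gt0.
    have := c_ge _ (scaled (- a)^-1); rewrite /= lerBlDr -(ler_pM2l am) mulrDr mulVKf ?oppr_eq0//.
    rewrite -[X in _ <= _ + X * _ -> _](gtr0_norm am) -normrZ scalerBr scalerA.
    rewrite divff ?oppr_eq0// scale1r scaleNr opprK mulNr.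
    by rewrite -lerBlDl opprK.
  - by move=> _ [u [a [Au _]]]; exists base, 0; split=> //; rewrite scale0r mul0r !addr0.
have [f fP] : exists f : X -> R^o, forall x, A (x, f x).
  exists (fun x => projT1 (cid (Atotal x))) => x.
  by case: cid.
have lf : linear f.
  move=> a x y; apply: (Afun _ _ _ (fP _)).
  exact: Acomb a _ _ (fP x) (fP y).
exists f; last exact: (Afun _ _ _ (fP _) A0).
apply: dual_ballP => // x; rewrite ler_norml; apply/andP; split.
  rewrite lerNl -mulN1r -(linear_funZ (-1))// scaleN1r -(normrN x).
  exact: (Adom (- x, _)).
exact: (Adom (x, _)).
Qed.

(** Pointwise separability of the dual ball: a functional is determined, up to
    a small error at finitely many given points, by coarse values at nearby
    points of a countable dense set, and there are countably many such data. *)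
Lemma dual_ball_separable (n : nat) : separable_space X ->
  exists F : nat -> X -> R^o, (forall j, dual_ball (F j)) /\
    forall f (x : 'I_n -> X) (kap : R), dual_ball f -> 0 < kap ->
      exists j, forall i, `|F j (x i) - f (x i)| <= kap.
Proof.
move=> [D /countable_injP[h hinj] Ddense].
pose e k : X := get [set d | D d /\ h d = k].
have eP d : D d -> e (h d) = d.
  move=> Dd; have [De he] : [set d' | D d' /\ h d' = h d] (e (h d)).
    by apply: getPex; exists d.
  by apply: hinj; rewrite ?inE.
pose code := ({ffun 'I_n -> nat * int} * nat)%type.
pose spec (c : code) f := dual_ball f /\
  forall i, Num.floor (c.2.+1%:R * f (e (c.1 i).1)) = (c.1 i).2.
pose F j : X -> R^o := match @unpickle code j with
  | Some c => xget (fun=> 0) [set f | spec c f]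
  | None => fun=> 0 end.
exists F; split.
  move=> j; rewrite /F; case: unpickle => [c|]; last exact: dual_ball0.
  by case: xgetP => [f -> []|_]//; exact: dual_ball0.
move=> f x kap fB kap0.
have [m mP] : exists m : nat, m.+1%:R^-1 <= kap / 4.
  have [m _ /(_ m (leqnn m)) mP] := near_infty_natSinv_lt (PosNum (divr_gt0 kap0 (ltr0Sn R 3))).
  by exists m; exact: ltW.
have close y : exists d, D d /\ `|y - d| <= kap / 4.
  have [||d [yd Dd]] := Ddense (ball y (kap / 4)).
  - by exists y; apply: ballxx; rewrite divr_gt0.
  - by apply: ball_open; rewrite divr_gt0.
  by exists d; split=> //; apply: ltW; move: yd; rewrite -ball_normE.
pose d i := projT1 (cid (close (x i))).
have dP i : D (d i) /\ `|x i - d i| <= kap / 4 by rewrite /d; case: cid.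
pose c : code := ([ffun i => (h (d i), Num.floor (m.+1%:R * f (d i)))], m).
have sf : spec c f.
  by split=> // i; rewrite ffunE /= eP//; exact: (dP i).1.
exists (pickle c) => i; rewrite /F pickleK.
have : spec c (xget (fun=> 0) [set f | spec c f]) by apply: xgetPex; exists f.
move: (xget _ _) => g [gB gc].
have := gc i; rewrite ffunE /= eP; last exact: (dP i).1.
move=> fl; have m0 : 0 < m.+1%:R :> R by [].
have gd : `|g (d i) - f (d i)| <= kap / 4.
  apply: le_trans mP; rewrite -(ler_pM2l m0) divff ?gt_eqF//.
  rewrite -[X in X * _](gtr0_norm m0) -normrM mulrBr ler_norml.
  have := floor_itv (m.+1%:R * g (d i)); have := floor_itv (m.+1%:R * f (d i)).
  rewrite fl => /andP[u1 u2] /andP[v1 v2]; rewrite intrD1 in u2 v2.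
  by apply/andP; split; lra.
have lg : linear g by case: gB => -[].
have lf : linear f by case: fB => -[].
have g1 := dual_ball_le (x i - d i) gB; have f1 := dual_ball_le (x i - d i) fB.
rewrite linear_funB// in g1; rewrite linear_funB// in f1.
have xd := (dP i).2.
rewrite (_ : g (x i) - f (x i) = (g (x i) - g (d i)) - (f (x i) - f (d i)) +
  (g (d i) - f (d i))); last by ring.
apply: le_trans (ler_normD _ _) _; have := ler_normB (g (x i) - g (d i)) (f (x i) - f (d i)).
by lra.
Qed.

End DualBall.

(** * Finitely valued images of random elements *)

Section FiniteValuedMaps.
Context d (Om : measurableType d) (R : realType) (Q : probability Om R).
Context (A : finType) (Phi : Om -> A).
Hypothesis mPhi : forall a, measurable (Phi @^-1` [set a]).

Definition law (a : A) : R := fine (Q (Phi @^-1` [set a])).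

Lemma lawE a : (law a)%:E = Q (Phi @^-1` [set a]).
Proof. by rewrite /law fineK// fin_num_measure. Qed.

Lemma comp_finite_valued (g : A -> R) w :
  (g (Phi w))%:E = (\sum_a (g a)%:E * (\1_(Phi @^-1` [set a]) w)%:E)%E.
Proof.
rewrite (bigD1 (Phi w))//= big1 ?adde0 => [|a aw].
  by rewrite indicE mem_set// mule1.
by rewrite indicE memNset ?mule0// => /esym/eqP; rewrite (negPf aw).
Qed.

Lemma integral_finite_valued (g : A -> R) :
  (\int[Q]_w (g (Phi w))%:E = (expect law g)%:E)%E.
Proof.
under eq_integral do rewrite comp_finite_valued.
rewrite integral_sum//; last first.
  by move=> a; apply: integrableZl => //; exact: integrable_indic.
rewrite /expect -sumEFin; apply: eq_bigr => a _.
rewrite integralZl//; last exact: integrable_indic.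
by rewrite integral_indic// setIT muleC EFinM lawE.
Qed.

Lemma law_pmf : pmf law.
Proof.
split=> [a|]; first by rewrite /law fine_ge0.
apply: EFin_inj; have := integral_finite_valued (fun=> 1).
rewrite /expect; under eq_bigr do rewrite mulr1.
by move=> <-; rewrite integral_cst//= mul1e; exact: probability_setT.
Qed.

Lemma measurable_finite_preimage (B : pred A) : measurable (Phi @^-1` [set a | B a]).
Proof.
have -> : Phi @^-1` [set a | B a] = \bigcup_(a in [set a | B a]) (Phi @^-1` [set a]).
  apply/seteqP; split=> [w Bw|w [a Ba wa]]; first by exists (Phi w).
  by rewrite /= (wa : Phi w = a).
by apply: fin_bigcup_measurable => //; exact: finite_finset.
Qed.

Lemma probability_finite_preimage (B : pred A) :
  Q (Phi @^-1` [set a | B a]) = (expect law (fun a => (B a)%:R))%:E.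
Proof.
rewrite -integral_finite_valued -[X in Q X](setIT _).
rewrite -(integral_indic _ _ (measurable_finite_preimage B))//.
apply: eq_integral => w _; rewrite indicE; congr (_%:R%:E).
congr nat_of_bool; apply/idP/idP => [/set_mem|Bw]; [by []|exact: mem_set].
Qed.

End FiniteValuedMaps.

(** The law of a coded i.i.d. sample is the product of the one-sample law:
    independence is only used on products of fibres of the coding. *)
Section CodedSample.
Context (R : realType) (X : normedModType R) (n : nat).
Context (P : probability (borel X) R) d (Om : measurableType d).
Context (Pr : probability Om R) (Z : 'I_n -> {RV Pr >-> borel X}) (ZP : iid P Z).
Context (T : finType) (code : borel X -> T).
Hypothesis mcode : forall a, measurable (code @^-1` [set a]).

Definition coded (w : Om) : {ffun 'I_n -> T} := [ffun i => code (Z i w)].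

Lemma codedE (x : {ffun 'I_n -> T}) : coded @^-1` [set x] =
  \bigcap_(i in [set` [set: 'I_n]%SET]) (Z i @^-1` (code @^-1` [set x i])).
Proof.
apply/seteqP; split=> [w <- i _|w H] /=; first by rewrite ffunE.
by apply/ffunP => i; rewrite ffunE; apply: H; rewrite /= inE.
Qed.

Lemma measurable_coded x : measurable (coded @^-1` [set x]).
Proof.
rewrite codedE; apply: fin_bigcap_measurable; first exact: finite_finset.
by move=> i _; rewrite -[_ @^-1` _]setTI; apply: measurable_funPT.
Qed.

Lemma coded_law x : law Pr coded x = prodw (law P code) x.
Proof.
apply: EFin_inj; rewrite lawE; last exact: measurable_coded.
rewrite codedE (ZP.1 [set: 'I_n]%SET (fun i => code @^-1` [set x i]))//.
rewrite /prodw -prodEFin; apply: eq_big => [i|i _]; first by rewrite inE.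
by rewrite lawE// -(ZP.2 i)//.
Qed.

End CodedSample.

Section Measurability.
Context (R : realType).
Import HBNNSimple.

Lemma continuous_borel (X : normedModType R) (f : X -> R) : continuous f ->
  measurable_fun [set: borel X] (f : borel X -> R).
Proof.
move=> /continuousP cf; apply: (measurability _ (RGenOpens.measurableE R)).
move=> _ [_ [a [b ->] <-]]; rewrite setTI; apply: sub_sigma_algebra.
exact/cf/interval_open.
Qed.

(** The integral of a nonnegative function is a supremum over the simple
    functions below it. The comparison serves with g the norm of a sample
    mean. *)
Lemma ge0_le_integral_any d (T : measurableType d) (mu : {measure set T -> \bar R})
    (f g : T -> \bar R) : (forall x, (0 <= f x)%E) -> (forall x, (f x <= g x)%E) ->
  (\int[mu]_x f x <= \int[mu]_x g x)%E.
Proof.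
move=> f0 fg; have g0 x : (0 <= g x)%E by exact: le_trans (fg x).
rewrite !ge0_integralTE//; apply: ge_ereal_sup => _ [h hf <-].
by apply: ereal_sup_ubound; exists h => // x; exact: le_trans (fg x).
Qed.

(** The positive and the negative part are approximated from below by simple
    functions. As absolute values shrink, every moment bound is kept. *)
Lemma finite_discretization : exists disc : nat -> R -> R,
  [/\ forall K, measurable_fun [set: R] (disc K),
      forall K, exists vals : seq R, forall x, disc K x \in vals,
      forall K x, `|disc K x| <= `|x| &
      forall x, disc K x @[K --> \oo] --> x].
Proof.
pose pos (x : R) : \bar R := (Num.max x 0)%:E.
have mpos : measurable_fun [set: R] pos.
  by apply/measurable_EFinP; apply: measurable_maxr => //; exact: measurable_id.
have pos0 x : [set: R] x -> (0 <= pos x)%E by rewrite lee_fin le_max lexx orbT.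
pose s := nnsfun_approx measurableT mpos.
have s_ge0 K x : 0 <= s K x by [].
have s_le K x : s K x <= Num.max x 0.
  by rewrite -lee_fin /s nnsfun_approxE; exact: (le_approx K pos0).
have s_cvg x : s K x @[K --> \oo] --> Num.max x 0.
  have := cvg_nnsfun_approx measurableT mpos pos0 (I : [set: R] x).
  by move/fine_cvg; apply.
exists (fun K x => s K x - s K (- x)); split.
- move=> K; apply: measurable_funB; first exact: measurable_funPT.
  by apply: measurableT_comp => //; exact: measurable_funPT.
- move=> K; have /finite_seqP[v vE] : finite_set (range (s K)) by [].
  exists [seq a - b | a <- v, b <- v] => x.
  have sv y : s K y \in v.
    by have : range (s K) (s K y) by [exists y]; rewrite vE.
  by apply/allpairsP; exists (s K x, s K (- x)); rewrite !sv.
- move=> K x; have := s_le K x; have := s_le K (- x).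
  have := s_ge0 K x; have := s_ge0 K (- x).
  have /orP[x0|x0] := le_total 0 x.
    rewrite (max_r (_ : - x <= 0)) ?oppr_le0// max_l// => a b c d.
    by rewrite (ger0_norm x0) ler_norml; apply/andP; split; lra.
  rewrite (max_l (_ : 0 <= - x)) ?oppr_ge0// max_r// => a b c d.
  by rewrite (ler0_norm x0) ler_norml; apply/andP; split; lra.
- move=> x; rewrite [X in _ --> X](_ : x = Num.max x 0 - Num.max (- x) 0).
    by apply: cvgB; exact: s_cvg.
  have /orP[x0|x0] := le_total 0 x.
    by rewrite max_l// max_r ?subr0// oppr_le0.
  by rewrite max_r// max_l ?sub0r ?opprK// oppr_ge0.
Qed.

End Measurability.

Section PettisMean.
Context (R : realType) (X : normedModType R) (P : probability (borel X) R).
Hypothesis P_integrable : (\int[P]_x `|(x : X)|%:E < +oo)%E.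

Lemma integrable_norm : P.-integrable [set: borel X] (fun x => `|(x : X)|%:E).
Proof.
apply/integrableP; split.
  by apply/measurable_EFinP; apply: continuous_borel => x; exact: norm_continuous.
by under eq_integral do rewrite gee0_abs//.
Qed.

Lemma integrable_dual (f : X -> R^o) : dual f ->
  P.-integrable [set: borel X] (fun x => (f x)%:E).
Proof.
move=> df; have [C C0 fC] := dual_bounded df.
apply: (le_integrable measurableT _ _ (integrableZl measurableT C integrable_norm)).
  by apply/measurable_EFinP; apply: continuous_borel; case: df.
move=> x _; rewrite /= lee_fin normrM normr_id gtr0_norm//; exact: fC.
Qed.

(** The functional f |-> E f(X) on the dual is linear and bounded by E |X|, so
    reflexivity makes it the evaluation at a point. *)
Lemma meanP (f : X -> R^o) : reflexive_space X -> dual f ->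
  (\int[P]_x (f (x : X))%:E = (f (mean P))%:E)%E.
Proof.
move=> refl; move: f.
suff : [set m : X | forall f, dual f -> (\int[P]_x (f (x : X))%:E = (f m)%:E)%E] (mean P).
  by [].
apply: getPex.
pose Psi (f : X -> R^o) : R := fine (\int[P]_x (f x)%:E).
have PsiE f : dual f -> (\int[P]_x (f x)%:E = (Psi f)%:E)%E.
  by move=> df; rewrite /Psi fineK//; exact: integrable_fin_num (integrable_dual df).
have [|m mP] := refl Psi; last first.
  by exists m => f df; rewrite PsiE// mP.
split=> [a f g df dg|].
  have [Cf Cf0 fC] := dual_bounded df; have [Cg Cg0 gC] := dual_bounded dg.
  have lfg : linear (a *: f + g).
    move=> b x y; have [lf _] := df; have [lg _] := dg.
    change (a *: f (b *: x + y) + g (b *: x + y) =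
      b *: (a *: f x + g x) + (a *: f y + g y)).
    rewrite lf lg !scalerDr !scalerA (mulrC b a) addrACA; congr (_ + _).
  have dfg : dual (a *: f + g).
    split=> //; apply: (@continuous_le_norm _ _ _ (`|a| * Cf + Cg)) => // [|x].
      by rewrite addr_ge0 ?mulr_ge0// ltW.
    change (`|a * f x + g x| <= (`|a| * Cf + Cg) * `|x|).
    apply: le_trans (ler_normD _ _) _; rewrite mulrDl lerD// normrM -mulrA.
    by rewrite ler_wpM2l.
  apply: EFin_inj; rewrite -PsiE// EFinD EFinM -!PsiE//.
  rewrite -integralZl//; last exact: integrable_dual.
  rewrite -integralD//; last 2 first.
    exact/integrableZl/integrable_dual.
  exact: integrable_dual.
pose M := fine (\int[P]_x `|(x : X)|%:E) + 1.
have E0 : 0 <= fine (\int[P]_x `|(x : X)|%:E).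
  by rewrite fine_ge0// integral_ge0.
exists M => f df; case E : (dual_norm f) => [c||].
- have fc x := dual_norm_le x df.1 (_ : (dual_norm f <= c%:E)%E).
  have {}fc x : `|f x| <= c * `|x| by apply: fc; rewrite E.
  have c0 : 0 <= c.
    have : (`|f 0|%:E <= dual_norm f)%E by apply: ereal_sup_ubound; exists 0 => //=; rewrite normr0.
    by rewrite E lee_fin; apply: le_trans.
  rewrite -EFinM -[`|Psi f|%:E]/(`|(Psi f)%:E|%E) -PsiE//.
  have [mf _] := integrableP _ _ _ (integrable_dual df).
  apply: le_trans (le_abse_integral P measurableT mf) _.
  apply: (@le_trans _ _ (\int[P]_x (c%:E * `|(x : X)|%:E))%E).
    apply: ge0_le_integral_any => x //.
    by rewrite /= lee_fin.
  rewrite integralZl//; last exact: integrable_norm.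
  rewrite -[X in (_ * X <= _)%E]fineK; last exact: integrable_fin_num integrable_norm.
  by rewrite -EFinM lee_fin mulrC ler_wpM2r// lerDl.
- by rewrite gt0_muley ?leey// lte_fin ltr_wpDl.
- have : (`|f 0|%:E <= dual_norm f)%E by apply: ereal_sup_ubound; exists 0 => //=; rewrite normr0.
  by rewrite E.
Qed.

End PettisMean.

(** * The good event for finitely many functionals *)

Lemma nu_ge0 (R : realType) (X : normedModType R) (P : probability (borel X) R) (q : R) :
  (0 <= nu P q)%E.
Proof.
apply: (@le_trans _ _ (Lnorm P q%:E (fun x : borel X => (0 : R)%:E))); first exact: Lnorm_ge0.
by apply: ereal_sup_ubound; exists (fun=> 0) => //; exact: dual_ball0.
Qed.

Section CentredFunctionals.
Context (R : realType) (X : normedModType R) (P : probability (borel X) R).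
Hypothesis P_integrable : (\int[P]_x `|(x : X)|%:E < +oo)%E.
Hypothesis X_reflexive : reflexive_space X.

Definition centred (f : X -> R^o) (x : borel X) : R := f ((x : X) - mean P).

Lemma centredE (f : X -> R^o) x : dual f -> centred f x = f x - f (mean P).
Proof. by case=> lf _; rewrite /centred linear_funB. Qed.

Lemma integrable_centred (f : X -> R^o) : dual f ->
  P.-integrable [set: borel X] (EFin \o centred f).
Proof.
move=> df; rewrite (_ : EFin \o _ = fun x : borel X => ((f x)%:E - (f (mean P))%:E)%E).
  apply: integrableB => //; first exact: integrable_dual.
  exact: finite_measure_integrable_cst.
by apply/funext => x; rewrite /= centredE// EFinB.
Qed.

Lemma measurable_centred (f : X -> R^o) : dual f ->
  measurable_fun [set: borel X] (centred f).
Proof.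
by move=> df; apply/measurable_EFinP; case/integrableP: (integrable_centred df).
Qed.

Lemma integral_centred (f : X -> R^o) : dual f ->
  (\int[P]_x (centred f x)%:E = 0)%E.
Proof.
move=> df; under eq_integral do rewrite centredE// EFinB.
rewrite integralB_EFin//; last 2 first.
- exact: integrable_dual.
- exact: finite_measure_integrable_cst.
by rewrite meanP// integral_cst//= probability_setT mule1 subee.
Qed.

Lemma moment_centred (f : X -> R^o) (q : R) : 1 <= q -> dual_ball f ->
  nu P q \is a fin_num ->
  (\int[P]_x (`|centred f x| `^ q)%:E <= (fine (nu P q) `^ q)%:E)%E.
Proof.
move=> q1 fB nufin; have q0 : 0 < q by lra.
have : (Lnorm P q%:E (fun x => (centred f x)%:E) <= nu P q)%E.
  by apply: ereal_sup_ubound; exists f.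
have := powR_Lnorm P (fun x => (centred f x)%:E) (_ : q != 0).
rewrite gt_eqF// => /(_ isT) LE h.
rewrite (eq_integral (fun x => `|(centred f x)%:E| `^ q)%E); last by [].
rewrite -LE -poweR_EFin fineK//; apply: gt0_ler_poweR => //.
- by rewrite ltW.
- by rewrite in_itv/= Lnorm_ge0 leey.
- by rewrite in_itv/= (le_trans (Lnorm_ge0 _ _ _) h) leey.
Qed.

End CentredFunctionals.

Section SampleEvent.
Context (R : realType) (X : normedModType R) (P : probability (borel X) R).
Hypothesis P_integrable : (\int[P]_x `|(x : X)|%:E < +oo)%E.
Hypothesis X_reflexive : reflexive_space X.
Context (disc : nat -> R -> R).
Hypothesis mdisc : forall K, measurable_fun [set: R] (disc K).
Hypothesis disc_finite : forall K, exists vals : seq R, forall x, disc K x \in vals.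
Hypothesis disc_le : forall K x, `|disc K x| <= `|x|.
Hypothesis disc_cvg : forall x, disc K x @[K --> \oo] --> x.
Context (F : nat -> X -> R^o) (FB : forall j, dual_ball (F j)).

Local Notation V j := (@centred _ _ P (F j)).

Let mV j : measurable_fun [set: borel X] (V j).
Proof. by apply: measurable_centred => //; case: (FB j). Qed.

Let iV j : P.-integrable [set: borel X] (EFin \o V j).
Proof. by apply: integrable_centred => //; case: (FB j). Qed.

Let mdV K j : measurable_fun [set: borel X] (fun x => disc K (V j x)).
Proof. exact: (measurableT_comp (mdisc K)). Qed.

Let idV K j : P.-integrable [set: borel X] (fun x => (disc K (V j x))%:E).
Proof.
apply: (le_integrable measurableT _ _ (iV j)) => [|x _]; first exact/measurable_EFinP.
by rewrite /= lee_fin disc_le.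
Qed.

Lemma discretization_error_cvg j (e : R) : 0 < e -> exists K0, forall K, (K0 <= K)%N ->
  (\int[P]_x `|disc K (V j x) - V j x|%:E < e%:E)%E.
Proof.
move=> e0.
have [|||||_ + _] := @dominated_convergence _ _ _ P _ measurableT
  (fun K x => (disc K (V j x))%:E) (EFin \o V j) (fun x => `|V j x|%:E).
- by move=> K; exact/measurable_EFinP.
- exact/measurable_EFinP.
- by apply/aeW => x _; apply: cvg_EFin; [exact: nearW|exact: disc_cvg].
- apply: (le_integrable measurableT _ _ (iV j)) => [|x _].
    by apply/measurable_EFinP; exact: measurableT_comp.
  by rewrite /= lee_fin normr_id.
- by apply/aeW => x K _; rewrite /= lee_fin disc_le.
move=> /fine_cvgP[fin /cvgr_lt/(_ e e0) lt].
have [K0 _ K0P] := filterI fin lt.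
exists K0 => K /K0P[/= finK ltK].
rewrite (_ : (\int[P]_x _)%E = (fine (\int[P]_x `|(disc K (V j x))%:E - (EFin \o V j) x|))%:E)%E.
  by rewrite lte_fin.
by rewrite fineK.
Qed.

Lemma uniform_discretization (N K0 : nat) (e : R) : 0 < e -> exists2 K, (K0 <= K)%N &
  forall j, (j <= N)%N -> (\int[P]_x `|disc K (V j x) - V j x|%:E <= e%:E)%E.
Proof.
move=> e0; have H j := cid (discretization_error_cvg j e0).
exists (\max_(j < N.+1) projT1 (H j) + K0)%N; first exact: leq_addl.
move=> j jN; apply/ltW; have := projT2 (H j); apply.
apply: leq_trans (leq_addr _ _).
exact: (leq_bigmax (F := fun i : 'I_N.+1 => projT1 (H i)) (Ordinal (jN : (j < N.+1)%N))).
Qed.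

Context (n : nat) (n_gt0 : (0 < n)%N).

Lemma norm_sample_sum_le (f : X -> R^o) (z : 'I_n -> X) : dual_ball f ->
  `|\sum_(i < n) f (z i - mean P)| <=
  n%:R * `|n%:R^-1 *: (\sum_(i < n) z i) - mean P|.
Proof.
move=> fB; have lf : linear f by case: fB => -[].
rewrite -(linear_fun_sum _ _ lf); apply: le_trans (dual_ball_le _ fB) _.
rewrite -[X in X * _](ger0_norm (ler0n R n)) -normrZ scalerBr scalerA divff; last first.
  by rewrite pnatr_eq0 -lt0n.
by rewrite scale1r sumrB sumr_const card_ord scaler_nat.
Qed.

Section OneSample.
Context d (Om : measurableType d) (Pr : probability Om R).
Context (Z : 'I_n -> {RV Pr >-> borel X}) (ZP : iid P Z).

Lemma integral_sample (g : borel X -> R) i : measurable_fun setT g ->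
  (forall x, 0 <= g x) ->
  (\int[Pr]_w (g (Z i w))%:E = \int[P]_x (g x)%:E)%E.
Proof.
move=> mg g0.
have mg' : measurable_fun setT (EFin \o g) by exact/measurable_EFinP.
have := @ge0_integral_pushforward _ _ _ _ R (Z i) (measurable_funP (Z i)) Pr setT
  (EFin \o g) measurableT mg' (fun x _ => g0 x).
rewrite preimage_setT => <-.
apply: eq_measure_integral => A mA _; exact: ZP.2.
Qed.

Section Coding.
Context (N K : nat) (vals : seq R) (valsP : forall x, disc K x \in vals).

Definition code (x : borel X) : {ffun 'I_N.+1 -> seq_sub vals} :=
  [ffun j : 'I_N.+1 => SeqSub (valsP (V j x))].

Lemma measurable_code a : measurable (code @^-1` [set a]).
Proof.
have -> : code @^-1` [set a] =
    \bigcap_(j in [set: 'I_N.+1]) ((fun x => disc K (V j x)) @^-1` [set ssval (a j)]).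
  apply/seteqP; split=> [x <- j _|x H] /=; first by rewrite ffunE.
  by apply/ffunP => j; rewrite ffunE; apply: val_inj; exact: H.
apply: fin_bigcap_measurable; first exact: finite_finset.
by move=> j _; rewrite -[_ @^-1` _]setTI; apply: mdV.
Qed.

(** The family is doubled with its negatives, so that one-sided maxima control
    absolute values. *)
Definition coded_functional (f : 'I_N.+1 * bool) (c : {ffun 'I_N.+1 -> seq_sub vals}) : R :=
  sgb R f.2 * ssval (c f.1).

Lemma coded_functionalE f x :
  coded_functional f (code x) = sgb R f.2 * disc K (V f.1 x).
Proof. by rewrite /coded_functional ffunE. Qed.

Lemma norm_coded_functional f x :
  `|coded_functional f (code x)| = `|disc K (V f.1 x)|.
Proof. by rewrite coded_functionalE normrM normr_sgb mul1r. Qed.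

Local Notation p := (law P code).
Local Notation J := ('I_N.+1 * bool)%type.
Local Notation W := coded_functional.
Let j0 : J := (ord0, true).

Lemma integral_coded (g : {ffun 'I_N.+1 -> seq_sub vals} -> R) :
  (\int[P]_x (g (code x))%:E = (expect p g)%:E)%E.
Proof. exact: (integral_finite_valued P measurable_code). Qed.

Lemma coded_moment (f : J) (q c : R) : 0 <= q ->
  (\int[P]_x (`|V f.1 x| `^ q)%:E <= (c `^ q)%:E)%E ->
  expect p (fun y => `|W f y| `^ q) <= c `^ q.
Proof.
move=> q0; rewrite -[expect _ _ <= _]lee_fin -integral_coded; apply: le_trans.
apply: ge0_le_integral_any => x; first by rewrite lee_fin powR_ge0.
rewrite lee_fin norm_coded_functional; apply: ge0_ler_powR; rewrite ?nnegrE//.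
Qed.

Lemma coded_bias (f : J) (e : R) :
  (\int[P]_x `|disc K (V f.1 x) - V f.1 x|%:E <= e%:E)%E ->
  `|expect p (W f)| <= e.
Proof.
move=> he.
have -> : `|expect p (W f)| = `|expect p (fun c => ssval (c f.1))|.
  by rewrite /coded_functional expectZ normrM normr_sgb mul1r.
have E : (\int[P]_x (disc K (V f.1 x))%:E =
    (expect p (fun c : {ffun 'I_N.+1 -> seq_sub vals} => ssval (c f.1)))%:E)%E.
  by rewrite -integral_coded; apply: eq_integral => x _; rewrite ffunE.
rewrite -lee_fin; apply: le_trans he.
rewrite -[X in (X <= _)%E]/(`|(expect p (fun c => ssval (c f.1)))%:E|%E) -E.
have -> : (\int[P]_x (disc K (V f.1 x))%:E =
    \int[P]_x ((disc K (V f.1 x))%:E - (V f.1 x)%:E))%E.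
  rewrite integralB_EFin//; last exact: idV.
  by rewrite integral_centred ?sube0//; case: (FB f.1).
apply: le_trans (le_abse_integral _ _ _) _ => //.
by apply/measurable_EFinP; exact: measurable_funB.
Qed.

(** The mean largest sum over the coded family is controlled by the deviation
    of the sample mean in norm. The norm of the sample mean enters as an upper
    bound of the integral of a measurable function. *)
Lemma coded_deviation (dev e : R) : 0 <= e ->
  (forall j, (j <= N)%N ->
    (\int[P]_x `|disc K (V j x) - V j x|%:E <= (e / N.+1%:R)%:E)%E) ->
  (expected_deviation Z (mean P) <= dev%:E)%E ->
  expect (prodw p : {ffun 'I_n -> _} -> R)
    (fun x => maxf j0 (fun f => \sum_(i < n) W f (x i))) <= n%:R * (dev + e).
Proof.
move=> e0 he hdev; have n0R : 0 < n%:R :> R by rewrite ltr0n.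
pose D (x : {ffun 'I_n -> {ffun 'I_N.+1 -> seq_sub vals}}) :=
  maxf j0 (fun f => \sum_(i < n) W f (x i)).
pose cz := coded Z code.
have mcz := measurable_coded Z measurable_code.
have ED : (\int[Pr]_w (D (cz w))%:E = (expect (prodw p) D)%:E)%E.
  rewrite (integral_finite_valued Pr mcz); congr (_%:E).
  by apply: eq_bigr => x _; rewrite (coded_law ZP measurable_code).
have mD : measurable_fun setT (fun w => D (cz w)).
  apply/measurable_EFinP.
  rewrite (_ : EFin \o _ = fun w => (\sum_a (D a)%:E * (\1_(cz @^-1` [set a]) w)%:E)%E).
    apply: emeasurable_sum => a; apply: measurable_funeM.
    by apply/measurable_EFinP; exact: measurable_indic.
  by apply/funext => w; rewrite -(comp_finite_valued cz).
pose err i j w := `|disc K (V j (Z i w)) - V j (Z i w)|.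
have merr i j : measurable_fun setT (err i j).
  apply: measurableT_comp => //; apply: measurable_funB.
    by apply: (measurableT_comp (mdV K j)).
  by apply: (measurableT_comp (mV j)).
have Eerr i j : (j <= N)%N -> (\int[Pr]_w (err i j w)%:E <= (e / N.+1%:R)%:E)%E.
  move=> jN; apply: le_trans (he j jN).
  rewrite -(@integral_sample (fun x => `|disc K (V j x) - V j x|) i)//.
  by apply: measurableT_comp => //; exact: measurable_funB.
pose Err w := \sum_(i < n) \sum_(j < N.+1) err i j w.
have mErr : measurable_fun setT Err.
  by apply: measurable_sum => i; apply: measurable_sum => j.
have err0 i j w : 0 <= err i j w by exact: normr_ge0.
have Err0 w : 0 <= Err w by apply: sumr_ge0 => i _; apply: sumr_ge0 => j _; exact: err0.
have EErr : (\int[Pr]_w (Err w)%:E <= (n%:R * e)%:E)%E.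
  under eq_integral do rewrite -sumEFin.
  rewrite ge0_integral_sum//; last 2 first.
  - by move=> i; apply/measurable_EFinP; apply: measurable_sum.
  - by move=> i w _; rewrite lee_fin sumr_ge0.
  rewrite mulr_natl -[X in X%:E](_ : \sum_(i < n) e = _); last by rewrite sumr_const card_ord.
  rewrite -sumEFin; apply: lee_sum => i _.
  under eq_integral do rewrite -sumEFin.
  rewrite ge0_integral_sum//; last 2 first.
  - by move=> j; exact/measurable_EFinP.
  - by move=> j w _; rewrite lee_fin.
  rewrite [X in (_ <= X%:E)%E](_ : e = \sum_(j < N.+1) e / N.+1%:R); last first.
    by rewrite sumr_const card_ord -[RHS]mulr_natr divfK// pnatr_eq0.
  by rewrite -sumEFin; apply: lee_sum => j _; apply: Eerr; rewrite -ltnS.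
pose nrm w := `|n%:R^-1 *: (\sum_(i < n) (Z i w : X)) - mean P|.
have point w : D (cz w) <= n%:R * nrm w + Err w.
  apply: maxf_le => f.
  have -> : \sum_(i < n) W f (cz w i) = sgb R f.2 * \sum_(i < n) V f.1 (Z i w) +
      sgb R f.2 * \sum_(i < n) (disc K (V f.1 (Z i w)) - V f.1 (Z i w)).
    rewrite -mulrDr -big_split mulr_sumr; apply: eq_bigr => i _ /=.
    by rewrite ffunE coded_functionalE addrC subrK.
  apply: lerD.
    apply: le_trans (ler_norm _) _; rewrite normrM normr_sgb mul1r.
    exact: (norm_sample_sum_le (fun i => Z i w) (FB f.1)).
  apply: le_trans (ler_norm _) _; rewrite normrM normr_sgb mul1r.
  apply: le_trans (ler_norm_sum _ _ _) _; apply: ler_sum => i _.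
  by rewrite (bigD1 f.1)//= lerDl sumr_ge0.
pose U w := Num.max (n%:R^-1 * (D (cz w) - Err w)) 0.
have mU : measurable_fun setT U.
  apply: measurable_maxr => //; apply: measurable_funM => //.
  exact: measurable_funB.
have U0 w : 0 <= U w by rewrite le_max lexx orbT.
have EU : (\int[Pr]_w (U w)%:E <= dev%:E)%E.
  apply: le_trans hdev; apply: ge0_le_integral_any => w; rewrite lee_fin//.
  by rewrite ge_max normr_ge0 andbT mulrC ler_pdivrMr// lerBlDr mulrC; exact: point.
have DU w : D (cz w) <= n%:R * U w + Err w.
  rewrite -lerBlDr mulrC -ler_pdivrMr// mulrC.
  by rewrite le_max lexx.
have D0 w : 0 <= D (cz w).
  have h1 := le_maxf j0 (fun f => \sum_(i < n) W f (cz w i)) (ord0, true).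
  have h2 := le_maxf j0 (fun f => \sum_(i < n) W f (cz w i)) (ord0, false).
  have : \sum_(i < n) W (ord0, true) (cz w i) = - \sum_(i < n) W (ord0, false) (cz w i).
    rewrite -sumrN; apply: eq_bigr => i _; rewrite /coded_functional /sgb /=.
    by rewrite expr1 expr0 mulN1r mul1r.
  by rewrite /D; lra.
rewrite -lee_fin -ED.
apply: (@le_trans _ _ (\int[Pr]_w (n%:R%:E * (U w)%:E + (Err w)%:E))%E).
  by apply: ge0_le_integral_any => w; rewrite -?EFinM -?EFinD lee_fin.
rewrite ge0_integralD//; last 4 first.
- by move=> w _; rewrite -EFinM lee_fin mulr_ge0.
- by apply: measurable_funeM; exact/measurable_EFinP.
- by move=> w _; rewrite lee_fin.
- exact/measurable_EFinP.
rewrite ge0_integralZl//; last 2 first.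
- exact/measurable_EFinP.
- by move=> w _; rewrite lee_fin.
by rewrite mulrDr EFinD EFinM; apply: leeD => //; apply: lee_wpmul2l => //; rewrite lee_fin.
Qed.

End Coding.
End OneSample.

Context d (Om : measurableType d) (Pr : probability Om R).
Context (Z : 'I_n -> {RV Pr >-> borel X}) (ZP : iid P Z).

(** The two samples Z and Z' may live on different spaces: both have the same
    coded law, under which [finite_sample_good] applies. Z provides the event,
    Z' the deviation of the sample mean. *)
Lemma sample_event d' (Om' : measurableType d') (Pr' : probability Om' R)
    (Z' : 'I_n -> {RV Pr' >-> borel X}) (Z'P : iid P Z')
    (N K0 t : nat) (M dev eta r q L l : R) :
  (0 < t)%N -> 0 < M -> 0 < eta -> 1 <= r -> nu P r \is a fin_num ->
  1 <= q <= 2 -> nu P q \is a fin_num -> 0 < l -> l <= L ->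
  (expected_deviation Z' (mean P) <= dev%:E)%E ->
  2 * (13 * n%:R / t%:R) `^ r^-1 * fine (nu P r) <= M ->
  4 / M * (2 * (n%:R * (dev + eta)) + n%:R * eta) <= t%:R / 24 ->
  exists (K : nat) (G : set Om), [/\ (K0 <= K)%N, measurable G,
    ((1 - expR (- t%:R) - expR (- l))%:E <= Pr G)%E &
    forall w, G w -> forall j, (j <= N)%N ->
      (#|[pred i | (M < `|disc K (V j (Z i w))|)%R]| <= t)%N /\
      `|\sum_(i < n) clip M (disc K (V j (Z i w)))| <=
        sum_level n t (dev + eta) eta M
          (fine (nu P q) * (L / n%:R) `^ (1 - q^-1)) l].
Proof.
move=> t0 M0 eta0 r1 rfin q12 qfin l0 lL hdev levM levA.
have N0 : 0 < N.+1%:R :> R by rewrite ltr0n.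
have [K K0K KP] := @uniform_discretization N K0 (eta / N.+1%:R) (divr_gt0 eta0 N0).
have [vals valsP] := disc_finite K.
pose cd := @code N K vals valsP.
have mcode : forall a, measurable (cd @^-1` [set a]) by exact: measurable_code.
pose p := law P cd; have pP : pmf p by exact: law_pmf.
pose W := @coded_functional N vals.
have fine_nu_ge0 s : 0 <= fine (nu P s).
  by rewrite fine_ge0// nu_ge0.
have eN : eta / N.+1%:R <= eta by rewrite ler_pdivrMr// ler_peMr ?(ltW eta0) ?ler1n.
have jN (f : 'I_N.+1 * bool) : (f.1 <= N)%N by rewrite -ltnS.
have q1 : 1 <= q by case/andP: q12.
have good := @finite_sample_good R _ n p pP _ (ord0, true) W (fun f => (f.1, ~~ f.2))
  t M (dev + eta) eta (fine (nu P r)) r (fine (nu P q)) q L l n_gt0 t0 M0.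
have {}good := good _ _ _ (fine_nu_ge0 r) r1 _ (fine_nu_ge0 q) q12 _ l0 lL levM levA.
exists K.
pose ok (x : {ffun 'I_n -> {ffun 'I_N.+1 -> seq_sub vals}}) :=
  [forall f, (#|[pred i | (M < `|W f (x i)|)%R]| <= t)%N &&
      (`|\sum_(i < n) clip M (W f (x i))| <=
         sum_level n t (dev + eta) eta M (fine (nu P q) * (L / n%:R) `^ (1 - q^-1)) l)].
exists (coded Z cd @^-1` [set x | ok x]); split=> //.
- exact: measurable_finite_preimage (measurable_coded Z mcode) ok.
- rewrite (probability_finite_preimage Pr (measurable_coded Z mcode)) lee_fin.
  rewrite (_ : expect _ _ = expect (prodw p : {ffun 'I_n -> _} -> R) (fun x => (ok x)%:R)).
    apply: good.
    + by move=> [j b] y; rewrite /W /coded_functional /sgb /=; case: b; rewrite /= ?expr0 ?expr1; ring.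
    + by move=> f; apply: le_trans eN; apply: coded_bias; exact: KP.
    + exact: (coded_deviation Z'P valsP (ltW eta0) KP hdev).
    + move=> f; apply: coded_moment; first by lra.
      by apply: moment_centred => //.
    + move=> f; apply: coded_moment; first by lra.
      by apply: moment_centred => //.
  by apply: eq_bigr => x _; rewrite (coded_law ZP mcode).
- move=> w /forallP Gw j jN'.
  have := Gw (Ordinal (jN' : (j < N.+1)%N), false).
  have WE i : W (Ordinal (jN' : (j < N.+1)%N), false) (coded Z cd w i) = disc K (V j (Z i w)).
    by rewrite ffunE /W /cd coded_functionalE /sgb expr0 mul1r.
  move=> /andP[cnt sm]; split.
    by apply: leq_trans cnt; rewrite leq_eqVlt; apply/orP; left; apply/eqP/eq_card => i;
      rewrite !inE WE.
  by move: sm; under eq_bigr do rewrite WE.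
Qed.

End SampleEvent.

(** * The good event at a given precision *)

Section ErrorTerms.
Context (R : realType) (X : normedModType R) (P : probability (borel X) R).

Lemma rate_ge0 (S : set R) (s : R) :
  (0 <= ereal_inf [set (nu P q * (s `^ (1 - q^-1))%:E)%E | q in S])%E.
Proof.
apply: le_ereal_inf_tmp => _ [q _ <-].
by rewrite mule_ge0 ?nu_ge0// lee_fin powR_ge0.
Qed.

Lemma rate_attained (S : set R) (s c zeta : R) : 0 < s -> 0 < zeta ->
  ereal_inf [set (nu P q * (s `^ (1 - q^-1))%:E)%E | q in S] = c%:E ->
  exists q, [/\ S q, nu P q \is a fin_num &
    fine (nu P q) * s `^ (1 - q^-1) <= c + zeta].
Proof.
move=> s0 z0 cE.
have [_ [q Sq <-]] : exists2 y, [set (nu P q * (s `^ (1 - q^-1))%:E)%E | q in S] y &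
    (y < (c + zeta)%:E)%E.
  by apply: ereal_inf_lt; rewrite cE lte_fin ltrDl.
have sp : 0 < s `^ (1 - q^-1) by exact: powR_gt0.
case E : (nu P q) => [v||]; last by have := nu_ge0 P q; rewrite E.
  by rewrite -EFinM lte_fin => /ltW h; exists q; rewrite E.
by rewrite gt0_mulye ?lte_fin// ltNge leey.
Qed.

End ErrorTerms.

Section Precision.
Context (R : realType) (X : normedModType R) (P : probability (borel X) R).
Hypothesis P_integrable : (\int[P]_x `|(x : X)|%:E < +oo)%E.
Hypothesis X_reflexive : reflexive_space X.
Context (disc : nat -> R -> R).
Hypothesis mdisc : forall K, measurable_fun [set: R] (disc K).
Hypothesis disc_finite : forall K, exists vals : seq R, forall x, disc K x \in vals.
Hypothesis disc_le : forall K x, `|disc K x| <= `|x|.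
Hypothesis disc_cvg : forall x, disc K x @[K --> \oo] --> x.
Context (F : nat -> X -> R^o) (FB : forall j, dual_ball (F j)).
Context (n : nat) (n_gt0 : (0 < n)%N).
Context d (Om : measurableType d) (Pr : probability Om R).
Context (Z : 'I_n -> {RV Pr >-> borel X}) (ZP : iid P Z).
Context d' (Om' : measurableType d') (Pr' : probability Om' R).
Context (Z' : 'I_n -> {RV Pr' >-> borel X}) (Z'P : iid P Z').
Context (eps alpha : R) (eps_bounds : 0 <= eps < 2^-1).
Context (alpha_bounds : 0 < alpha < 1).
Context (dev fl ct : R) (devE : expected_deviation Z' (mean P) = dev%:E).
Hypothesis flE : fluctuation_term P n alpha = fl%:E.
Hypothesis ctE : contamination_term P eps = ct%:E.

Local Notation V j := (@centred _ _ P (F j)).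
Local Notation limit_error := (384 * (1 + ratio eps) * (8 * dev + fl + ct)).
Local Notation slack := (768 * (1 + ratio eps) + 130).

(** At precision zeta the exponents p and q nearly attain their infima, and only
    finitely many discretized functionals are considered. The level M uses the
    exponent q when the logarithm makes up t, and p when eps does, so that
    [level_rate] applies with s = ln (3 / alpha) / n or with s = eps. *)
Lemma precision_event (e t N : nat) (zeta : R) : 0 < zeta ->
  (0 < t)%N -> (2 * (e + t) < n)%N -> ln (2 / alpha) <= t%:R ->
  e%:R <= 2 * ratio eps * t%:R -> ((4 * (e + t) < n)%N -> ratio eps = 1) ->
  t%:R <= 2 * ln (3 / alpha) \/ 0 < eps /\ t%:R <= eps * n%:R ->
  exists (K : nat) (G : set Om) (M B : R),
    [/\ (N <= K)%N, measurable G, ((1 - alpha)%:E <= Pr G)%E,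
      0 < M & [/\ (n <= 4 * (e + t))%N -> M <= limit_error + slack * zeta,
      (4 * (e + t) < n)%N ->
        B + 2 * (e + t + e)%:R * M <= (n - 2 * (e + t))%:R * (limit_error + slack * zeta) &
    forall w, G w -> forall j, (j <= N)%N ->
      (#|[pred i | (M < `|disc K (V j (Z i w))|)%R]| <= t)%N /\
      `|\sum_(i < n) clip M (disc K (V j (Z i w)))| <= B]].
Proof.
move=> z0 t0 k2 lt_ er r4 tcase.
have n0R : 0 < n%:R :> R by rewrite ltr0n.
have t0R : 0 < t%:R :> R by rewrite ltr0n.
have [l0 lL L0] := ln_alpha_spec alpha_bounds.
set l := ln (2 / alpha) in lt_ l0 lL; set L := ln (3 / alpha) in tcase lL L0.
have dev0 : 0 <= dev by rewrite -lee_fin -devE integral_ge0.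
have [q [/andP[q1 q2] qfin qle]] := rate_attained (divr_gt0 L0 n0R) z0 flE.
set D := fine (nu P q) * _ in qle.
have nu0 s : 0 <= fine (nu P s) by rewrite fine_ge0// nu_ge0.
have D0 : 0 <= D by rewrite mulr_ge0 ?powR_ge0.
have [G0 [r [s [r1 rfin ts Hle]]]] : exists (G0 r s : R), [/\ 1 <= r, nu P r \is a fin_num,
    t%:R <= 2 * (s * n%:R) & [/\ 0 <= G0, G0 <= ct + zeta &
      fine (nu P r) * s `^ (1 - r^-1) <= D + G0]].
  case: tcase => [tL|[eps0 te]].
    exists 0, q, (L / n%:R); split=> //; first by rewrite divfK// gt_eqF.
    split=> //; last by rewrite addr0.
    by rewrite addr_ge0 ?(ltW z0)// -lee_fin -ctE /contamination_term;
      case: ifP => // _; exact: rate_ge0.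
  have ctE' := ctE; rewrite /contamination_term gt_eqF// in ctE'.
  have [p [p1 pfin ple]] := rate_attained eps0 z0 ctE'.
  exists (fine (nu P p) * eps `^ (1 - p^-1)), p, eps; split=> //.
    by have : 0 <= eps * n%:R by [rewrite mulr_ge0 ?ler0n ?(ltW eps0)]; lra.
  by split=> //; [rewrite mulr_ge0 ?powR_ge0|rewrite lerDr].
have [G00 Gct Hle'] := Hle.
set H := fine (nu P r) * s `^ (1 - r^-1) in Hle'.
set W := 2 * (13 * n%:R / t%:R) `^ r^-1 * fine (nu P r).
have W0 : 0 <= W by rewrite !mulr_ge0 ?powR_ge0.
have WH : W * (t%:R / n%:R) <= 26 * H by exact: level_rate.
set M := 224 * dev * (n%:R / t%:R) + W + zeta.
have M0 : 0 < M.
  by rewrite ltr_wpDl// addr_ge0// mulr_ge0 ?divr_ge0 ?mulr_ge0 ?ler0n.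
(* The second entry keeps the bias below the slack between t / 24 and t / 28. *)
pose eta := Num.min zeta (M * t%:R / (2016 * n%:R)).
have eta0 : 0 < eta by rewrite lt_min z0 divr_gt0 ?mulr_gt0 ?ltr0n.
have etaz : 0 <= eta <= zeta by rewrite (ltW eta0) ge_min lexx.
have levM : W <= M by rewrite /M; have := mulr_ge0 (mulr_ge0 (ler0n R 224) dev0) (divr_ge0 (ltW n0R) (ltW t0R)); lra.
have levA : 4 / M * (2 * (n%:R * (dev + eta)) + n%:R * eta) <= t%:R / 24.
  rewrite mulrAC ler_pdivrMr//.
  have h1 : eta * (2016 * n%:R) <= M * t%:R.
    by rewrite -ler_pdivlMr ?mulr_gt0 ?ltr0n// ge_min lexx orbT.
  have h2 : 224 * dev * n%:R <= M * t%:R.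
    have -> : M * t%:R = 224 * dev * n%:R + W * t%:R + zeta * t%:R.
      by rewrite /M; field; rewrite gt_eqF.
    by have := mulr_ge0 W0 (ltW t0R); have := mulr_ge0 (ltW z0) (ltW t0R); lra.
  by lra.
have hdev : (expected_deviation Z' (mean P) <= dev%:E)%E by rewrite devE.
have q12 : 1 <= q <= 2 by rewrite q1.
have [K [G [NK mG PG GP]]] := sample_event P_integrable X_reflexive mdisc disc_finite
  disc_le disc_cvg FB n_gt0 ZP Z'P N N t0 M0 eta0 r1 rfin q12 qfin l0 lL hdev levM levA.
have [case1 case2] := error_budget n_gt0 t0 k2 dev0 D0 G00 Hle' W0 WH
  (ratio_ge1 eps_bounds) er r4 (ltW l0) lt_ etaz.
have rat1 := ratio_ge1 eps_bounds.
have budget : 384 * (1 + ratio eps) * (8 * dev + D + G0) + 130 * zeta <=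
    limit_error + slack * zeta.
  have : 384 * (1 + ratio eps) * (8 * dev + D + G0) <=
      384 * (1 + ratio eps) * (8 * dev + fl + ct + 2 * zeta).
    by rewrite ler_wpM2l ?mulr_ge0 ?ler0n//; lra.
  by lra.
exists K, G, M, (sum_level n t (dev + eta) eta M D l); split=> //.
  apply: le_trans PG; rewrite lee_fin.
  have a0 : 0 < alpha by case/andP: alpha_bounds.
  have el : expR (- l) = alpha / 2.
    by rewrite expRN lnK ?posrE ?divr_gt0// invf_div.
  have et : expR (- t%:R) <= expR (- l) by rewrite ler_expR lerN2.
  by rewrite el in et *; lra.
split=> [/case1|/case2|//]; first by move=> /le_trans; apply.
move=> h; apply: le_trans (_ : _ <= (n - 2 * (e + t))%:R *
  (384 * (1 + ratio eps) * (8 * dev + D + G0) + 130 * zeta)) _; first exact: h.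
by rewrite ler_wpM2l.
Qed.

End Precision.

(** * The trimmed-mean estimator *)

Section LimsupEvent.
Context d (Om : measurableType d) (R : realType) (Pr : probability Om R).

Lemma probability_lim_sup_set (G : nat -> set Om) (c : R) :
  (forall N, measurable (G N)) -> (forall N, (c%:E <= Pr (G N))%E) ->
  measurable (lim_sup_set G) /\ (c%:E <= Pr (lim_sup_set G))%E.
Proof.
move=> mG cG.
have mU N : measurable (\bigcup_(k >= N) G k) by apply: bigcup_measurable.
split; first exact: bigcapT_measurable.
have /cvg_lim <- // := lim_sup_set_cvg Pr G mG
  (le_lt_trans (probability_le1 Pr (mU 0%N)) (ltry 1)).
apply: lime_ge.
  by apply/cvg_ex; exists (Pr (lim_sup_set G)); apply: lim_sup_set_cvg => //;
    exact: le_lt_trans (probability_le1 Pr (mU 0%N)) (ltry 1).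
apply: nearW => N; apply: le_trans (cG N) _.
by apply: le_measure; rewrite ?inE// => w Gw; exists N => /=.
Qed.

Lemma inner_probability_ge (A E : set Om) (c : R) :
  measurable E -> (c%:E <= Pr E)%E ->
  {ae Pr, forall w, E w -> A w} -> (c%:E <= inner_probability Pr A)%E.
Proof.
move=> mE cE [N0 [mN0 N00 subN]].
apply: (@le_trans _ _ (Pr (E `\` N0))).
  have EN0 : Pr (E `&` N0) = 0%E.
    by apply: (@subset_measure0 _ _ _ _ _ N0) => //; exact: measurableI.
  have DI : Pr E = (Pr (E `\` N0) + Pr (E `&` N0))%E := measureDI Pr mE mN0.
  by apply: le_trans cE _; rewrite DI EN0 adde0.
apply: ereal_sup_ubound; exists (E `\` N0) => //; split; first exact: measurableD.
move=> w [Ew nNw]; apply: contrapT => nA; apply: nNw; apply: subN => /= H.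
exact/nA/H.
Qed.

End LimsupEvent.

Section ErrorAlgebra.
Context (R : realType).
Implicit Types (x y z kap M B c d : R).

Lemma slack_gt0 r : 1 <= r -> 0 < 768 * (1 + r) + 130 :> R.
Proof. by move=> r1; lra. Qed.

Lemma ler_dist_via x y z kap : `|z - x| <= kap -> `|y - z| <= kap ->
  `|x - y| <= 2 * kap.
Proof.
move=> zx yz; rewrite (_ : x - y = - (z - x) - (y - z)); last by ring.
by apply: le_trans (ler_normB _ _) _; rewrite normrN; lra.
Qed.

(** From the raw trimmed-sum bound to an error in units of the precision: d is
    the number of retained observations, at least half of the sample size n. *)
Lemma retained_error d n m M B c zeta kap S S' T : 0 < d -> n <= 2 * d ->
  m <= n -> 0 <= kap -> zeta <= kap -> 0 <= c ->
  d * T <= S + 2 * n * (2 * kap) + 2 * m * (M + 2 * kap) -> S <= S' ->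
  S' + 2 * m * M <= d * (B + c * zeta) -> T <= B + (c + 24) * kap.
Proof.
move=> d0 nd mn kap0 zk c0 dT SS' SB; rewrite -(ler_pM2l d0).
have h1 : d * (c * zeta) <= d * (c * kap) by rewrite !ler_wpM2l// ltW.
have h2 := ler_wpM2r kap0 nd; have h3 := ler_wpM2r kap0 mn.
by have h4 := mulr_ge0 (ltW d0) kap0; lra.
Qed.

Lemma level_error M B c zeta kap T : 0 <= kap -> zeta <= kap -> 0 <= c ->
  T <= M + 2 * kap -> M <= B + c * zeta -> T <= B + (c + 24) * kap.
Proof. by move=> kap0 zk c0 TM MB; have := ler_wpM2l c0 zk; lra. Qed.

End ErrorAlgebra.

Section Estimator.
Context (R : realType) (X : normedModType R) (n k : nat).

(** The minimiser has no larger loss than m itself, and a norming functional of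
    muhat x - m compares the two through the trimmed mean. *)
Lemma trimmed_estimator_error (muhat : ('I_n -> X) -> X) (x : 'I_n -> X) (m : X) (B : R) :
  is_trimmed_estimator k muhat ->
  (forall f, dual_ball f -> `|trimmed_mean k f x - f m| <= B) ->
  `|muhat x - m| <= 2 * B.
Proof.
move=> est fB; have [f fball fE] := norming_functional (muhat x - m).
have lf : linear f by case: fball => -[].
have loss_m : (trimmed_loss k x m <= B%:E)%E.
  by apply: ge_ereal_sup => _ [g gb <-]; rewrite lee_fin fB.
have loss_hat : (`|trimmed_mean k f x - f (muhat x)|%:E <= trimmed_loss k x (muhat x))%E.
  by apply: ereal_sup_ubound; exists f.
have := le_trans (le_trans loss_hat (est x m)) loss_m; rewrite lee_fin => h1.
have h2 := fB f fball.
rewrite -fE linear_funB//; have := ler_norm (f (muhat x) - f m).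
have := ler_normB (trimmed_mean k f x - f m) (trimmed_mean k f x - f (muhat x)).
rewrite (_ : _ - _ - _ = f (muhat x) - f m); last by ring.
lra.
Qed.

End Estimator.

Theorem theorem4p1 (R : realType) (X : completeNormedModType R)
    (X_separable : separable_space X) (X_reflexive : reflexive_space X)
    (n : nat) (n_gt0 : (0 < n)%N)
    (eps alpha : R) (eps_bounds : 0 <= eps < 2^-1)
    (alpha_bounds : 0 < alpha < 1)
    (muhat : nat -> ('I_n -> X) -> X)
    (muhat_argmin : forall k : nat, (1 <= k)%N -> (2 * k < n)%N ->
       is_trimmed_estimator k (muhat k))
    (phi_lt : phi n eps alpha < 2^-1)
    (P : probability (borel X) R)
    (P_integrable : (\int[P]_x `|(x : X)|%:E < +oo)%E)
    (d : measure_display) (Omega : measurableType d)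
    (Pr : probability Omega R)
    (Y : 'I_n -> {RV Pr >-> borel X})
    (Y_contaminated : contaminated_iid eps P Y)
    (d' : measure_display) (Omega' : measurableType d')
    (Pr' : probability Omega' R)
    (Z : 'I_n -> {RV Pr' >-> borel X})
    (Z_iid : iid P Z) :
  ((1 - alpha)%:E <=
   inner_probability Pr
     [set w | `|muhat (trim_level n eps alpha) (fun i => Y i w) - mean P|%:E
              <= error_bound P n eps alpha
                   (expected_deviation Z (mean P))])%E.
Proof.
have a0 : 0 < alpha by case/andP: alpha_bounds.
have rat1 := ratio_ge1 eps_bounds.
have C0 : 0 < 2 * C_const eps by rewrite C_constE !mulr_gt0 ?ltr0n//; lra.
have dev0 : (0 <= expected_deviation Z (mean P))%E by rewrite integral_ge0.
have fl0 : (0 <= fluctuation_term P n alpha)%E by exact: rate_ge0.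
have ct0 : (0 <= contamination_term P eps)%E.
  by rewrite /contamination_term; case: ifP => _; [exact: lexx|exact: rate_ge0].
(* If one of the three error terms is infinite, so is the bound. *)
have trivial_bound : error_bound P n eps alpha (expected_deviation Z (mean P)) = +oo%E ->
  ((1 - alpha)%:E <= inner_probability Pr
     [set w | `|muhat (trim_level n eps alpha) (fun i => Y i w) - mean P|%:E
       <= error_bound P n eps alpha (expected_deviation Z (mean P))])%E.
  move=> ->; apply: (inner_probability_ge measurableT); last first.
    by apply/aeW => w _; exact: leey.
  by rewrite probability_setT lee_fin; lra.
case devE : (expected_deviation Z (mean P)) dev0 => [dev||] // dev0; last first.
  rewrite -devE; apply: trivial_bound; rewrite devE /error_bound gt0_muley ?lte_fin ?ltr0n//.
  rewrite addye ?addye ?gt0_muley ?lte_fin//.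
  - by rewrite gt_eqF// (lt_le_trans _ ct0) ?ltNy0.
  - by rewrite gt_eqF// (lt_le_trans _ fl0) ?ltNy0.
case flE : (fluctuation_term P n alpha) fl0 => [fl||] // fl0; last first.
  rewrite -devE; apply: trivial_bound; rewrite devE /error_bound flE -EFinM.
  rewrite addey// addye ?gt0_muley ?lte_fin//.
  by rewrite gt_eqF// (lt_le_trans _ ct0) ?ltNy0.
case ctE : (contamination_term P eps) ct0 => [ct||] // ct0; last first.
  rewrite -devE; apply: trivial_bound; rewrite devE /error_bound flE ctE -EFinM.
  by rewrite addey// gt0_muley ?lte_fin.
rewrite !lee_fin in dev0 fl0 ct0.
pose B := 384 * (1 + ratio eps) * (8 * dev + fl + ct).
have boundE : error_bound P n eps alpha dev%:E = (2 * B)%:E.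
  have -> : 2 * B = 2 * C_const eps * (8 * dev + fl + ct) by rewrite C_constE /B; ring.
  rewrite /error_bound flE ctE; move: (2 * C_const eps) => A.
  by rewrite (EFinM A) !EFinD EFinM.
have [e [t [kE k2 t0 [eP lt_ er r4 tcase]]]] :=
  trim_level_spec n_gt0 eps_bounds alpha_bounds phi_lt.
rewrite boundE kE.
have [disc [mdisc disc_finite disc_le disc_cvg]] := finite_discretization R.
have [F [FB Fdense]] := dual_ball_separable n X_separable.
have [W W_iid YW] := Y_contaminated.
pose zeta N : R := N.+1%:R^-1.
have zeta0 N : 0 < zeta N by rewrite invr_gt0.
have ev N := precision_event P_integrable X_reflexive mdisc disc_finite disc_le disc_cvg
  FB n_gt0 W_iid Z_iid eps_bounds alpha_bounds devE flE ctE N (zeta0 N) t0 k2 lt_ er r4 tcase.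
have /choice[K /choice[G /choice[M /choice[S GP]]]] : forall N, exists K G M S,
  [/\ (N <= K)%N, measurable G, ((1 - alpha)%:E <= Pr G)%E,
      0 < M & [/\ (n <= 4 * (e + t))%N -> M <= B + (768 * (1 + ratio eps) + 130) * zeta N,
      (4 * (e + t) < n)%N ->
        S + 2 * (e + t + e)%:R * M <=
          (n - 2 * (e + t))%:R * (B + (768 * (1 + ratio eps) + 130) * zeta N) &
    forall w, G w -> forall j, (j <= N)%N ->
      (#|[pred i | (M < `|disc K (centred P (F j) (W i w))|)%R]| <= t)%N /\
      `|\sum_(i < n) clip M (disc K (centred P (F j) (W i w)))| <= S]] by exact: ev.
(* The event is that infinitely many of the precisions 1 / (N + 1) succeed: for
   a given functional and sample, one of them uses a close enough member of the
   dense family, discretized finely enough. *)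
have [mE PE] := probability_lim_sup_set (fun N => let: And5 _ mG _ _ _ := GP N in mG)
  (fun N => let: And5 _ _ PG _ _ := GP N in PG).
apply: (inner_probability_ge mE PE).
case: YW => N0 [mN0 N00 subN]; exists N0; split=> //.
apply: subset_trans subN => w /= H cont; apply: H => Ew.
rewrite lee_fin; apply: trimmed_estimator_error; first by apply: muhat_argmin => //; rewrite addn_gt0 t0 orbT.
move=> f fB; apply/ler_addgt0Pr => del del0.
pose c := 768 * (1 + ratio eps) + 130 : R.
have c0 : 0 < c := slack_gt0 rat1.
pose kap := del / (c + 24).
have ck0 : 0 < c + 24 by rewrite addr_gt0 ?ltr0n.
have kap0 : 0 < kap by rewrite divr_gt0.
have [j jP] := Fdense f (fun i => (W i w : X) - mean P) kap fB kap0.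
have [N1 N1P] : exists N1 : nat, forall N i, (N1 <= N)%N ->
    `|disc N (centred P (F j) (W i w)) - centred P (F j) (W i w)| <= kap.
  have conv i : exists N1, forall N, (N1 <= N)%N ->
      `|disc N (centred P (F j) (W i w)) - centred P (F j) (W i w)| <= kap.
    have /cvgrPdist_le/(_ kap kap0)[N1 _ N1P] := disc_cvg (centred P (F j) (W i w)).
    by exists N1 => N N1N; rewrite distrC; exact: N1P.
  have [h hP] := choice conv.
  exists (\max_(i < n) h i)%N => N i hN; apply: hP; apply: leq_trans hN.
  exact: (leq_bigmax (F := h) i).
have [N2 N2P] : exists N2, forall N, (N2 <= N)%N -> zeta N <= kap.
  have [N2 _ N2P] := near_infty_natSinv_lt (PosNum kap0).
  by exists N2 => N N2N; apply/ltW; exact: N2P.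
have [N /= NP GN] := Ew (maxn j (maxn N1 N2)) I.
have [jN [N1N N2N]] : (j <= N)%N /\ (N1 <= N)%N /\ (N2 <= N)%N.
  by move: NP; rewrite !geq_max => /and3P[-> -> ->].
have [NK _ _ M0 [case1 case2 good]] := GP N.
have [cnt sm] := good w GN j jN.
have zk := N2P N N2N.
have lf : linear f by case: fB => -[].
have close i : `|f ((W i w : X) - mean P) - disc (K N) (centred P (F j) (W i w))| <= 2 * kap.
  have h1 := jP i; have h2 := N1P (K N) i (leq_trans N1N NK).
  exact: ler_dist_via h1 h2.
have kap2 : 0 <= 2 * kap by rewrite mulr_ge0 ?ler0n// ltW.
have diff : (#|[pred i | (f (Y i w) - f (mean P) != f ((W i w : X) - mean P))%R]| <= e)%N.
  apply: leq_trans (eP _ cont); apply: subset_leq_card; apply/fintype.subsetP => i.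
  by rewrite !inE linear_funB//; apply: contra_neq => ->.
have [T1 T2] := trimmed_mean_stable erefl k2 (ltW M0) kap2 close diff cnt.
have -> : del = (c + 24) * kap by rewrite /kap mulrC divfK ?gt_eqF.
have [k4|k4] := leqP n (4 * (e + t)).
  exact: level_error (ltW kap0) zk (ltW c0) T1 (case1 k4).
apply: retained_error (ltW kap0) zk (ltW c0) T2 sm (case2 k4).
- by rewrite ltr0n subn_gt0.
- by rewrite -natrM ler_nat; move: k2 k4; clear; lia.
- by rewrite ler_nat; move: k2; clear; lia.
Qed.
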